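(* Let $X$ be a countable set, $m:X\to(0,\infty)$ a measure of full support, $(b,c)$ a graph over $X$, and $\mathcal{E}_{b,c,m}$ the associated regular Dirichlet form on $\ell^2(X,m)$ with generator $\mathcal{L}=\mathcal{L}_{b,c,m}$. Assume additionally that $m$ is bounded below by a positive constant. Then $\mathcal{L}$ is spatially locally compact. In particular: (a) for every set $B\subset X$ of finite capacity and $G:=X\setminus B$, the operator $\varphi(\mathcal{L}_G)-\varphi(\mathcal{L})$ is compact for every $\varphi\in C_0(\mathbb{R})$, and $\sigma_{ess}(\mathcal{L}_G)=\sigma_{ess}(\mathcal{L})$; (b) $\inf\sigma_{ess}(\mathcal{L})=\lim_{K\to X}\inf\sigma(\mathcal{L}_{X\setminus K})$, where the limit is taken along the net of finite subsets $K$ of $X$.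
   Context: $X$ carries the discrete topology, and $m$ is regarded as a measure via $m(E)=\sum_{x\in E}m(x)$. A graph over $X$ is a pair $(b,c)$ of maps $c:X\to[0,\infty)$ and $b:X\times X\to[0,\infty)$ with $b(x,x)=0$, $b(x,y)=b(y,x)$ for all $x,y\in X$ and $\sum_{y\in X}b(x,y)<\infty$ for all $x\in X$. On the space $C_c(X)$ of real-valued functions with finite support put $$\mathcal{E}^{\rm comp}_{b,c}(u,v)=\frac12\sum_{x,y\in X}b(x,y)(u(x)-u(y))(v(x)-v(y))+\sum_{x\in X}c(x)u(x)v(x).$$ This form is closable in $\ell^2(X,m)$ and its closure is the regular Dirichlet form $\mathcal{E}=\mathcal{E}_{b,c,m}$, with domain $\mathcal{D}$; $\mathcal{L}_{b,c,m}\ge 0$ is the associated selfadjoint operator. $\mathcal{L}$ is spatially locally compact if $\mathbf{1}_E e^{-\mathcal{L}}$ is a compact operator for every $E\subset X$ with $m(E)<\infty$. Capacity: $\operatorname{cap}(U)=\inf\{(\mathcal{E}(v,v)+\|v\|^2)^{1/2}:v\in\mathcal{D},\ \mathbf{1}_U\le v\}$ for $U\subset X$, with $\inf\emptyset=\infty$ (every subset of $X$ is open and closed). For $U\subset X$, $\mathcal{L}_U$ is the selfadjoint operator on $\ell^2(U,m)$ associated with the restriction of $\mathcal{E}$ to the closure of $C_c(U)$ with respect to $(\mathcal{E}(u,u)+\|u\|^2)^{1/2}$. For $\varphi\in C_0(\mathbb{R})$ (continuous functions vanishing at infinity), $\varphi(\mathcal{L}_U)$ is regarded as an operator on $\ell^2(X,m)$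 by extending it by $0$ on $\ell^2(X\setminus U,m)$. $\sigma$ is the spectrum and $\sigma_{ess}$ the essential spectrum (the complement in the spectrum of the isolated eigenvalues of finite multiplicity), taken in the respective Hilbert spaces. *)

(* Defs.v *)
From mathcomp Require Import all_boot all_order all_algebra finmap.
From mathcomp Require Import all_classical all_reals all_analysis.
From mathcomp Require summability.

Set Implicit Arguments.
Unset Strict Implicit.
Unset Printing Implicit Defensive.

Import Order.TTheory GRing.Theory Num.Theory.
Import numFieldNormedType.Exports.

Local Open Scope classical_set_scope.
Local Open Scope ring_scope.

(* Everything is real: l^2(X, m) is the real Hilbert space of functions
   X -> R, and C_0(R) consists of real-valued functions. For U a subset of X,
   l^2(U, m) is identified with the closed subspace of those functions in
   l^2(X, m) which vanish off U; operators in l^2(U, m) are given either by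
   their graph (unbounded ones) or by a map (X -> R) -> (X -> R) of which only
   the values on l^2(U, m) are relevant (everywhere defined ones). *)

(* Sum of an absolutely summable real family. *)
Definition rsum {R : realType} {T : choiceType} (f : T -> R) : R :=
  fine (\esum_(t in setT) ((EFin \o f)^\+ t) -
        \esum_(t in setT) ((EFin \o f)^\- t))%E.

Section l2.
Context {R : realType} {X : countType}.
Implicit Types (m u v f g : X -> R) (U E : set X).
Implicit Types (A : (X -> R) -> (X -> R)) (L : set ((X -> R) * (X -> R))).

Definition mass m E : \bar R := (\esum_(x in E) (m x)%:E)%E.

Definition l2 m U : set (X -> R) :=
  [set u | (\esum_(x in setT) (m x * u x ^+ 2)%:E < +oo)%E /\
           forall x, ~ U x -> u x = 0].

Definition l2dot m u v : R := rsum (fun x => m x * u x * v x).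

Definition l2norm m u : R := Num.sqrt (l2dot m u u).

Definition l2cvg m (un : nat -> X -> R) u : Prop :=
  l2norm m (un n - u) @[n --> \oo] --> 0.

Definition bounded_op m U A : Prop :=
  [/\ forall f, l2 m U f -> l2 m U (A f),
      forall a f g, l2 m U f -> l2 m U g ->
        A (a \*o f + g) = a \*o A f + A g
    & exists C, forall f, l2 m U f -> l2norm m (A f) <= C * l2norm m f].

(* Compact operators on l^2(X, m): bounded sequences are mapped to sequences
   having a convergent subsequence. *)
Definition compact_op m A : Prop :=
  bounded_op m setT A /\
  forall un : nat -> X -> R,
    (forall n, l2 m setT (un n)) ->
    (exists C, forall n, l2norm m (un n) <= C) ->
    exists k : nat -> nat, {homo k : i j / (i < j)%N} /\
      exists2 g, l2 m setT g & l2cvg m (A \o un \o k) g.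

Definition extend0 U A : (X -> R) -> (X -> R) := fun f => A (\1_U \* f).

(* Spectral theory of an operator in l^2(U, m) with graph L. The operators
   considered are selfadjoint, so that their spectrum is real. *)

Definition resolvent_set m U L : set R :=
  [set l | (forall f, l2 m U f -> exists! u, L (u, f + l \*o u)) /\
           exists C, forall u f, L (u, f) ->
             l2norm m u <= C * l2norm m (f - l \*o u)].

Definition spectrum m U L : set R := ~` resolvent_set m U L.

Definition eigenvalue L : set R :=
  [set l | exists2 u, u != 0 & L (u, l \*o u)].

Definition finite_multiplicity L (l : R) : Prop :=
  exists (n : nat) (e : 'I_n -> X -> R), forall u, L (u, l \*o u) ->
    exists a : 'I_n -> R, u = \sum_(i < n) (a i \*o e i).

Definition ess_spectrum m U L : set R :=
  spectrum m U L `\`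
  [set l | [/\ isolated (spectrum m U L) l, eigenvalue L l
             & finite_multiplicity L l]].

Definition C0 (phi : R -> R) : Prop :=
  [/\ continuous phi, phi x @[x --> +oo] --> 0 & phi x @[x --> -oo] --> 0].

(* The functional calculus of a nonnegative selfadjoint operator L is the
   unique contractive *-homomorphism from C_0(R) to the bounded operators which
   maps phi to (L + a)^-1 whenever a > 0 and phi(x) = (x + a)^-1 on [0, +oo[, a
   set containing the spectrum of L; by the Stone-Weierstrass theorem, it is
   determined by these values. *)
Definition is_functional_calculus m U L
    (Phi : (R -> R) -> (X -> R) -> (X -> R)) : Prop :=
  [/\ forall phi, C0 phi -> bounded_op m U (Phi phi) /\
        forall f g, l2 m U f -> l2 m U g ->
          l2dot m (Phi phi f) g = l2dot m f (Phi phi g),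
      forall (a : R) phi psi f, C0 phi -> C0 psi -> l2 m U f ->
        Phi (a \*o phi + psi) f = a \*o Phi phi f + Phi psi f,
      forall phi psi f, C0 phi -> C0 psi -> l2 m U f ->
        Phi (phi \* psi) f = Phi phi (Phi psi f),
      forall phi C f, C0 phi -> (forall x, `|phi x| <= C) -> l2 m U f ->
        l2norm m (Phi phi f) <= C * l2norm m f
    & forall (a : R) phi f, 0 < a -> C0 phi ->
        (forall x, 0 <= x -> phi x = (x + a)^-1) -> l2 m U f ->
        L (Phi phi f, f - a \*o Phi phi f)].

Definition functional_calculus m U L : (R -> R) -> (X -> R) -> (X -> R) :=
  xget (fun _ f => f) (is_functional_calculus m U L).

(* As L >= 0, the function exp(-|x|) in C_0(R) gives e^{-L}. *)
Definition semigroup1 m U L : (X -> R) -> (X -> R) :=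
  functional_calculus m U L (fun x => expR (- `|x|)).

Definition spatially_locally_compact m L : Prop :=
  forall E, (mass m E < +oo)%E ->
    compact_op m (fun f => \1_E \* semigroup1 m setT L f).

End l2.

Section dirichlet_form.
Context {R : realType} {X : countType}.
Implicit Types (m c u v f : X -> R) (b : X -> X -> R) (U : set X).

Definition is_graph b c : Prop :=
  [/\ forall x, 0 <= c x,
      forall x y, 0 <= b x y,
      forall x, b x x = 0,
      forall x y, b x y = b y x
    & forall x, (\esum_(y in setT) (b x y)%:E < +oo)%E].

(* C_c(U), extended by 0 *)
Definition Cc U : set (X -> R) :=
  [set u | finite_set [set x | u x != 0] /\ forall x, ~ U x -> u x = 0].

Definition form_comp b c u v : R :=
  2^-1 * rsum (fun p : X * X =>
                 b p.1 p.2 * (u p.1 - u p.2) * (v p.1 - v p.2)) +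
  rsum (fun x => c x * u x * v x).

(* (un) is a sequence in C_c(X) which is Cauchy for the form norm and
   converges to u in l^2(X, m). *)
Definition form_approx m b c (un : nat -> X -> R) u : Prop :=
  [/\ forall n, Cc setT (un n),
      forall e : R, 0 < e -> exists N : nat, forall i j : nat,
        (N <= i)%N -> (N <= j)%N ->
        form_comp b c (un i - un j) (un i - un j) +
          l2norm m (un i - un j) ^+ 2 < e
    & l2cvg m un u].

(* The closure of form_comp in l^2(X, m). *)
Definition form_dom m b c : set (X -> R) :=
  [set u | l2 m setT u /\ exists un, form_approx m b c un u].

Definition form m b c u v : R :=
  xget 0 [set l | forall un vn,
    form_approx m b c un u -> form_approx m b c vn v ->
    form_comp b c (un n) (vn n) @[n --> \oo] --> l].

Definition form_norm m b c u : R :=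
  Num.sqrt (form m b c u u + l2norm m u ^+ 2).

(* The closure of C_c(U) in the domain of the form. *)
Definition form_dom_on m b c U : set (X -> R) :=
  [set u | form_dom m b c u /\ exists un : nat -> X -> R,
     (forall n, Cc U (un n)) /\
     form_norm m b c (un n - u) @[n --> \oo] --> 0].

(* Graph of the operator in l^2(U, m) associated with the form (D, E). *)
Definition form_operator m U (D : set (X -> R))
    (E : (X -> R) -> (X -> R) -> R) : set ((X -> R) * (X -> R)) :=
  [set uf | [/\ D uf.1, l2 m U uf.2
              & forall v, D v -> E uf.1 v = l2dot m uf.2 v]].

Definition laplacian m b c : set ((X -> R) * (X -> R)) :=
  form_operator m setT (form_dom m b c) (form m b c).

Definition laplacian_on m b c U : set ((X -> R) * (X -> R)) :=
  form_operator m U (form_dom_on m b c U) (form m b c).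

Definition capacity m b c U : \bar R :=
  ereal_inf [set (form_norm m b c v)%:E | v in
    [set v | form_dom m b c v /\ forall x, \1_U x <= v x]].

End dirichlet_form.

(* Main.v *)
(* Since m is bounded below, sets of finite mass and sets of finite capacity are
   finite. Multiplication by the indicator of a finite set is compact, and so is
   (L_G + 1)^-1 - (L + 1)^-1 if G has a finite complement F: applied to u_n -> 0
   weakly, it gives z_n which is orthogonal in the form norm to the domain of
   L_G, so that the form norm of z_n is at most that of its restriction to F,
   which tends to 0. By approximation with polynomials in the resolvent,
   phi(L_G) - phi(L) is compact for all phi in C_0(R). The essential spectrum is
   the common zero set of the phi in C_0(R) for which phi(L) is compact, so it
   is the same for L_G and L; in particular inf sigma(L_(X \ K)) is at most
   inf sigma_ess(L). If it were below a0 < inf sigma_ess(L) for finite sets K_n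
   exhausting X, then there would be unit vectors u_n in the form domain of
   X \ K_n, hence weakly null, with energy at most a0, and thus
   <(L + 1)^-1 u_n, u_n> >= (1 + a0)^-1; but the part of (L + 1)^-1 exceeding
   (1 + a)^-1 > 0 is compact for every a < inf sigma_ess(L). *)
From HB Require Import structures.
Require Import Defs.
From mathcomp Require Import all_boot all_order all_algebra finmap.
From mathcomp Require Import all_classical all_reals all_analysis.
From mathcomp Require summability.
From mathcomp Require Import ring lra.

Set Implicit Arguments.
Unset Strict Implicit.
Unset Printing Implicit Defensive.

Import Order.TTheory GRing.Theory Num.Theory.
Import numFieldNormedType.Exports.

Local Open Scope classical_set_scope.
Local Open Scope ring_scope.

(** * Hilbert spaces *)

(** Neither a spectral measure nor spectral projections are used. Everything is derived from the
    bounded operator S = (1 + L_U)^-1 1_U, symmetric with 0 <= S <= 1 on the common space l^2(X, m),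
    so that operators living on different subsets U can be subtracted. The estimate |p(S)| <= sup
    |p| over [0, 1] replaces the spectral theorem and comes from algebra alone: S^k (1 - S)^l >= 0,
    and the Bernstein coefficients of p tend to its values. It yields phi(L) as a norm limit of q(S)
    with q(0) = 0. Compactness is tested on weakly null sequences, which makes sums, products and
    norm limits easy to handle. As to the essential spectrum: if phi(L) is compact and phi(l) != 0,
    approximate eigenvectors at l have a convergent subsequence, while infinitely many orthonormal
    eigenvectors with |phi| bounded below at their eigenvalues would contradict compactness. Since
    the definitions select the functional calculus and the form by [xget], existence and uniqueness
    have to be established before anything is known about them. *)

Section RealSequences.
Context {R : realType}.
Implicit Types (x y : nat -> R).

Lemma cvg0P x : x n @[n --> \oo] --> (0 : R) <->
  forall e : R, 0 < e -> exists N : nat, forall n, (N <= n)%N -> `|x n| < e.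
Proof.
split.
  move=> /cvgr0Pnorm_lt h e e0; have [N _ hN] := h _ e0.
  by exists N => n Nn; apply: hN.
move=> h; apply/cvgr0Pnorm_lt => e e0; have [N hN] := h _ e0.
by exists N => // n /= Nn; apply: hN.
Qed.

Lemma cvg0_le x y : (forall n, `|x n| <= y n) ->
  y n @[n --> \oo] --> (0 : R) -> x n @[n --> \oo] --> (0 : R).
Proof.
move=> xy /cvg0P h; apply/cvg0P => e e0; have [N hN] := h _ e0.
exists N => n /hN; apply: le_lt_trans; apply: le_trans (xy n) _.
exact: ler_norm.
Qed.

Lemma cvg0_sub x (k : nat -> nat) : (forall n, (n <= k n)%N) ->
  x n @[n --> \oo] --> (0 : R) -> x (k n) @[n --> \oo] --> (0 : R).
Proof.
move=> hk /cvg0P h; apply/cvg0P => e e0; have [N hN] := h _ e0.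
by exists N => n Nn; apply: hN; apply: leq_trans (hk n).
Qed.

Lemma homo_geid (k : nat -> nat) : {homo k : i j / (i < j)%N} ->
  forall n, (n <= k n)%N.
Proof. by move=> hk; elim=> // n IH; apply: leq_ltn_trans IH _; apply: hk. Qed.

Lemma cvg_invSn : (n.+1%:R^-1 : R) @[n --> \oo] --> (0 : R).
Proof. exact: cvg_harmonic. Qed.

Lemma le_cvg0 x (a : R) : (forall n, a <= x n) ->
  x n @[n --> \oo] --> (0 : R) -> a <= 0.
Proof.
move=> ax xl; rewrite leNgt; apply/negP => a0.
have [N hN] := (cvg0P x).1 xl _ a0.
by have := hN N (leqnn _); rewrite ltNge (le_trans (ax N)) // ler_norm.
Qed.

Lemma lt_invSn (e : R) : 0 < e -> exists N, forall n, (N <= n)%N -> n.+1%:R^-1 < e.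
Proof.
move=> e0; have [N hN] := (cvg0P _).1 cvg_invSn _ e0.
by exists N => n /hN; rewrite ger0_norm // invr_ge0 ler0n.
Qed.

Lemma cvg0D x y : x n @[n --> \oo] --> (0 : R) -> y n @[n --> \oo] --> (0 : R) ->
  x n + y n @[n --> \oo] --> (0 : R).
Proof. by move=> hx hy; rewrite -[X in _ --> X](addr0 0); apply: cvgD. Qed.

Lemma cvg0B x y : x n @[n --> \oo] --> (0 : R) -> y n @[n --> \oo] --> (0 : R) ->
  x n - y n @[n --> \oo] --> (0 : R).
Proof. by move=> hx hy; rewrite -[X in _ --> X](subrr 0); apply: cvgB. Qed.

Lemma cvg0M (a : R) x : x n @[n --> \oo] --> (0 : R) ->
  a * x n @[n --> \oo] --> (0 : R).
Proof.
by move=> hx; rewrite -[X in _ --> X](mulr0 a); apply: cvgM => //; exact: cvg_cst.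
Qed.

End RealSequences.

(** * Inner products, completeness and the Riesz representation *)

Section InnerProduct.
Context {R : realType} {V : lmodType R}.
Implicit Types (dot : V -> V -> R) (u v w : V).

(** A predicate on a bare function instead of a structure on V: [surj_of_bounded_below] works with
    two inner products on the same space. *)
Record inner_product dot : Prop := InnerProduct {
  dotC : forall u v, dot u v = dot v u;
  dotP : forall a u v w, dot (a *: u + v) w = a * dot u w + dot v w;
  dot_ge0 : forall u, 0 <= dot u u;
  dot_eq0 : forall u, dot u u = 0 -> u = 0 }.

Definition nrm dot u : R := Num.sqrt (dot u u).

Definition hcvg dot (un : nat -> V) u : Prop :=
  nrm dot (un n - u) @[n --> \oo] --> (0 : R).

Definition hcauchy dot (un : nat -> V) : Prop :=
  forall e : R, 0 < e -> exists N : nat, forall i j : nat,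
    (N <= i)%N -> (N <= j)%N -> nrm dot (un i - un j) < e.

Definition hcomplete dot : Prop :=
  forall un, hcauchy dot un -> exists u, hcvg dot un u.

Definition lin (A : V -> V) : Prop :=
  forall a u v, A (a *: u + v) = a *: A u + A v.

Definition symop dot (A : V -> V) : Prop :=
  forall u v, dot (A u) v = dot u (A v).

Section LinTheory.
Context {A : V -> V} (Alin : lin A).
Lemma linD u v : A (u + v) = A u + A v.
Proof. by have := Alin 1 u v; rewrite !scale1r. Qed.
Lemma lin0 : A 0 = 0.
Proof. by apply: (@addrI _ (A 0)); rewrite -linD !addr0. Qed.
Lemma linZ a u : A (a *: u) = a *: A u.
Proof. by have := Alin a u 0; rewrite lin0 !addr0. Qed.
Lemma linN u : A (- u) = - A u.
Proof. by rewrite -scaleN1r linZ scaleN1r. Qed.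
Lemma linB u v : A (u - v) = A u - A v.
Proof. by rewrite linD linN. Qed.
End LinTheory.

Section Theory.
Context {dot : V -> V -> R} (H : inner_product dot).
Local Notation nrm := (nrm dot).

Lemma dotDl u v w : dot (u + v) w = dot u w + dot v w.
Proof. by have := dotP H 1 u v w; rewrite scale1r mul1r. Qed.
Lemma dot0l w : dot 0 w = 0.
Proof. by apply: (@addrI _ (dot 0 w)); rewrite -dotDl !addr0. Qed.
Lemma dotZl a u w : dot (a *: u) w = a * dot u w.
Proof. by have := dotP H a u 0 w; rewrite dot0l !addr0. Qed.
Lemma dotNl u w : dot (- u) w = - dot u w.
Proof. by rewrite -scaleN1r dotZl mulN1r. Qed.
Lemma dotBl u v w : dot (u - v) w = dot u w - dot v w.
Proof. by rewrite dotDl dotNl. Qed.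
Lemma dotDr u v w : dot w (u + v) = dot w u + dot w v.
Proof. by rewrite !(dotC H w) dotDl. Qed.
Lemma dot0r w : dot w 0 = 0.
Proof. by rewrite (dotC H) dot0l. Qed.
Lemma dotZr a u w : dot w (a *: u) = a * dot w u.
Proof. by rewrite !(dotC H w) dotZl. Qed.
Lemma dotNr u w : dot w (- u) = - dot w u.
Proof. by rewrite !(dotC H w) dotNl. Qed.
Lemma dotBr u v w : dot w (u - v) = dot w u - dot w v.
Proof. by rewrite dotDr dotNr. Qed.

Definition dotE := (dotDl, dotDr, dotZl, dotZr, dotNl, dotNr).

Lemma dot_suml I (s : seq I) (F : I -> V) w :
  dot (\sum_(i <- s) F i) w = \sum_(i <- s) dot (F i) w.
Proof. by elim: s => [|i s IH]; rewrite ?big_nil ?dot0l // !big_cons dotDl IH. Qed.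

Lemma nrm_ge0 u : 0 <= nrm u. Proof. exact: sqrtr_ge0. Qed.

Lemma nrm_sqr u : nrm u ^+ 2 = dot u u.
Proof. by rewrite sqr_sqrtr // dot_ge0. Qed.

Lemma nrm0 : nrm 0 = 0. Proof. by rewrite /nrm dot0l sqrtr0. Qed.

Lemma nrm_eq0 u : nrm u = 0 -> u = 0.
Proof. by move=> u0; apply: (dot_eq0 H); rewrite -nrm_sqr u0 expr0n. Qed.

Lemma nrm_le0 u : nrm u <= 0 -> u = 0.
Proof. by move=> u0; apply/nrm_eq0/le_anti; rewrite u0 nrm_ge0. Qed.

Lemma nrmB_le0 u v : nrm (u - v) <= 0 -> u = v.
Proof. by move=> uv; apply/eqP; rewrite -subr_eq0; apply/eqP/nrm_le0. Qed.

Lemma nrm_gt0 u : u != 0 -> 0 < nrm u.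
Proof.
move=> u0; rewrite lt_neqAle nrm_ge0 andbT eq_sym.
by apply: contra_neq u0 => /nrm_eq0.
Qed.

Lemma nrmZ a u : nrm (a *: u) = `|a| * nrm u.
Proof.
by rewrite /nrm dotZl dotZr mulrA -expr2 sqrtrM ?sqr_ge0 // sqrtr_sqr.
Qed.

Lemma nrmN u : nrm (- u) = nrm u.
Proof. by rewrite /nrm dotNl dotNr opprK. Qed.

Lemma nrmB u v : nrm (u - v) = nrm (v - u).
Proof. by rewrite -nrmN opprB. Qed.

Lemma dot_CS u v : `|dot u v| <= nrm u * nrm v.
Proof.
rewrite -ler_sqr ?nnegrE ?mulr_ge0 ?nrm_ge0 // exprMn !nrm_sqr.
rewrite real_normK ?num_real //.
have [->|v0] := eqVneq v 0; first by rewrite !dot0r expr0n mulr0.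
have vv : 0 < dot v v by rewrite -nrm_sqr exprn_gt0 // nrm_gt0.
have := dot_ge0 H (dot v v *: u - dot u v *: v).
rewrite !dotE (dotC H v u).
rewrite (_ : _ + _ = dot v v * (dot u u * dot v v - dot u v ^+ 2)); last by ring.
by rewrite pmulr_rge0 // subr_ge0.
Qed.

Lemma nrmD u v : nrm (u + v) <= nrm u + nrm v.
Proof.
rewrite -ler_sqr ?nnegrE ?addr_ge0 ?nrm_ge0 // sqrrD !nrm_sqr !dotE (dotC H v u).
by have := dot_CS u v; have := ler_norm (dot u v); lra.
Qed.

Lemma nrmBD u v : nrm (u - v) <= nrm u + nrm v.
Proof. by rewrite -(nrmN v) nrmD. Qed.

Lemma nrm_triB w u v : nrm (u - v) <= nrm (u - w) + nrm (w - v).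
Proof. by rewrite -[u - v](subrKA w) nrmD. Qed.

Lemma nrm_sub_ge u v : nrm u - nrm v <= nrm (u - v).
Proof. by rewrite lerBlDr -{1}(subrK v u) nrmD. Qed.

Lemma nrm_dist u v : `|nrm u - nrm v| <= nrm (u - v).
Proof. by rewrite ler_norml nrm_sub_ge andbT lerNl opprB nrmB nrm_sub_ge. Qed.

Lemma dot_all_eq0 u : (forall v, dot u v = 0) -> u = 0.
Proof. by move=> h; apply: (dot_eq0 H). Qed.

Lemma hcvg_unique (un : nat -> V) u v : hcvg dot un u -> hcvg dot un v -> u = v.
Proof.
move=> hu hv; apply: nrmB_le0.
apply: (@le_cvg0 _ (fun n => nrm (un n - u) + nrm (un n - v))).
  by move=> n; rewrite (nrmB (un n)); apply: nrm_triB.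
by rewrite -(addr0 0); apply: cvgD.
Qed.

Lemma hcvgP (un vn : nat -> V) u v a : hcvg dot un u -> hcvg dot vn v ->
  hcvg dot (fun n => a *: un n + vn n) (a *: u + v).
Proof.
move=> hu hv.
apply: (@cvg0_le _ _ (fun n => `|a| * nrm (un n - u) + nrm (vn n - v))).
  move=> n; rewrite ger0_norm ?nrm_ge0 // -nrmZ.
  rewrite (_ : _ - _ = a *: (un n - u) + (vn n - v)) ?nrmD //.
  by rewrite scalerBr opprD addrACA.
rewrite -(addr0 0) -{1}(mulr0 `|a|); apply: cvgD => //.
by apply: cvgM => //; apply: cvg_cst.
Qed.

Lemma hcvg_nrm (un : nat -> V) u : hcvg dot un u -> nrm (un n) @[n --> \oo] --> nrm u.
Proof.
by move=> hu; apply/subr_cvg0; apply: cvg0_le hu => n; apply: nrm_dist.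
Qed.

Lemma hcvg_op (A : V -> V) C (un : nat -> V) u : lin A ->
  (forall f, nrm (A f) <= C * nrm f) -> hcvg dot un u ->
  hcvg dot (A \o un) (A u).
Proof.
move=> Al Ab hu; apply: (@cvg0_le _ _ (fun n => C * nrm (un n - u))) => [n|].
  by rewrite ger0_norm ?nrm_ge0 //= -(linB Al).
by rewrite -(mulr0 C); apply: cvgM => //; apply: cvg_cst.
Qed.

(** Norm and numerical radius agree for symmetric operators. For g parallel to A f with the length
    of f, polarization and the parallelogram law give 4 <A f, g> <= C (|f + g|^2 + |f - g|^2) = 4 C
    |f|^2, and <A f, g> = |f| |A f|. *)
Lemma symop_bound (A : V -> V) C : lin A -> symop dot A ->
  (forall f, `|dot (A f) f| <= C * dot f f) ->
  forall f, nrm (A f) <= C * nrm f.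
Proof.
move=> Al As Ab f.
have [A0|A0] := eqVneq (A f) 0.
  have [->|f0] := eqVneq f 0; first by rewrite (lin0 Al) !nrm0 mulr0.
  rewrite A0 nrm0 mulr_ge0 ?nrm_ge0 //.
  have := le_trans (normr_ge0 _) (Ab f).
  by rewrite pmulr_lge0 // -nrm_sqr exprn_gt0 // nrm_gt0.
have Agt := nrm_gt0 A0.
have [g gE] : exists g, g = (nrm f / nrm (A f)) *: A f by eexists.
have h1 := Ab (f + g); have h2 := Ab (f - g).
have ng : dot g g = dot f f.
  rewrite gE dotZl dotZr -!nrm_sqr; field.
  by rewrite gt_eqF.
have sg : dot (A g) f = dot (A f) g by rewrite As (dotC H).
have key : 4 * dot (A f) g <= 4 * C * dot f f.
  move: h1 h2; rewrite (linD Al) (linB Al) !ler_norml !dotE ng sg (dotC H g f).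
  by move=> /andP[_ h1] /andP[h2 _]; lra.
have eg : dot (A f) g = nrm f * nrm (A f).
  by rewrite gE dotZr -nrm_sqr; field; rewrite gt_eqF.
have [f0|f0] := eqVneq f 0.
  by move: A0; rewrite f0 (lin0 Al) eqxx.
have fgt := nrm_gt0 f0.
rewrite -(ler_pM2l fgt) -eg.
have : nrm f * (C * nrm f) = C * dot f f by rewrite -nrm_sqr; ring.
move=> ->; lra.
Qed.

End Theory.

Arguments nrm_ge0 : clear implicits.

(** Minimize J(v) = <v, v> - 2 F(v). By the parallelogram law a minimizing sequence is Cauchy, and
    the first variation of J at its limit is the claim. *)
Lemma riesz dot (H : inner_product dot) (F : V -> R) C : hcomplete dot ->
  (forall a u v, F (a *: u + v) = a * F u + F v) ->
  (forall v, `|F v| <= C * nrm dot v) ->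
  exists u, forall v, dot u v = F v.
Proof.
move=> Hc Fl Fb.
have F0 : F 0 = 0 by have := Fl 1 0 0; rewrite scale1r addr0 mul1r; lra.
have FZ a v : F (a *: v) = a * F v by rewrite -[a *: v]addr0 Fl F0 addr0.
have FD u v : F (u + v) = F u + F v by rewrite -{1}[u]scale1r Fl mul1r.
pose J v := dot v v - 2 * F v.
have Jlb v : - C ^+ 2 <= J v.
  have := Fb v; rewrite ler_norml => /andP[_ h].
  have := sqr_ge0 (nrm dot v - C); rewrite /J -(nrm_sqr H); nra.
pose E := range J.
have Ei : has_inf E by split; [exists (J 0), 0 | exists (- C ^+ 2) => _ [v _ <-]].
have Jinf v : inf E <= J v by apply: ge_inf; [exact: Ei.2 | exists v].
have [un hun] : {un : nat -> V & forall n, J (un n) < inf E + n.+1%:R^-1}.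
  apply: (@choice _ _ (fun n v => J v < inf E + n.+1%:R^-1)) => n.
  have [|_ [v _ <-] hv] := @inf_adherent _ E (n.+1%:R^-1 : R) _ Ei.
    by rewrite invr_gt0.
  by exists v.
have Jpar u v : nrm dot (u - v) ^+ 2 = 2 * (J u + J v) - 4 * J (2^-1 *: (u + v)).
  rewrite (nrm_sqr H) /J FZ FD !(dotE H) (dotC H v u).
  by field.
have uc : hcauchy dot un.
  move=> e e0; have e2 : 0 < e ^+ 2 / 4 by rewrite divr_gt0 ?exprn_gt0.
  have [N hN] := lt_invSn e2; exists N => i j /hN hi /hN hj.
  rewrite -ltr_sqr ?nnegrE ?nrm_ge0 ?ltW // Jpar.
  have := hun i; have := hun j; have := Jinf (2^-1 *: (un i + un j)).
  move: hi hj; move: (J _) (J _) (J _) (inf E) (i.+1%:R^-1) (j.+1%:R^-1) (e ^+ 2).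
  move=> x y z t p q r; lra.
have [u hu] := Hc _ uc; exists u => v.
have Ju : J u <= inf E.
  have h1 : dot (un n) (un n) @[n --> \oo] --> dot u u.
    rewrite -(nrm_sqr H) expr2 [X in X @ _ --> _](_ : _ =
      (fun n => nrm dot (un n) * nrm dot (un n))); last first.
      by apply/funext => n; rewrite -expr2 (nrm_sqr H).
    by apply: cvgM; apply: hcvg_nrm.
  have h2 : F (un n) @[n --> \oo] --> F u.
    apply/subr_cvg0; apply: (@cvg0_le _ _ (fun n => C * nrm dot (un n - u))) => [n|].
      apply: le_trans (Fb _); rewrite -[un n - u]addrC.
      by rewrite -scaleN1r Fl mulN1r addrC.
    by rewrite -(mulr0 C); apply: cvgM => //; apply: cvg_cst.
  have h3 : J (un n) @[n --> \oo] --> J u.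
    by apply: cvgB => //; apply: cvgM => //; apply: cvg_cst.
  have h4 : inf E + n.+1%:R^-1 @[n --> \oo] --> inf E.
    rewrite -[X in _ --> X]addr0; apply: cvgD; [exact: cvg_cst | exact: cvg_invSn].
  rewrite -subr_le0.
  apply: (@le_cvg0 _ (fun n => (inf E + n.+1%:R^-1 - J (un n)) - (inf E - J u))).
    by move=> n; have := hun n; move: (J (un n)) (J u) (n.+1%:R^-1) => x y q; lra.
  by rewrite -(subrr (inf E - J u)); apply: cvgB; [exact: cvgB | exact: cvg_cst].
have quad (t : R) : 0 <= 2 * t * (dot u v - F v) + t ^+ 2 * dot v v.
  have := le_trans Ju (Jinf (t *: v + u)).
  by rewrite /J Fl !(dotE H) (dotC H v u); nra.
apply/eqP; rewrite -subr_eq0; apply/eqP; set d := dot u v - F v.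
have [v0|v0] := eqVneq (dot v v) 0.
  by have := quad (- d); rewrite v0 -/d; nra.
have vv : 0 < dot v v by rewrite lt_neqAle eq_sym v0 (dot_ge0 H).
(* This t minimizes the quadratic; the minimum is -d^2 / <v, v>. *)
have := quad (- d / dot v v); rewrite -/d.
rewrite (_ : _ + _ = - (d ^+ 2 / dot v v)); last by field.
rewrite oppr_ge0 pmulr_lle0 ?invr_gt0 // => d2.
by apply/eqP; rewrite -sqrf_eq0 eq_le d2 sqr_ge0.
Qed.

End InnerProduct.

Arguments nrm_ge0 {R V} dot u.

(** * Functional calculus of a positive contraction *)

Section OperatorPolynomials.
Context {R : realType} {V : lmodType R} {S : V -> V} (Sl : lin S).
Implicit Types (p q : {poly R}) (f g : V).

Definition pop (S : V -> V) p f : V := \sum_(i < size p) p`_i *: iter i S f.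

Lemma pop_widen n p f : (size p <= n)%N ->
  pop S p f = \sum_(i < n) p`_i *: iter i S f.
Proof.
move=> pn; rewrite /pop (big_ord_widen n (fun i => p`_i *: iter i S f)) //.
rewrite big_mkcond /=; apply: eq_bigr => i _; case: ltnP => // ip.
by rewrite nth_default // scale0r.
Qed.

Lemma popP a p q f : pop S (a *: p + q) f = a *: pop S p f + pop S q f.
Proof.
pose n := maxn (size (a *: p + q)) (maxn (size p) (size q)).
rewrite !(@pop_widen n) ?leq_max ?leqnn ?orbT // scaler_sumr -big_split /=.
by apply: eq_bigr => i _; rewrite coefD coefZ scalerDl scalerA.
Qed.

Lemma popD p q f : pop S (p + q) f = pop S p f + pop S q f.
Proof. by have := popP 1 p q f; rewrite !scale1r. Qed.

Lemma popC c f : pop S c%:P f = c *: f.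
Proof.
by rewrite (@pop_widen 1) ?size_polyC ?leq_b1 // big_ord1 coefC.
Qed.

Lemma popZ a p f : pop S (a *: p) f = a *: pop S p f.
Proof.
by rewrite -[a *: p]addr0 popP [pop S 0 f](_ : _ = 0) ?addr0 // /pop size_poly0 big_ord0.
Qed.

Lemma pop_sum I (s : seq I) (F : I -> {poly R}) f :
  pop S (\sum_(i <- s) F i) f = \sum_(i <- s) pop S (F i) f.
Proof.
elim: s => [|i s IH]; last by rewrite !big_cons popD IH.
by rewrite !big_nil /pop size_poly0 big_ord0.
Qed.

Lemma popMX p f : pop S (p * 'X) f = S (pop S p f).
Proof.
rewrite (@pop_widen (size p).+1); last first.
  have [->|p0] := eqVneq p 0; first by rewrite mul0r size_poly0.
  by rewrite size_mulX.
rewrite big_ord_recl coefMX /= scale0r add0r /pop.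
have Ssum n (F : 'I_n -> V) : S (\sum_(i < n) F i) = \sum_(i < n) S (F i).
  elim: n F => [|n IH] F; first by rewrite !big_ord0 (lin0 Sl).
  by rewrite !big_ord_recl (linD Sl) IH.
by rewrite Ssum; apply: eq_bigr => i _; rewrite coefMX /= (linZ Sl).
Qed.

Lemma popM p q f : pop S (p * q) f = pop S p (pop S q f).
Proof.
elim/poly_ind: p => [|p c IH].
  by rewrite mul0r /pop size_poly0 !big_ord0.
rewrite mulrDl -mulrA (mulrC 'X) mulrA !popD !popMX IH popC.
by rewrite mul_polyC popZ.
Qed.

Lemma popXE f : pop S 'X f = S f.
Proof. by rewrite -(mul1r 'X) popMX -[1]/(1%:P) popC scale1r. Qed.

Lemma pop_comm p f : pop S p (S f) = S (pop S p f).
Proof. by rewrite -popMX popM popXE. Qed.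

Lemma pop_lin p : lin (pop S p).
Proof.
move=> a u v; elim/poly_ind: p => [|p c IH].
  by rewrite /pop size_poly0 !big_ord0 scaler0 addr0.
rewrite !popD !popMX IH !popC Sl !scalerDr !scalerA (mulrC c).
by rewrite addrACA.
Qed.

Context {dot : V -> V -> R} (H : inner_product dot) (Ss : symop dot S).

Lemma pop_sym p : symop dot (pop S p).
Proof.
move=> u v; elim/poly_ind: p u v => [|p c IH] u v.
  by rewrite /pop size_poly0 !big_ord0 (dot0l H) (dot0r H).
rewrite !popD !popMX !popC !(dotE H) Ss IH pop_comm.
by [].
Qed.

Hypothesis Spos : forall f, 0 <= dot (S f) f.
Hypothesis Sle1 : forall f, dot (S f) f <= dot f f.

(** With g = p(S) f the form equals <q(S) g, g>, as p(S) is symmetric and commutes with q(S). *)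
Lemma pop_pos_sqr p q : (forall f, 0 <= dot (pop S q f) f) ->
  forall f, 0 <= dot (pop S (p * p * q) f) f.
Proof.
by move=> h f; rewrite -mulrA popM pop_sym (mulrC p) popM; apply: h.
Qed.

(** Up to the square of a polynomial only exponents 0 and 1 remain, and X (1 - X) = X^2 (1 - X) + (1
    - X)^2 X. This gives S (1 - S) >= 0 without a square root of S. *)
Lemma pop_pos_monom k l f : 0 <= dot (pop S ('X^k * (1 - 'X) ^+ l) f) f.
Proof.
have popN p g : pop S (- p) g = - pop S p g by rewrite -(scaleN1r p) popZ scaleN1r.
have pos1 g : 0 <= dot (pop S 1 g) g.
  by rewrite -[1]/(1%:P) popC scale1r (dot_ge0 H).
have posX g : 0 <= dot (pop S 'X g) g by rewrite popXE.
have posX' g : 0 <= dot (pop S (1 - 'X) g) g.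
  by rewrite popD popN popXE -[1]/(1%:P) popC scale1r (dotBl H) subr_ge0.
have posXX g : 0 <= dot (pop S ('X * (1 - 'X)) g) g.
  rewrite (_ : _ * _ = 'X * 'X * (1 - 'X) + (1 - 'X) * (1 - 'X) * 'X); last by ring.
  by rewrite popD (dotDl H) addr_ge0 // pop_pos_sqr.
have -> : 'X^k * (1 - 'X) ^+ l = 'X^(k./2) * (1 - 'X) ^+ l./2 *
    ('X^(k./2) * (1 - 'X) ^+ l./2) * ('X^(odd k) * (1 - 'X) ^+ odd l) :> {poly R}.
  rewrite -{1}(odd_double_half k) -{1}(odd_double_half l) !exprD -!addnn !exprD.
  ring.
apply: pop_pos_sqr => g.
by case: (odd k); case: (odd l); rewrite ?expr0 ?expr1 ?mul1r ?mulr1.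
Qed.

Definition bern n k : {poly R} := 'C(n, k)%:R *: ('X^k * (1 - 'X) ^+ (n - k)).

Lemma pop_pos_bern n k f : 0 <= dot (pop S (bern n k) f) f.
Proof. by rewrite popZ (dotZl H) mulr_ge0 ?ler0n ?pop_pos_monom. Qed.

End OperatorPolynomials.

(** * Bernstein coefficients and degree elevation *)

Section Bernstein.
Context {R : realType}.
Implicit Types (p : {poly R}) (t : R).

Lemma bin_trinomial n k j : (j <= k)%N -> (k <= n)%N ->
  ('C(n, k) * 'C(k, j) = 'C(n, j) * 'C(n - j, k - j))%N.
Proof.
move=> jk kn; have jn := leq_trans jk kn.
have e : ((n - j) - (k - j) = n - k)%N by rewrite subnBA // subnK.
apply/eqP; rewrite -(eqn_pmul2r (fact_gt0 j)) -(eqn_pmul2r (fact_gt0 (k - j))).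
rewrite -(eqn_pmul2r (fact_gt0 (n - k))).
have h1 := bin_fact kn; have h2 := bin_fact jk; have h3 := bin_fact jn.
have h4 := bin_fact (leq_sub2r j kn); rewrite e in h4.
apply/eqP; transitivity n`!.
  by rewrite -h1 -h2; ring.
by rewrite -h3 -h4; ring.
Qed.

Definition rbin n k j : R := 'C(k, j)%:R / 'C(n, j)%:R.

(* Degree elevation: the Bernstein coefficients of X^j are close to the values of X^j. *)
Lemma bern_monom n j : (j <= n)%N ->
  'X^j = \sum_(k < n.+1) rbin n k j *: bern n k :> {poly R}.
Proof.
move=> jn.
rewrite -(big_mkord xpredT (fun k => rbin n k j *: bern n k)).
rewrite (@big_cat_nat _ _ _ j) //=; last exact: leqW.
rewrite big_nat_cond big1 ?add0r; last first.
  move=> k; rewrite andbT => /= kj.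
  by rewrite /rbin bin_small // mul0r scale0r.
rewrite -[X in index_iota X _]add0n big_addn subSn // big_mkord.
have <- : 'X^j * ((1 - 'X) + 'X) ^+ (n - j) = 'X^j :> {poly R}.
  by rewrite subrK expr1n mulr1.
rewrite exprDn mulr_sumr; apply: eq_bigr => i _.
have ij : (i + j <= n)%N by rewrite addnC -leq_subRL // -ltnS ltn_ord.
have Cn : 'C(n, j)%:R != 0 :> R by rewrite pnatr_eq0 -lt0n bin_gt0.
rewrite /bern scalerA -scaler_nat -scalerAr; congr (_ *: _).
  rewrite /rbin mulrAC -natrM mulnC bin_trinomial ?leq_addl // addnK natrM.
  by rewrite mulrAC mulfV // mul1r.
by rewrite addnC exprD -subnDA; ring.
Qed.

Lemma bern_sum1 n : \sum_(k < n.+1) bern n k = 1 :> {poly R}.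
Proof.
rewrite -(expr0 'X) (@bern_monom n 0) //.
by apply: eq_bigr => k _; rewrite /rbin !bin0 divr1 scale1r.
Qed.

(** Passing from j to j + 1 multiplies [rbin] by (k - j) / (n - j), which lies between k / n - j /
    (n - j) and k / n; the errors add up to at most (j^2 + j) / (n - j). *)
Lemma rbin_bound j n k : (j < n)%N -> (k <= n)%N ->
  `|rbin n k j - (k%:R / n%:R) ^+ j| <= j%:R ^+ 2 / (n - j)%:R.
Proof.
elim: j => [|j IH] jn kn.
  by rewrite /rbin !bin0 expr0 divr1 subrr normr0 expr0n mul0r.
have n0 : (0 < n)%N by apply: leq_trans jn.
have nR : 0 < n%:R :> R by rewrite ltr0n.
have jn' : (j < n)%N by apply: leq_trans jn.
have jnR : 0 < (n - j)%:R :> R by rewrite ltr0n subn_gt0.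
have jnR' : 0 < (n - j.+1)%:R :> R by rewrite ltr0n subn_gt0.
have {IH} := IH jn' kn.
have -> : rbin n k j.+1 = rbin n k j * ((k - j)%:R / (n - j)%:R).
  rewrite /rbin mulf_div -!natrM !(mulnC _ (_ - j)%N) -!mul_bin_left !natrM.
  by rewrite -mulf_div divff ?mul1r // pnatr_eq0.
have r0 : 0 <= rbin n k j by rewrite divr_ge0.
have r1 : rbin n k j <= 1.
  by rewrite ler_pdivrMr ?mul1r ?ler_nat ?leq_bin2l // ltr0n bin_gt0 ltnW.
have y0 : 0 <= k%:R / n%:R :> R by rewrite divr_ge0.
have y1 : k%:R / n%:R <= 1 :> R by rewrite ler_pdivrMr // mul1r ler_nat.
have wy : (k - j)%:R / (n - j)%:R <= k%:R / n%:R :> R.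
  rewrite ler_pdivrMr // mulrAC ler_pdivlMr // -!natrM ler_nat.
  case: (leqP j k) => jk; last by rewrite (eqP (ltnW jk)).
  rewrite mulnBl mulnBr leq_sub2l // mulnC.
  by rewrite leq_mul2l kn orbT.
have yw : k%:R / n%:R - j%:R / (n - j)%:R <= (k - j)%:R / (n - j)%:R :> R.
  rewrite lerBlDr -mulrDl -natrD ler_pdivrMr // mulrAC ler_pdivlMr //.
  rewrite -!natrM ler_nat leq_mul ?leq_subr //.
  by rewrite addnC -leq_subLR.
rewrite (exprSr (k%:R / n%:R) j).
move: r0 r1 y0 y1 wy yw.
have : j%:R ^+ 2 / (n - j)%:R + j%:R / (n - j)%:R <= j.+1%:R ^+ 2 / (n - j.+1)%:R :> R.
  rewrite -mulrDl; apply: ler_pM.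
  - by rewrite addr_ge0 ?sqr_ge0.
  - by rewrite invr_ge0.
  - by rewrite -(natr1 j) sqrrD; have := ler0n R j; lra.
  - by rewrite lef_pV2 ?posrE // ler_nat leq_sub2l.
move: (rbin n k j) (k%:R / n%:R) ((k - j)%:R / (n - j)%:R) => r y w.
move: (y ^+ j) (j%:R ^+ 2 / (n - j)%:R : R) (j%:R / (n - j)%:R : R).
move: (j.+1%:R ^+ 2 / (n - j.+1)%:R : R) => d z a b.
move=> abd r0 r1 y0 y1 wy yw; rewrite !ler_norml => /andP[h1 h2].
by apply/andP; split; nra.
Qed.

End Bernstein.

(** * Weierstrass approximation on [0, 1] *)

Section Weierstrass.
Context {R : realType}.
Implicit Types (p : {poly R}) (t e d l C M : R).

Lemma small_div (B e : R) (d : nat) : 0 < e ->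
  exists n, (d < n)%N /\ forall k, (n <= k)%N -> B / (k - d)%:R <= e.
Proof.
move=> e0; exists (d + (Num.Def.archi_bound (B / e)).+1)%N.
split; first by rewrite -addSnnS leq_addr.
move=> k hk; have kd : (Num.Def.archi_bound (B / e) < k - d)%N.
  by rewrite ltn_subRL -addnS.
have kd0 : 0 < (k - d)%:R :> R by rewrite ltr0n (leq_ltn_trans _ kd).
rewrite ler_pdivrMr // -ler_pdivrMl // mulrC.
apply: le_trans (ltW (unstable.ltr_bound _)) _.
by rewrite ler_nat ltnW.
Qed.

Lemma bounded_subseq (x : nat -> R) (C : R) : (forall n, `|x n| <= C) ->
  exists k : nat -> nat, {homo k : i j / (i < j)%N} /\
  exists l : R, x (k n) @[n --> \oo] --> l.
Proof.
move=> xC; have xb : bounded_fun x.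
  exists C; split; first exact: num_real.
  by move=> y Cy n _ /=; apply: le_trans (xC n) (ltW Cy).
have [k kinc kcvg] := bolzano_weierstrass xb.
exists k; split; last by exists (lim (x \o k @ \oo)).
by move=> i j; rewrite !ltnNge -kinc leEnat.
Qed.

Lemma continuous_seq (f : R -> R) (x : nat -> R) l : continuous f ->
  x n @[n --> \oo] --> l -> f (x n) @[n --> \oo] --> f l.
Proof. by move=> fc xl; apply: (@cvg_comp _ _ _ x f _ _ _ xl); apply: fc. Qed.

Lemma unif_continuous01 (f : R -> R) e : continuous f -> 0 < e ->
  exists2 d : R, 0 < d & forall s t : R, 0 <= s <= 1 -> 0 <= t <= 1 ->
    `|s - t| < d -> `|f s - f t| < e.
Proof.
move=> fc e0; apply: contrapT => hn.
have : forall n : nat, exists st : R * R, [/\ 0 <= st.1 <= 1, 0 <= st.2 <= 1,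
    `|st.1 - st.2| < n.+1%:R^-1 & e <= `|f st.1 - f st.2|].
  move=> n; apply: contrapT => hst; apply: hn; exists n.+1%:R^-1 => // s t hs ht h.
  by rewrite ltNge; apply/negP => h'; apply: hst; exists (s, t).
move=> /choice[st hst].
have [|k [kh [l kl]]] := @bounded_subseq (fun n => (st n).1) 1.
  by move=> n; have [/andP[h1 h2] _ _ _] := hst n; rewrite ger0_norm.
have kl2 : (st (k n)).2 @[n --> \oo] --> l.
  have -> : (fun n => (st (k n)).2) =
    (fun n => (st (k n)).1 - ((st (k n)).1 - (st (k n)).2)).
    by apply/funext => n; rewrite subKr.
  rewrite -[l]subr0; apply: cvgB => //.
  apply: (@cvg0_sub _ (fun n => (st n).1 - (st n).2)) (homo_geid kh) _.
  apply: cvg0_le (@cvg_invSn R) => n; have [_ _ h _] := hst n; exact: ltW.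
suff : e <= 0 by rewrite leNgt e0.
apply: (@le_cvg0 _ (fun n => `|f (st (k n)).1 - f (st (k n)).2|)) => [n|].
  by have [] := hst (k n).
rewrite -(normr0 R) -(subrr (f l)).
by apply: cvg_norm; apply: cvgB; apply: continuous_seq.
Qed.

Lemma bounded01 (f : R -> R) : continuous f ->
  exists2 M : R, 0 < M & forall t : R, 0 <= t <= 1 -> `|f t| <= M.
Proof.
move=> fc.
have [||c _ hc] := @EVT_max R (fun x => `|f x|) 0 1; first exact: ler01.
  apply: continuous_subspaceT => x; apply: (@cvg_norm _ _ _ _ _ f); exact: fc.
exists (`|f c| + 1); first by rewrite ltr_wpDl.
move=> t ht; have := hc t; rewrite in_itv /= => /(_ ht).
by have := @ler01 R; lra.
Qed.

Lemma bern_ge0 n k t : 0 <= t <= 1 -> 0 <= (bern n k).[t].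
Proof.
move=> /andP[t0 t1]; rewrite /bern !hornerE.
by rewrite !mulr_ge0 ?ler0n ?exprn_ge0 // subr_ge0.
Qed.

Lemma bern_horner n j t : (j <= n)%N ->
  \sum_(k < n.+1) rbin n k j * (bern n k).[t] = t ^+ j.
Proof.
move=> jn; rewrite -[t ^+ j]hornerXn (bern_monom jn) horner_sum.
by under [RHS]eq_bigr do rewrite hornerZ.
Qed.

(** The variance of a binomial proportion. The square expands over the [rbin n k j] with j <= 2,
    whose Bernstein sums are the powers of t by [bern_horner]. *)
Lemma bern_variance n t : (2 <= n)%N ->
  \sum_(k < n.+1) (k%:R / n%:R - t) ^+ 2 * (bern n k).[t] = t * (1 - t) / n%:R.
Proof.
move=> n2; have n0 : n%:R != 0 :> R by rewrite pnatr_eq0; case: n n2.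
have n1 : n%:R - 1 != 0 :> R.
  by rewrite subr_eq0 pnatr_eq1; case: n n2 {n0} => [|[]].
have e0 := @bern_horner n 0 t isT.
have e1 := @bern_horner n 1 t (ltnW n2).
have e2 := bern_horner t n2.
transitivity (((n%:R - 1) / n%:R) * t ^+ 2 + (n%:R^-1 - 2 * t) * t ^+ 1
   + t ^+ 2 * t ^+ 0); last by field.
rewrite -[in _ * t ^+ 0]e0 -e1 -[in _ / _ * t ^+ 2]e2 !mulr_sumr -!big_split /=.
apply: eq_bigr => k _; rewrite !mulrA -!mulrDl; congr (_ * _).
have b2 i : 'C(i, 2)%:R = i%:R * (i%:R - 1) / 2 :> R.
  have -> : i%:R * (i%:R - 1) = (i * i.-1)%:R :> R.
    by case: i => [|i]; rewrite ?mul0r // natrM -natr1 addrK.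
  have := mul_bin_left i 1; rewrite bin1 subn1 => /(congr1 (fun x => x%:R : R)).
  by rewrite mulnC (mulnC i) !natrM => <-; rewrite mulfK // pnatr_eq0.
rewrite /rbin !bin0 !bin1 !b2; field.
by rewrite n0 n1.
Qed.

(** Bernstein's proof. Where |t - k/N| < d the error is at most e/2; elsewhere it is at most 2 M <=
    (2 M / d^2) (k/N - t)^2, and the variance is at most 1/N. *)
Lemma weierstrass01 (f : R -> R) e : continuous f -> 0 < e ->
  exists p, forall t : R, 0 <= t <= 1 -> `|f t - p.[t]| <= e.
Proof.
move=> fc e0; have e20 : 0 < e / 2 by rewrite divr_gt0.
have [d d0 hd] := unif_continuous01 fc e20.
have [M M0 hM] := bounded01 fc.
have [n [n2 hn]] := small_div (2 * M / d ^+ 2) 0 e20.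
pose N := n.+1.
have {hn} := hn N (leqnSn n); rewrite subn0 => hN.
have N2 : (2 <= N)%N by [].
have NR : 0 < N%:R :> R by rewrite ltr0n.
exists (\sum_(k < N.+1) f (k%:R / N%:R) *: bern N k) => t ht.
have e1 : \sum_(k < N.+1) (bern N k).[t] = 1 by rewrite -horner_sum bern_sum1 hornerC.
have -> : f t = \sum_(k < N.+1) f t * (bern N k).[t] by rewrite -mulr_sumr e1 mulr1.
rewrite horner_sum -sumrB.
apply: le_trans (ler_norm_sum _ _ _) _.
apply: le_trans (_ : \sum_(k < N.+1) ((e / 2) * (bern N k).[t] +
   2 * M / d ^+ 2 * ((k%:R / N%:R - t) ^+ 2 * (bern N k).[t])) <= _); last first.
  rewrite big_split /= -!mulr_sumr e1 bern_variance // mulr1 [leRHS]splitr lerD2l.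
  apply: le_trans hN; rewrite mulrA ler_pM2r ?invr_gt0 // ger_pMr; last first.
    by rewrite divr_gt0 ?mulr_gt0 ?exprn_gt0.
  by move: ht => /andP[]; nra.
apply: ler_sum => k _; rewrite (hornerZ (f (k%:R / N%:R))) -mulrBl normrM.
have b0 := bern_ge0 N k ht.
rewrite (ger0_norm b0) mulrA -mulrDl; apply: ler_wpM2r => //.
have hk : 0 <= (k%:R / N%:R : R) <= 1.
  by rewrite divr_ge0 //= ler_pdivrMr // mul1r ler_nat -ltnS.
have [h|h] := ltP `|t - k%:R / N%:R| d.
  have := ltW (hd _ _ ht hk h) => h'; apply: le_trans h' _.
  by rewrite lerDl mulr_ge0 ?sqr_ge0 // divr_ge0 ?sqr_ge0 // mulr_ge0 // ltW.
apply: le_trans (_ : 2 * M <= _).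
  apply: le_trans (ler_normB _ _) _; have := hM _ ht; have := hM _ hk; lra.
rewrite -[leLHS]add0r; apply: lerD; first exact: ltW.
rewrite mulrAC ler_pdivlMr ?exprn_gt0 // ler_pM2l ?mulr_gt0 //.
by rewrite -[leRHS]real_normK ?num_real // distrC ler_sqr // nnegrE ltW.
Qed.

End Weierstrass.

(** * Norm bound for polynomials of a positive contraction *)

Section OperatorPolynomialBound.
Context {R : realType} {V : lmodType R} {S : V -> V} (Sl : lin S).
Context {dot : V -> V -> R} (H : inner_product dot) (Ss : symop dot S).
Hypothesis Spos : forall f, 0 <= dot (S f) f.
Hypothesis Sle1 : forall f, dot (S f) f <= dot f f.

(** The operators [pop S (bern n k)] are nonnegative and add up to the identity, so the quadratic
    form of the combination is at most C <f, f> in absolute value, and [symop_bound] applies. *)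
Lemma pop_bern_le n (c : nat -> R) C f : (forall k, (k <= n)%N -> `|c k| <= C) ->
  nrm dot (pop S (\sum_(k < n.+1) c k *: bern n k) f) <= C * nrm dot f.
Proof.
move=> cC; apply: (symop_bound H) => [||{}f]; [exact: pop_lin | exact: pop_sym |].
have -> : dot f f = \sum_(k < n.+1) dot (pop S (bern n k) f) f.
  by rewrite -(dot_suml H) -pop_sum bern_sum1 -[1]/(1%:P) popC scale1r.
rewrite pop_sum (dot_suml H) mulr_sumr; apply: le_trans (ler_norm_sum _ _ _) _.
apply: ler_sum => k _; rewrite popZ (dotZl H) normrM.
rewrite (ger0_norm (pop_pos_bern Sl H Ss Spos Sle1 n k f)).
by rewrite ler_wpM2r ?cC -1?ltnS //; apply: pop_pos_bern.
Qed.

(** In degree n the Bernstein coefficients [c k] of p differ from p(k/n) by at most B / (n - d),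
    hence are bounded by C + e' for large n. *)
Lemma pop_le p C f : (forall t : R, 0 <= t <= 1 -> `|p.[t]| <= C) ->
  nrm dot (pop S p f) <= C * nrm dot f.
Proof.
move=> pC; apply/ler_addgt0Pr => e e0.
have e1 : 0 < e / (nrm dot f + 1) by rewrite divr_gt0 // ltr_wpDl // nrm_ge0.
set e' := e / _ in e1.
apply: le_trans (_ : (C + e') * nrm dot f <= _); last first.
  rewrite mulrDl lerD2l mulrAC ler_pdivrMr ?ltr_wpDl ?nrm_ge0 //.
  by rewrite ler_pM2l // lerDl.
pose d := size p; pose B := \sum_(j < d) `|p`_j| * d%:R ^+ 2.
have [n [dn hn]] := small_div B d e1.
pose c k := \sum_(j < d) p`_j * rbin n k j.
have -> : p = \sum_(k < n.+1) c k *: bern n k.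
  rewrite -{1}[p]coefK poly_def.
  under [RHS]eq_bigr do rewrite scaler_suml.
  rewrite exchange_big /=; apply: eq_bigr => j _.
  rewrite (@bern_monom _ n j) ?scaler_sumr; last first.
    by apply: leq_trans (ltnW (ltn_ord j)) (ltnW dn).
  by apply: eq_bigr => k _; rewrite scalerA.
apply: pop_bern_le => k kn.
have n0 : (0 < n)%N by apply: leq_ltn_trans dn.
have hk : 0 <= (k%:R / n%:R : R) <= 1.
  by rewrite divr_ge0 //= ler_pdivrMr ?ltr0n // mul1r ler_nat.
rewrite -(subrK p.[k%:R / n%:R] (c k)) addrC.
apply: le_trans (ler_normD _ _) _; apply: lerD; first exact: pC.
apply: le_trans (hn n (leqnn n)).
rewrite horner_coef -sumrB /B mulr_suml; apply: le_trans (ler_norm_sum _ _ _) _.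
apply: ler_sum => j _; rewrite -mulrBr normrM -mulrA ler_wpM2l //.
have jn : (j < n)%N by apply: ltn_trans dn.
apply: le_trans (rbin_bound jn kn) _.
apply: ler_pM; rewrite ?sqr_ge0 ?invr_ge0 //.
  by rewrite ler_sqr ?nnegrE ?ler0n // ler_nat ltnW.
by rewrite lef_pV2 ?posrE ?ltr0n ?subn_gt0 // ler_nat leq_sub2l // ltnW.
Qed.

(** Continuity of p fills in the endpoint t = 0, which corresponds to x = +oo under t = (1 +
    x)^-1. *)
Lemma pop_le_oc p C f : (forall t : R, 0 < t <= 1 -> `|p.[t]| <= C) ->
  nrm dot (pop S p f) <= C * nrm dot f.
Proof.
move=> pC; apply: pop_le => t /andP[]; rewrite le_eqVlt => /orP[/eqP <- _|t0 t1].
  rewrite -subr_le0.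
  apply: (@le_cvg0 _ (fun n => `|p.[0]| - `|p.[n.+1%:R^-1]|)) => [n|].
    by rewrite lerD2l lerN2; apply: pC; rewrite invr_gt0 ltr0n /= invf_le1 ?ltr0n // ler1n.
  rewrite -[X in _ --> X](subrr `|p.[0]|); apply: cvgB; first exact: cvg_cst.
  apply: cvg_norm; apply: (@continuous_seq _ (horner p) _ _ _ (@cvg_invSn R)).
  exact: continuous_horner.
by apply: pC; rewrite t0.
Qed.

End OperatorPolynomialBound.

(** * C_0(R) and the change of variable t = (1 + x)^-1 *)

Section C0Functions.
Context {R : realType}.
Implicit Types (f g phi psi : R -> R) (a e C r x y t : R).

Lemma C0P phi : C0 phi <-> continuous phi /\
  forall e : R, 0 < e -> exists A : R, forall x : R, A < `|x| -> `|phi x| < e.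
Proof.
split=> [[pc h1 h2]|[pc h]]; split=> //.
- move=> e e0.
  have [A1 [_ hA1]] := (cvgr0Pnorm_lt _).1 h1 e e0.
  have [A2 [_ hA2]] := (cvgr0Pnorm_lt _).1 h2 e e0.
  exists (Num.max A1 (- A2)) => x; rewrite gt_max => /andP[k1 k2].
  have [x0|x0] := leP 0 x; first by apply: hA1; rewrite -(ger0_norm x0).
  by apply: hA2; move: k2; rewrite (ltr0_norm x0) ltrN2.
- apply/cvgr0Pnorm_lt => e e0; have [A hA] := h e e0.
  exists A; split; first exact: num_real.
  by move=> x Ax; apply: hA; apply: lt_le_trans Ax (ler_norm x).
- apply/cvgr0Pnorm_lt => e e0; have [A hA] := h e e0.
  exists (- A); split; first exact: num_real.
  move=> x Ax; apply: hA; rewrite ltrNr in Ax; apply: lt_le_trans Ax _.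
  by rewrite -normrN ler_norm.
Qed.

Lemma C0_le phi psi C : continuous psi -> C0 phi ->
  (forall x, `|psi x| <= C * `|phi x|) -> C0 psi.
Proof.
move=> pc /C0P[_ h] pp; apply/C0P; split=> // e e0.
have C1 : 0 < `|C| + 1 by rewrite ltr_wpDl.
have [A hA] := h (e / (`|C| + 1)) (divr_gt0 e0 C1).
exists A => x /hA; rewrite ltr_pdivlMr // => hx; apply: le_lt_trans (pp x) _.
apply: le_lt_trans hx; rewrite mulrC ler_wpM2l //.
by have := ler_norm C; have := @ler01 R; lra.
Qed.

Lemma C0_lin a phi psi : C0 phi -> C0 psi -> C0 (a \*o phi + psi).
Proof.
move=> [c1 p1 n1] [c2 p2 n2]; split.
- move=> x; apply: cvgD; last exact: c2.
  by apply: cvgM; [exact: cvg_cst | exact: c1].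
- rewrite -(addr0 0) -{1}(mulr0 a); apply: cvgD => //.
  by apply: cvgM => //; exact: cvg_cst.
- rewrite -(addr0 0) -{1}(mulr0 a); apply: cvgD => //.
  by apply: cvgM => //; exact: cvg_cst.
Qed.

Lemma C0_mul phi psi : C0 phi -> C0 psi -> C0 (phi \* psi).
Proof.
move=> [c1 p1 n1] [c2 p2 n2]; split.
- by move=> x; apply: cvgM; [exact: c1 | exact: c2].
- by rewrite -(mulr0 0); apply: cvgM.
- by rewrite -(mulr0 0); apply: cvgM.
Qed.

Lemma C0_comp_abs phi : C0 phi -> C0 (fun x => phi `|x|).
Proof.
move=> /C0P[pc h]; apply/C0P; split.
  move=> x; apply: (@continuous_comp _ _ _ (fun x => `|x|) phi); last exact: pc.
  exact: norm_continuous.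
by move=> e /h[A hA]; exists A => x Ax; apply: hA; rewrite normr_id.
Qed.

Lemma small_mul e M : 0 < e -> 0 <= M -> exists2 d : R, 0 < d & d * M <= e.
Proof.
move=> e0 M0; exists (e / (M + 1)); first by rewrite divr_gt0 // ltr_wpDl.
by rewrite mulrAC ler_pdivrMr ?ltr_wpDl // ler_pM2l // lerDl.
Qed.

(** The absolute value puts (1 + x)^-1 into C_0(R) without changing it on [0, +oo[. *)
Definition res1 (x : R) : R := (1 + `|x|)^-1.

Lemma res1_gt0 x : 0 < res1 x.
Proof. by rewrite invr_gt0 ltr_pwDl. Qed.

Lemma res1_le1 x : res1 x <= 1.
Proof. by rewrite invf_le1 ?lerDl ?ltr_pwDl. Qed.

Lemma continuous_res1 : continuous res1.
Proof.
move=> x; apply: cvgV; first by rewrite gt_eqF // ltr_pwDl.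
by apply: cvgD; [exact: cvg_cst | exact: norm_continuous].
Qed.

Lemma C0_res1 : C0 res1.
Proof.
apply/C0P; split; first exact: continuous_res1.
move=> e e0; exists e^-1 => x ex; rewrite ger0_norm ?ltW ?res1_gt0 //.
rewrite /res1 invf_plt ?posrE ?ltr_pwDl //.
exact: ltW.
Qed.

Lemma C0_support r phi : continuous phi -> (forall x, r < `|x| -> phi x = 0) -> C0 phi.
Proof.
move=> pc h; apply/C0P; split=> // e e0; exists r => x /h ->.
by rewrite normr0.
Qed.

(** The restriction of phi to [0, +oo[ in the variable t = (1 + x)^-1, which is the spectral
    variable of S. The value 0 at t = 0 stands for the limit of phi at +oo. *)
Definition cayley phi (t : R) : R := if 0 < t then phi (t^-1 - 1) else 0.

Lemma continuous_cayley phi : C0 phi -> continuous (cayley phi).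
Proof.
move=> /C0P[pc h] t; have [t0|t0|<-] := ltgtP 0 t.
- have ct : {for t, continuous (fun t => phi (t^-1 - 1))}.
    apply: (@continuous_comp _ _ _ (fun t => t^-1 - 1) phi); last exact: pc.
    apply: cvgB; last exact: cvg_cst.
    by apply: cvgV; [rewrite gt_eqF | exact: cvg_id].
  rewrite /continuous_at {2}/cayley t0; apply: cvg_trans ct.
  apply: near_eq_cvg; near=> s; rewrite /cayley ifT //.
  by near: s; apply: lt_nbhsr.
- rewrite /continuous_at {2}/cayley ltNge (ltW t0) /=.
  apply: cvg_trans (@cvg_cst _ (0 : R) _ (nbhs t) _).
  apply: near_eq_cvg; near=> s; rewrite /cayley ifF //.
  apply/negbTE; rewrite -leNgt ltW //; near: s; exact: lt_nbhsl.
- rewrite /continuous_at {2}/cayley ltxx.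
  apply/cvgr0Pnorm_lt => e e0; have [A hA] := h e e0.
  have B0 : 0 < (`|A| + 1)^-1 by rewrite invr_gt0 ltr_wpDl.
  near=> s; rewrite /cayley; case: ifP => s0; last by rewrite normr0.
  apply: hA; apply: lt_le_trans (ler_norm _); rewrite ltrBrDr.
  apply: le_lt_trans (_ : `|A| + 1 < _); first by rewrite lerD2r ler_norm.
  rewrite -[ltLHS]invrK ltf_pV2 ?posrE ?invr_gt0 //.
  by near: s; apply: lt_nbhsl.
Unshelve. all: by end_near.
Qed.

Lemma cayleyE phi x : 0 <= x -> cayley phi (1 + x)^-1 = phi x.
Proof.
move=> x0; rewrite /cayley invr_gt0 ltr_pwDl // invrK.
by rewrite addrAC subrr add0r.
Qed.

Lemma inv1_in01 x : 0 <= x -> 0 < (1 + x)^-1 <= 1.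
Proof. by move=> x0; rewrite invr_gt0 ltr_pwDl //= invf_le1 ?lerDl ?ltr_pwDl. Qed.

Lemma inv1_surj t : 0 < t <= 1 -> exists2 x : R, 0 <= x & t = (1 + x)^-1.
Proof.
move=> /andP[t0 t1]; exists (t^-1 - 1); last by rewrite subrKC invrK.
by rewrite subr_ge0 invf_ge1.
Qed.

Lemma C0_bounded phi : C0 phi ->
  exists2 C : R, 0 < C & forall x : R, 0 <= x -> `|phi x| <= C.
Proof.
move=> hp; have [M M0 hM] := bounded01 (continuous_cayley hp).
exists M => // x x0; rewrite -(cayleyE phi x0); apply: hM.
by have /andP[h1 h2] := inv1_in01 x0; rewrite ltW.
Qed.

(** Weierstrass for [cayley phi]. Since this function vanishes at 0, the polynomial has a constant
    term of size at most e/2, which is dropped at the cost of another e/2. *)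
Lemma C0_approx phi e : C0 phi -> 0 < e -> exists q : {poly R},
  q.[0] = 0 /\ forall x : R, 0 <= x -> `|phi x - q.[(1 + x)^-1]| <= e.
Proof.
move=> hp e0; have e20 : 0 < e / 2 by rewrite divr_gt0.
have [q hq] := weierstrass01 (continuous_cayley hp) e20.
exists (q - q.[0]%:P); split; first by rewrite !hornerE subrr.
move=> x x0; rewrite !hornerE opprD opprK addrA -(cayleyE phi x0).
apply: le_trans (ler_normD _ _) _; rewrite [e]splitr; apply: lerD.
  by apply: hq; have /andP[h1 h2] := inv1_in01 x0; rewrite ltW.
have := hq 0; rewrite lexx ler01 /cayley ltxx sub0r normrN; exact.
Qed.

(** As q = q' X, the function is a bounded multiple of [res1]. *)
Lemma C0_poly_res1 (q : {poly R}) : q.[0] = 0 -> C0 (fun x => q.[res1 x]).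
Proof.
move=> q0; have : root q 0 by apply/rootP.
move=> /factor_theorem[q' ->]; rewrite subr0 {q q0}.
have cq : continuous (fun x => q'.[res1 x]).
  move=> x; apply: (@continuous_comp _ _ _ res1 (horner q')).
    exact: continuous_res1.
  exact: continuous_horner.
have -> : (fun x => (q' * 'X).[res1 x]) = (fun x => q'.[res1 x]) \* res1.
  by apply/funext => x; rewrite hornerMX.
have [M M0 hM] := bounded01 (@continuous_horner _ q').
apply: (@C0_le res1 _ M); last 1 first.
- move=> x; rewrite normrM ler_wpM2r // hM // ltW ?res1_gt0 //.
  exact: res1_le1.
- by move=> x; apply: cvgM; [exact: cq | exact: continuous_res1].
- exact: C0_res1.
Qed.

End C0Functions.

(** * Construction of phi(L) as a limit of polynomials in S *)

Section FunctionalCalculus.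
Context {R : realType} {V : lmodType R} {S : V -> V} (Sl : lin S).
Context {dot : V -> V -> R} (H : inner_product dot) (Ss : symop dot S).
Context (Hc : hcomplete dot).
Context (Spos : forall f, 0 <= dot (S f) f) (Sle1 : forall f, dot (S f) f <= dot f f).
Local Notation nrm := (nrm dot).
Implicit Types (phi psi : R -> R) (A B : V -> V) (q : {poly R}).

(* S plays the role of (1 + L)^-1, so that A is phi(L). *)
Definition approxop phi A : Prop := forall e : R, 0 < e -> exists q,
  [/\ q.[0] = 0, forall x : R, 0 <= x -> `|phi x - q.[(1 + x)^-1]| <= e
    & forall f, nrm (A f - pop S q f) <= e * nrm f].

Lemma pop_le_inv1 q C f : (forall x : R, 0 <= x -> `|q.[(1 + x)^-1]| <= C) ->
  nrm (pop S q f) <= C * nrm f.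
Proof.
move=> h; apply: (pop_le_oc Sl H Ss Spos Sle1) => t /inv1_surj[x x0 ->].
exact: h.
Qed.

Lemma popB p q f : pop S (p - q) f = pop S p f - pop S q f.
Proof.
by rewrite popD -(scaleN1r q) popZ scaleN1r.
Qed.

Lemma pop_norm q : exists2 C : R, 0 < C & forall f, nrm (pop S q f) <= C * nrm f.
Proof.
have [C C0 hC] := bounded01 (@continuous_horner _ q).
exists C => // f; exact: (pop_le Sl H Ss Spos Sle1).
Qed.

Lemma approxop_eq phi psi A B f : approxop phi A -> approxop psi B ->
  (forall x : R, 0 <= x -> phi x = psi x) -> A f = B f.
Proof.
move=> hA hB pp; apply: (nrmB_le0 H); apply/ler_addgt0Pr => e e0; rewrite add0r.
have [d e1 de] := small_mul e0 (mulr_ge0 (ler0n _ 4) (nrm_ge0 dot f)).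
have [p [_ hp1 hp2]] := hA d e1; have [q [_ hq1 hq2]] := hB d e1.
have pq : nrm (pop S (p - q) f) <= (2 * d) * nrm f.
  apply: pop_le_inv1 => x x0; have := hp1 x x0; have := hq1 x x0.
  rewrite (pp x x0) !hornerE !ler_norml; lra.
have : nrm (A f - B f) <= (4 * d) * nrm f.
  have h1 := nrm_triB H (pop S p f) (A f) (B f).
  have h2 := nrm_triB H (pop S q f) (pop S p f) (B f).
  have := hp2 f; have := hq2 f; move: pq; rewrite popB (nrmB H (B f)); lra.
by move/le_trans; apply; move: de; lra.
Qed.

(** For polynomials q_n approximating phi uniformly, |q_i(S) f - q_j(S) f| <= (eps_i + eps_j) |f| by
    [pop_le_inv1]; completeness gives the limit. *)
Lemma approxop_exists phi : C0 phi -> exists A, approxop phi A.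
Proof.
move=> hp; have [eps [eps0 epsl]] : exists eps : nat -> R,
    (forall n, 0 < eps n) /\ eps n @[n --> \oo] --> (0 : R).
  by exists (fun n => n.+1%:R^-1); split=> [n|]; [rewrite invr_gt0 | exact: cvg_invSn].
have epsN (e : R) : 0 < e -> exists N, forall n, (N <= n)%N -> eps n < e.
  move=> /((cvg0P eps).1 epsl)[N hN]; exists N => n /hN.
  by rewrite ger0_norm // ltW.
have /choice[q hq] : forall n, exists q : {poly R}, q.[0] = 0 /\
    forall x : R, 0 <= x -> `|phi x - q.[(1 + x)^-1]| <= eps n.
  by move=> n; apply: C0_approx.
have qq i j f : nrm (pop S (q i) f - pop S (q j) f) <= (eps i + eps j) * nrm f.
  rewrite -popB; apply: pop_le_inv1 => x x0.
  have := (hq i).2 x x0; have := (hq j).2 x x0.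
  by rewrite !hornerE !ler_norml; lra.
have /choice[A hA] : forall f, exists u, hcvg dot (fun n => pop S (q n) f) u.
  move=> f; apply: Hc => e e0.
  have [d d0 de] := small_mul e0 (mulr_ge0 (ler0n _ 2) (nrm_ge0 dot f)).
  have [N hN] := epsN (d / 2) (divr_gt0 d0 (ltr0n _ 2)).
  exists N => i j /hN hi /hN hj.
  apply: le_lt_trans (qq i j f) _.
  apply: le_lt_trans (_ : d * nrm f < _).
    by rewrite ler_wpM2r ?nrm_ge0 //; lra.
  have := nrm_ge0 dot f; rewrite le_eqVlt => /orP[/eqP <-|f0]; first by rewrite mulr0.
  by apply: lt_le_trans de; rewrite ltr_pM2l //; lra.
exists A => e e0; have [N hN] := epsN e e0.
exists (q N); split; [exact: (hq N).1 | |].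
  move=> x x0; apply: le_trans ((hq N).2 x x0) _; exact: ltW (hN N (leqnn N)).
move=> f; apply: le_trans (_ : eps N * nrm f <= _); last first.
  by rewrite ler_wpM2r ?nrm_ge0 // ltW // hN.
rewrite -subr_le0.
apply: (@le_cvg0 _ (fun n => nrm (pop S (q n) f - A f) + eps n * nrm f)).
  move=> n; have := qq n N f; have := nrm_triB H (pop S (q n) f) (A f) (pop S (q N) f).
  rewrite (nrmB H (A f) (pop S (q n) f)) mulrDl; lra.
rewrite -(addr0 0) -{2}(mul0r (nrm f)); apply: cvgD; first exact: hA.
by apply: cvgM => //; exact: cvg_cst.
Qed.

Lemma approxop_le phi A C f : approxop phi A ->
  (forall x : R, 0 <= x -> `|phi x| <= C) -> nrm (A f) <= C * nrm f.
Proof.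
move=> hA pC; apply/ler_addgt0Pr => e e0.
have [d e1 de] := small_mul e0 (mulr_ge0 (ler0n _ 2) (nrm_ge0 dot f)).
have [q [_ hq1 hq2]] := hA d e1.
have h1 : nrm (pop S q f) <= (C + d) * nrm f.
  apply: pop_le_inv1 => x x0; have := pC x x0; have := hq1 x x0.
  by rewrite !ler_norml; lra.
have h2 := hq2 f; have h3 := nrm_sub_ge H (A f) (pop S q f).
lra.
Qed.

Lemma approxop_lin phi A : approxop phi A -> lin A.
Proof.
move=> hA a u v; apply: (nrmB_le0 H); apply/ler_addgt0Pr => e e0; rewrite add0r.
pose M := nrm (a *: u + v) + `|a| * nrm u + nrm v.
have M0 : 0 <= M by rewrite !addr_ge0 ?mulr_ge0 ?nrm_ge0.
have [d e1 de] := small_mul e0 M0; have [q [_ _ hq]] := hA d e1.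
apply: le_trans de.
have -> : A (a *: u + v) - (a *: A u + A v) = (A (a *: u + v) - pop S q (a *: u + v))
  - (a *: (A u - pop S q u) + (A v - pop S q v)).
  rewrite scalerBr addrACA -opprD -(pop_lin Sl).
  by rewrite (opprB _ (pop S q _)) addrA subrK.
have h1 := nrmBD H (A (a *: u + v) - pop S q (a *: u + v))
  (a *: (A u - pop S q u) + (A v - pop S q v)).
have h2 := nrmD H (a *: (A u - pop S q u)) (A v - pop S q v).
have h3 := hq (a *: u + v); have h4 := ler_wpM2l (normr_ge0 a) (hq u); have h5 := hq v.
rewrite (nrmZ H) in h2; rewrite /M; move: h1 h2 h3 h4 h5; set X := nrm (_ - _ - _).
by move=> *; lra.
Qed.

Lemma approxop_sym phi A : approxop phi A -> symop dot A.
Proof.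
move=> hA u v; apply/eqP; rewrite -subr_eq0 -normr_le0; apply/ler_addgt0Pr => e e0.
rewrite add0r; pose M := nrm u * nrm v.
have M0 : 0 <= M by rewrite mulr_ge0 ?nrm_ge0.
have [d e1 de] := small_mul e0 (mulr_ge0 (ler0n _ 2) M0).
have [q [_ _ hq]] := hA d e1.
have -> : dot (A u) v - dot u (A v) = dot (A u - pop S q u) v - dot u (A v - pop S q v).
  by rewrite !(dotE H) (pop_sym Sl H Ss); ring.
have h1 := dot_CS H (A u - pop S q u) v; have h2 := dot_CS H u (A v - pop S q v).
have h3 := ler_wpM2r (nrm_ge0 dot v) (hq u); have h4 := ler_wpM2l (nrm_ge0 dot u) (hq v).
apply: le_trans (ler_normB _ _) _.
by apply: le_trans de; rewrite /M; lra.
Qed.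

Lemma approxop_comb a phi psi A B : approxop phi A -> approxop psi B ->
  approxop (a \*o phi + psi) (fun f => a *: A f + B f).
Proof.
move=> hA hB e e0.
have a1 : 0 < `|a| + 1 by rewrite ltr_wpDl.
have [d [e1 de]] : exists d : R, 0 < d /\ d * (`|a| + 1) = e.
  by exists (e / (`|a| + 1)); rewrite divr_gt0 // mulfVK // gt_eqF.
have [p [p0 hp1 hp2]] := hA d e1; have [q [q0 hq1 hq2]] := hB d e1.
exists (a *: p + q); split; first by rewrite !hornerE p0 q0 mulr0 addr0.
  move=> x x0; rewrite !hornerE -de.
  rewrite (_ : _ - _ = a * (phi x - p.[(1 + x)^-1]) + (psi x - q.[(1 + x)^-1])); last first.
    by rewrite fctE /=; ring.
  apply: le_trans (ler_normD _ _) _; rewrite normrM.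
  have := ler_wpM2l (normr_ge0 a) (hp1 x x0); have := hq1 x x0; lra.
move=> f; rewrite popP opprD addrACA -scalerBr -de.
have h1 := nrmD H (a *: (A f - pop S p f)) (B f - pop S q f).
have h2 := ler_wpM2l (normr_ge0 a) (hp2 f); have h3 := hq2 f.
by rewrite (nrmZ H) in h1; lra.
Qed.

Lemma approxop_mul phi psi A B : C0 phi -> C0 psi -> approxop phi A -> approxop psi B ->
  approxop (phi \* psi) (A \o B).
Proof.
move=> hphi hpsi hA hB e e0.
have [C C0 hC] := C0_bounded hphi; have [D D0 hD] := C0_bounded hpsi.
(* The total error C d + d (D + d) is at most d (C + D + 1) because d <= 1. *)
pose d := Num.min 1 (e / (C + D + 1)).
have CD : 0 < C + D + 1 by rewrite !addr_gt0.
have d0 : 0 < d by rewrite lt_min ltr01 divr_gt0.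
have d1 : d <= 1 by rewrite ge_min lexx.
have de : d * (C + D + 1) <= e by rewrite -ler_pdivlMr // ge_min lexx orbT.
have [p [p0 hp1 hp2]] := hA d d0; have [q [q0 hq1 hq2]] := hB d d0.
have qD f : nrm (pop S q f) <= (D + d) * nrm f.
  apply: pop_le_inv1 => x x0; have := hD x x0; have := hq1 x x0.
  by rewrite !ler_norml; lra.
exists (p * q); split; first by rewrite hornerM p0 mul0r.
  move=> x x0; rewrite hornerM /=.
  rewrite (_ : _ - _ = phi x * (psi x - q.[(1 + x)^-1]) +
    (phi x - p.[(1 + x)^-1]) * q.[(1 + x)^-1]); last by ring.
  apply: le_trans (ler_normD _ _) _; rewrite !normrM.
  have k1 : `|q.[(1 + x)^-1]| <= D + d.
    by have := hD x x0; have := hq1 x x0; rewrite !ler_norml; lra.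
  have k2 := ler_pM (normr_ge0 _) (normr_ge0 _) (hC x x0) (hq1 x x0).
  have k3 := ler_pM (normr_ge0 _) (normr_ge0 _) (hp1 x x0) k1.
  by nra.
move=> f /=; rewrite (popM Sl).
have h1 := nrm_triB H (A (pop S q f)) (A (B f)) (pop S p (pop S q f)).
rewrite -(linB (approxop_lin hA)) in h1.
have h2 := approxop_le (B f - pop S q f) hA hC.
have h3 := hp2 (pop S q f); have h4 := ler_wpM2l (ltW C0) (hq2 f).
have h5 := ler_wpM2l (ltW d0) (qD f).
have h6 : d * ((D + d) * nrm f) <= d * ((D + 1) * nrm f).
  by rewrite ler_pM2l // ler_wpM2r ?nrm_ge0 // lerD2l.
have h7 := ler_wpM2r (nrm_ge0 dot f) de.
lra.
Qed.

Lemma approxop_res1 phi : (forall x : R, 0 <= x -> phi x = (1 + x)^-1) -> approxop phi S.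
Proof.
move=> hp e e0; exists 'X; split; first by rewrite hornerX.
  by move=> x x0; rewrite hornerX hp // subrr normr0 ltW.
by move=> f; rewrite (popXE Sl) subrr (nrm0 H) mulr_ge0 ?nrm_ge0 // ltW.
Qed.

End FunctionalCalculus.

Record pos_contraction {R : realType} {V : lmodType R} (dot : V -> V -> R)
    (S : V -> V) : Prop := PosContraction {
  pc_lin : lin S;
  pc_sym : symop dot S;
  pc_ge0 : forall f, 0 <= dot (S f) f;
  pc_le1 : forall f, dot (S f) f <= dot f f }.

Definition fcalc {R : realType} {V : lmodType R} (dot : V -> V -> R) (S : V -> V)
    (phi : R -> R) : V -> V :=
  xget (fun=> 0) [set A | approxop (S := S) (dot := dot) phi A].

Section Calculus.
Context {R : realType} {V : lmodType R} {dot : V -> V -> R}.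
Context (H : inner_product dot) (Hc : hcomplete dot).
Context {S : V -> V} (HS : pos_contraction dot S).
Local Notation nrm := (nrm dot).
Implicit Types (phi psi : R -> R) (q : {poly R}) (a e C l r t x : R).

Let Sl := pc_lin HS.
Let Ss := pc_sym HS.
Let S0 := pc_ge0 HS.
Let S1 := pc_le1 HS.

Local Notation fc := (fcalc dot S).

Lemma fcP phi : C0 phi -> approxop (S := S) (dot := dot) phi (fc phi).
Proof.
move=> hp; have [A hA] := approxop_exists Sl H Ss Hc S0 S1 hp.
by rewrite /fcalc; case: xgetP => [//|/(_ A) /(_ hA)].
Qed.

Lemma fc_uniq phi A f : C0 phi -> approxop (S := S) (dot := dot) phi A ->
  A f = fc phi f.
Proof. by move=> hp hA; apply: (approxop_eq Sl H Ss S0 S1 f hA (fcP hp)). Qed.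

Lemma fc_eq phi psi f : C0 phi -> C0 psi ->
  (forall x, 0 <= x -> phi x = psi x) -> fc phi f = fc psi f.
Proof.
by move=> hp hq; apply: (approxop_eq Sl H Ss S0 S1); exact: fcP.
Qed.

Lemma fc_lin phi : C0 phi -> lin (fc phi).
Proof. by move/fcP; exact: (approxop_lin Sl H). Qed.

Lemma fc_sym phi : C0 phi -> symop dot (fc phi).
Proof. by move/fcP; exact: (approxop_sym Sl H Ss). Qed.

Lemma fc_le phi C f : C0 phi -> (forall x, 0 <= x -> `|phi x| <= C) ->
  nrm (fc phi f) <= C * nrm f.
Proof. by move/fcP => h; exact: (approxop_le Sl H Ss S0 S1 f h). Qed.

Lemma fc_comb a phi psi f : C0 phi -> C0 psi ->
  fc (a \*o phi + psi) f = a *: fc phi f + fc psi f.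
Proof.
move=> hp hq; symmetry; apply: (fc_uniq (A := fun f => a *: fc phi f + fc psi f)).
  exact: C0_lin.
by apply: (approxop_comb H); exact: fcP.
Qed.

Lemma fc_mul phi psi f : C0 phi -> C0 psi ->
  fc (phi \* psi) f = fc phi (fc psi f).
Proof.
move=> hp hq; symmetry; apply: (fc_uniq (A := fc phi \o fc psi)).
  exact: C0_mul.
by apply: (approxop_mul Sl H Ss S0 S1) => //; exact: fcP.
Qed.

Lemma fc_res1 phi f : C0 phi -> (forall x, 0 <= x -> phi x = (1 + x)^-1) ->
  fc phi f = S f.
Proof.
move=> hp h; symmetry; apply: fc_uniq => //; exact: (approxop_res1 Sl H).
Qed.

Lemma fc_eq0 phi f : C0 phi -> (forall x, 0 <= x -> phi x = 0) -> fc phi f = 0.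
Proof.
move=> hp h; apply: (nrm_le0 H).
by rewrite -(mul0r (nrm f)); apply: fc_le => // x /h ->; rewrite normr0.
Qed.

Lemma fc_bounded phi : C0 phi ->
  exists2 C : R, 0 < C & forall f, nrm (fc phi f) <= C * nrm f.
Proof.
move=> hp; have [C C0 hC] := C0_bounded hp.
by exists C => // f; apply: fc_le.
Qed.

Lemma pc_nrm f : nrm (S f) <= nrm f.
Proof.
rewrite -(mul1r (nrm f)); apply: (symop_bound H Sl Ss) => g.
by rewrite ger0_norm // mul1r.
Qed.

(** This is S (1 - S) >= 0; [opg_ge0] turns it into the nonnegativity of L. *)
Lemma pc_sqr f : dot (S f) (S f) <= dot (S f) f.
Proof.
have := pop_pos_monom Sl H Ss S0 S1 1 1 f.
rewrite !expr1 (popM Sl) (popXE Sl) popB // popXE // -[1]/(1%:P) popC scale1r.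
by rewrite (linB Sl) (dotBl H) subr_ge0 (Ss (S f)).
Qed.

(** Because q(0) = 0, each approximant is q'(S) S and does not distinguish f from P f. For P = 1_U
    this says that [fcalc] is already extended by 0. *)
Lemma fc_absorb (P : V -> V) phi f : C0 phi -> (forall g, S (P g) = S g) ->
  (forall g, nrm (P g) <= nrm g) -> fc phi (P f) = fc phi f.
Proof.
move=> hp SP Pb; apply: (fc_uniq (A := fc phi \o P)) => // e e0.
have [q [q0 hq1 hq2]] := fcP hp e0; exists q; split=> // g /=.
have -> : pop S q g = pop S q (P g).
  have : root q 0 by apply/rootP.
  by move=> /factor_theorem[q' ->]; rewrite subr0 !(popM Sl) !(popXE Sl) SP.
by apply: le_trans (hq2 _) _; rewrite ler_pM2l.
Qed.

Lemma fc_range (P : V -> V) phi f : C0 phi -> lin P -> (forall g, P (S g) = S g) ->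
  (forall g, nrm (P g) <= nrm g) -> P (fc phi f) = fc phi f.
Proof.
move=> hp Pl SP Pb; apply: (fc_uniq (A := P \o fc phi)) => // e e0.
have [q [q0 hq1 hq2]] := fcP hp e0; exists q; split=> // g /=.
have -> : pop S q g = P (pop S q g).
  have : root q 0 by apply/rootP.
  move=> /factor_theorem[q' ->]; rewrite subr0 mulrC !(popM Sl) !(popXE Sl).
  by rewrite SP.
by rewrite -(linB Pl); apply: le_trans (Pb _) (hq2 _).
Qed.

(* Stone-Weierstrass: polynomials in (1 + |x|)^-1 are dense in the even part of C_0(R). *)
Lemma fc_unique (Phi : (R -> R) -> V -> V) :
  (forall a phi psi f, C0 phi -> C0 psi ->
    Phi (a \*o phi + psi) f = a *: Phi phi f + Phi psi f) ->
  (forall phi psi f, C0 phi -> C0 psi -> Phi (phi \* psi) f = Phi phi (Phi psi f)) ->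
  (forall phi C f, C0 phi -> (forall x, `|phi x| <= C) -> nrm (Phi phi f) <= C * nrm f) ->
  (forall phi f, C0 phi -> (forall x, 0 <= x -> phi x = (x + 1)^-1) -> Phi phi f = S f) ->
  forall phi f, C0 phi -> Phi phi f = fc phi f.
Proof.
move=> PhiL PhiM PhiB PhiS.
have PhiD phi psi f : C0 phi -> C0 psi -> Phi (phi + psi) f = Phi phi f + Phi psi f.
  move=> hp hq; have -> : phi + psi = 1 \*o phi + psi.
    by apply/funext => x; rewrite !fctE /= mul1r.
  by rewrite PhiL // scale1r.
have res1S f : Phi res1 f = S f.
  apply: PhiS; first exact: C0_res1.
  by move=> x x0; rewrite /res1 ger0_norm // addrC.
(* Both [res1] and [res1 + phi] coincide with (x + 1)^-1 on [0, +oo[, so the resolvent hypothesis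
   assigns S to both. *)
have Phi0 phi f : C0 phi -> (forall x, 0 <= x -> phi x = 0) -> Phi phi f = 0.
  move=> hp h; apply: (addrI (Phi res1 f)); rewrite addr0 -PhiD //; last exact: C0_res1.
  rewrite res1S; apply: PhiS.
    have -> : res1 + phi = 1 \*o (@res1 R) + phi by apply/funext => x; rewrite !fctE /= mul1r.
    by apply: C0_lin => //; exact: C0_res1.
  by move=> x x0; rewrite fctE h // addr0 /res1 ger0_norm // addrC.
have PhiE phi psi f : C0 phi -> C0 psi -> (forall x, 0 <= x -> phi x = psi x) ->
    Phi phi f = Phi psi f.
  move=> hp hq h; apply/eqP; rewrite -subr_eq0 addrC; apply/eqP.
  have <- : Phi (-1 \*o psi + phi) f = 0.
    apply: Phi0; first exact: C0_lin.
    by move=> x x0; rewrite !fctE /= h // mulN1r addNr.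
  by rewrite PhiL // scaleN1r.
have PhiP q f : q.[0] = 0 -> Phi (fun x => q.[res1 x]) f = pop S q f.
  move=> q0; have : root q 0 by apply/rootP.
  move=> /factor_theorem[p ->]; rewrite subr0 {q q0}.
  elim/poly_ind: p f => [|p c IH] f.
    rewrite mul0r /pop size_poly0 big_ord0; apply: Phi0 => [|x _].
      by apply: C0_poly_res1; rewrite horner0.
    by rewrite horner0.
  have cp : C0 (fun x => (p * 'X).[res1 x]) by apply: C0_poly_res1; rewrite hornerMX mulr0.
  have -> : (fun x => ((p * 'X + c%:P) * 'X).[res1 x]) =
     c \*o (@res1 R) + (fun x => (p * 'X).[res1 x]) \* (@res1 R).
    by apply/funext => x; rewrite !fctE /= !hornerE; ring.
  rewrite PhiL; [|exact: C0_res1|by apply: C0_mul => //; exact: C0_res1].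
  rewrite PhiM //; last exact: C0_res1.
  rewrite IH !res1S mulrDl popD mul_polyC popZ (popXE Sl) (popM Sl (p * 'X)).
  by rewrite (popXE Sl) addrC.
move=> phi f hp; apply: fc_uniq => // e e0.
have [q [q0 hq]] := C0_approx hp e0; exists q; split=> // g.
have cq := C0_poly_res1 q0; have ca := C0_comp_abs hp.
rewrite (PhiE phi _ _ hp ca) => [|x x0]; last by rewrite ger0_norm.
rewrite -PhiP // addrC -scaleN1r -PhiL //; apply: PhiB; first exact: C0_lin.
move=> x; rewrite !fctE /= mulN1r addrC /res1; exact: hq.
Qed.

End Calculus.

(** * Spectrum and essential spectrum *)

(* The graph of the operator L on the range of the projection P for which
   (1 + L)^-1 P = S. *)
Definition opgraph {R : realType} {V : lmodType R} (P S : V -> V) : set (V * V) :=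
  [set uf | P uf.2 = uf.2 /\ uf.1 = S (uf.2 + uf.1)].

Definition res_set {R : realType} {V : lmodType R} (dot : V -> V -> R)
    (P S : V -> V) : set R :=
  [set l | (forall f, P f = f -> exists! u, opgraph P S (u, f + l *: u)) /\
     exists C : R, forall u f, opgraph P S (u, f) ->
       nrm dot u <= C * nrm dot (f - l *: u)].

(** For a subset U of X, P is going to be multiplication by 1_U, the projection onto l^2(U, m), and
    S the operator (1 + L_U)^-1 P on the whole space. *)
Record compatible {R : realType} {V : lmodType R} (dot : V -> V -> R)
    (P S : V -> V) : Prop := Compatible {
  cp_lin : lin P;
  cp_nrm : forall f, nrm dot (P f) <= nrm dot f;
  cp_PS : forall f, P (S f) = S f;
  cp_SP : forall f, S (P f) = S f;
  cp_PP : forall f, P (P f) = P f }.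

Section Spectrum.
Context {R : realType} {V : lmodType R} {dot : V -> V -> R}.
Context (H : inner_product dot) (Hc : hcomplete dot).
Context {P S : V -> V} (HS : pos_contraction dot S) (HP : compatible dot P S).
Local Notation nrm_for := nrm.
Local Notation nrm := (nrm dot).
Local Notation opg := (opgraph P S).
Local Notation res := (res_set dot P S).
Implicit Types (phi psi : R -> R) (a e C l r t x mu : R) (u v w f g : V).

Let Sl := pc_lin HS.
Let Ss := pc_sym HS.
Let Pl := cp_lin HP.

Lemma opg_comb a u f v g : opg (u, f) -> opg (v, g) -> opg (a *: u + v, a *: f + g).
Proof.
move=> [/= Pf uE] [/= Pg vE]; split=> /=; first by rewrite Pl Pf Pg.
by rewrite addrACA -scalerDr Sl -uE -vE.
Qed.

Lemma opg_sym u f v g : opg (u, f) -> opg (v, g) -> dot f v = dot u g.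
Proof.
move=> [/= _ uE] [/= _ vE].
have : dot (f + u) v = dot u (g + v) by rewrite {1}vE -Ss -uE.
by rewrite (dotDl H) (dotDr H) => /addIr.
Qed.

Lemma opg_ge0 u f : opg (u, f) -> 0 <= dot f u.
Proof.
move=> [/= _ uE]; have := pc_sqr H HS (f + u).
by rewrite -uE (dotDr H) lerDr (dotC H u).
Qed.

Lemma opg_S u f l : opg (u, f) -> u - (1 + l) *: S u = S (f - l *: u).
Proof.
move=> [/= _ uE]; rewrite (linB Sl) (linZ Sl) scalerDl scale1r opprD addrA.
by rewrite {1}uE (linD Sl) addrK.
Qed.

Lemma opg_S_eig l u : 0 <= l -> opg (u, l *: u) -> S u = (1 + l)^-1 *: u.
Proof.
move=> l0 /(opg_S l); rewrite subrr (lin0 Sl) => /subr0_eq ue.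
by rewrite {2}ue scalerA mulVf ?scale1r // gt_eqF // ltr_pwDl.
Qed.

(** From (1 + L) S w = P w. *)
Lemma opg_of_S w : opg (S w, P w - S w).
Proof.
split=> /=; first by rewrite (linB Pl) (cp_PP HP) (cp_PS HP).
by rewrite subrK (cp_SP HP).
Qed.

Lemma hcvg_opg (un fn : nat -> V) u f : hcvg dot un u -> hcvg dot fn f ->
  (forall n, opg (un n, fn n)) -> opg (u, f).
Proof.
move=> hu hf h; split=> /=.
  have : hcvg dot (P \o fn) (P f).
    have h1 g : nrm (P g) <= 1 * nrm g by rewrite mul1r; exact: cp_nrm HP g.
    exact: (hcvg_op Pl h1 hf).
  have -> : P \o fn = fn by apply/funext => n; have [] := h n.
  by move/(hcvg_unique H); apply.
have : hcvg dot (S \o (fun n => fn n + un n)) (S (f + u)).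
  have h1 g : nrm (S g) <= 1 * nrm g by rewrite mul1r; exact: (pc_nrm H HS).
  apply: (hcvg_op Sl h1); have := hcvgP H 1 hf hu; rewrite scale1r.
  by under eq_fun do rewrite scale1r.
have -> : S \o (fun n => fn n + un n) = un.
  by apply/funext => n; have [_ /= <-] := h n.
by move/(hcvg_unique H hu).
Qed.

(** The inner product <N u, N v> is complete because N is bounded and bounded from below, so [riesz]
    gives w with <N w, N v> = <g, v> for all v. Symmetry of N turns this into N (N w) = g. *)
Lemma surj_of_bounded_below (N : V -> V) C K : lin N -> symop dot N ->
  (forall f, nrm (N f) <= C * nrm f) -> (forall f, nrm f <= K * nrm (N f)) ->
  forall g, exists f, N f = g.
Proof.
move=> Nl Ns NC NK g; pose dotN u v := dot (N u) (N v).
have nE u : nrm (N u) = nrm_for dotN u by [].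
have HN : inner_product dotN.
  split=> [u v|a u v w|u|u]; rewrite /dotN.
  - exact: dotC H _ _.
  - by rewrite Nl (dotP H).
  - exact: dot_ge0 H _.
  move=> /(dot_eq0 H) Nu; apply: (nrm_le0 H).
  by apply: le_trans (NK u) _; rewrite Nu (nrm0 H) mulr0.
have hcN : hcomplete dotN.
  move=> un uc; have [|u hu] := Hc (un := un).
    move=> e e0; have K0 : 0 < `|K| + 1 by rewrite ltr_wpDl.
    have [M hM] := uc (e / (`|K| + 1)) (divr_gt0 e0 K0); exists M => i j hi hj.
    have := hM i j hi hj; rewrite -nE ltr_pdivlMr // mulrC; apply: le_lt_trans.
    apply: le_trans (NK _) _; rewrite ler_wpM2r ?nrm_ge0 //.
    by apply: le_trans (ler_norm _) _; rewrite lerDl.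
  exists u; apply: (@cvg0_le _ _ (fun n => C * nrm (un n - u))) => [n|].
    by rewrite -nE ger0_norm ?nrm_ge0.
  by rewrite -(mulr0 C); apply: cvgM => //; exact: cvg_cst.
have gl a u v : dot g (a *: u + v) = a * dot g u + dot g v.
  by rewrite (dotDr H) (dotZr H).
have gb v : `|dot g v| <= (nrm g * K) * nrm_for dotN v.
  by apply: le_trans (dot_CS H _ _) _; rewrite -mulrA ler_wpM2l ?nrm_ge0 // NK.
have [w hw] := riesz HN hcN gl gb.
exists (N w); apply/eqP; rewrite -subr_eq0; apply/eqP/(dot_all_eq0 H) => v.
by rewrite (dotBl H) Ns -/(dotN w v) hw subrr.
Qed.

(** With N = 1 - (1 + l) S, the equation (L - l) u = f is solved by u = S w where N w = f; the lower
    bound on L - l is carried over to N. *)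
Lemma res_of_bound l e : 0 < e ->
  (forall u f, opg (u, f) -> e * nrm u <= nrm (f - l *: u)) -> res l.
Proof.
move=> e0 hb; split; last first.
  by exists e^-1 => u f /hb; rewrite ler_pdivlMl.
pose N w := w - (1 + l) *: S w.
have Nl : lin N.
  move=> a u v; rewrite /N Sl scalerDr opprD addrACA scalerBr.
  by rewrite !scalerA (mulrC a).
have Ns : symop dot N.
  by move=> u v; rewrite /N !(dotE H) Ss.
have NC f : nrm (N f) <= (1 + `|1 + l|) * nrm f.
  rewrite /N mulrDl mul1r; apply: le_trans (nrmBD H _ _) _; rewrite lerD2l (nrmZ H).
  by rewrite ler_wpM2l // (pc_nrm H HS).
(* As f = N f + (1 + l) S f, it remains to bound S f, and P (N f) = (L - l) S f. *)
have NK f : nrm f <= (1 + `|1 + l| / e) * nrm (N f).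
  have PN : P (N f) = P f - S f - l *: S f.
    rewrite /N (linB Pl) (linZ Pl) (cp_PS HP) scalerDl scale1r opprD addrA.
    by [].
  have h1 := hb _ _ (opg_of_S f).
  have h2 := cp_nrm HP (N f); rewrite PN in h2.
  have h3 : nrm (S f) <= nrm (N f) / e by rewrite ler_pdivlMr // mulrC (le_trans h1).
  have h4 := nrmD H (N f) ((1 + l) *: S f); rewrite subrK (nrmZ H) in h4.
  apply: le_trans h4 _; rewrite mulrDl mul1r lerD2l -mulrA ler_wpM2l //.
  by rewrite mulrC.
move=> f Pf; have [w hw] := surj_of_bounded_below Nl Ns NC NK f.
have wE : w = f + (1 + l) *: S w by rewrite -{1}hw subrK.
have wu u : opg (u, f + l *: u) -> N (f + l *: u + u) = f.
  move=> [/= _ uE]; rewrite /N -uE scalerDl scale1r -(addrA f) (addrC (l *: u)).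
  by rewrite addrK.
exists (S w); split.
  split=> /=; first by rewrite addrC Pl Pf (cp_PS HP).
  by rewrite {1}wE scalerDl scale1r (addrC (S w)) addrA.
move=> u hu; have [/= _ uE] := hu.
have : nrm (w - (f + l *: u + u)) <= 0.
  apply: le_trans (NK _) _; rewrite (linB Nl) hw (wu _ hu) subrr (nrm0 H).
  by rewrite mulr0.
by move=> w0; rewrite [RHS]uE; congr (S _); apply: (nrmB_le0 H).
Qed.

Lemma spectrum_approx l e : ~ res l -> 0 < e ->
  exists u f, [/\ opg (u, f), nrm u = 1 & nrm (f - l *: u) < e].
Proof.
move=> nl e0; apply: contrapT => hn; apply: nl; apply: (res_of_bound e0) => u f uf.
have [->|u0] := eqVneq u 0; first by rewrite (nrm0 H) mulr0 nrm_ge0.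
have un := nrm_gt0 H u0.
rewrite leNgt; apply/negP => h; apply: hn.
have o0 : opg (0, 0) by split=> /=; rewrite ?addr0 ?(lin0 Pl) ?(lin0 Sl).
exists ((nrm u)^-1 *: u), ((nrm u)^-1 *: f); split.
- by have := opg_comb (nrm u)^-1 uf o0; rewrite !addr0.
- by rewrite (nrmZ H) ger0_norm ?invr_ge0 ?nrm_ge0 // mulVf // gt_eqF.
rewrite scalerA mulrC -scalerA -scalerBr (nrmZ H) ger0_norm ?invr_ge0 ?nrm_ge0 //.
by rewrite mulrC ltr_pdivrMr.
Qed.

Lemma neg_res l : l < 0 -> res l.
Proof.
move=> l0; apply: (@res_of_bound l (- l)); first by rewrite oppr_gt0.
move=> u f uf; have [->|u0] := eqVneq u 0; first by rewrite (nrm0 H) mulr0 nrm_ge0.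
have un := nrm_gt0 H u0.
rewrite -(ler_pM2r un) -mulrA -expr2 (nrm_sqr H).
apply: le_trans (le_trans (ler_norm _) (dot_CS H (f - l *: u) u)).
by rewrite (dotBl H) (dotZl H) mulNr lerDr (opg_ge0 uf).
Qed.

End Spectrum.

(** * Compactness through weakly null sequences *)

Section Compact.
Context {R : realType} {V : lmodType R} (dot : V -> V -> R).
Implicit Types (A B : V -> V) (u : nat -> V) (z : V).

Definition wnull u : Prop :=
  (exists C : R, forall n, nrm dot (u n) <= C) /\
  forall z, dot (u n) z @[n --> \oo] --> (0 : R).

(* For a bounded operator A, this is compactness. *)
Definition cc A : Prop :=
  forall u, wnull u -> nrm dot (A (u n)) @[n --> \oo] --> (0 : R).

Definition weak_seq_compact : Prop :=
  forall u (C : R), (forall n, nrm dot (u n) <= C) ->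
  exists k : nat -> nat, {homo k : i j / (i < j)%N} /\
    exists z, wnull (fun n => u (k n) - z).

End Compact.

Section CompactTheory.
Context {R : realType} {V : lmodType R} {dot : V -> V -> R}.
Context (H : inner_product dot).
Local Notation nrm := (nrm dot).
Local Notation wnull := (wnull dot).
Local Notation cc := (cc dot).
Implicit Types (A B : V -> V) (u : nat -> V) (z : V) (e a C : R).

Lemma wnull_op A C u : symop dot A -> (forall f, nrm (A f) <= C * nrm f) ->
  wnull u -> wnull (A \o u).
Proof.
move=> As Ab [[D hD] hu]; split.
  exists (`|C| * D) => n; apply: le_trans (Ab _) _.
  apply: le_trans (ler_wpM2r (nrm_ge0 _ _) (ler_norm C)) _.
  by rewrite ler_wpM2l.
by move=> z /=; under eq_fun do rewrite As; exact: hu.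
Qed.

Lemma wnull_sub (k : nat -> nat) u : (forall n, (n <= k n)%N) -> wnull u ->
  wnull (u \o k).
Proof.
move=> hk [[C hC] hu]; split; first by exists C => n /=.
move=> z; exact: (cvg0_sub hk (hu z)).
Qed.

Lemma wnullB u v : wnull u -> wnull v -> wnull (fun n => u n - v n).
Proof.
move=> [[C hC] hu] [[D hD] hv]; split.
  by exists (C + D) => n; apply: le_trans (nrmBD H _ _) _; apply: lerD.
by move=> z; under eq_fun do rewrite (dotBl H); exact: cvg0B (hu z) (hv z).
Qed.

Lemma cc_ext A B : (forall f, A f = B f) -> cc A -> cc B.
Proof. by move=> AB hA u /hA; under eq_fun do rewrite AB. Qed.

Lemma cc_comb a A B : cc A -> cc B -> cc (fun f => a *: A f + B f).
Proof.
move=> hA hB u hu; apply: (@cvg0_le _ _ (fun n => `|a| * nrm (A (u n)) + nrm (B (u n)))).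
  move=> n; rewrite ger0_norm ?nrm_ge0 //; apply: le_trans (nrmD H _ _) _.
  by rewrite (nrmZ H).
exact: cvg0D (cvg0M _ (hA _ hu)) (hB _ hu).
Qed.

Lemma cc_compl A B C : (forall f, nrm (A f) <= C * nrm f) -> cc B -> cc (A \o B).
Proof.
move=> Ab hB u hu; apply: (@cvg0_le _ _ (fun n => C * nrm (B (u n)))) => [n|].
  by rewrite ger0_norm ?nrm_ge0 //= Ab.
exact: cvg0M (hB _ hu).
Qed.

Lemma cc_compr A B C : symop dot B -> (forall f, nrm (B f) <= C * nrm f) ->
  cc A -> cc (A \o B).
Proof. by move=> Bs Bb hA u /(wnull_op Bs Bb)/hA. Qed.

Lemma cc_lim A : (forall e, 0 < e -> exists B,
    cc B /\ forall f, nrm (A f - B f) <= e * nrm f) -> cc A.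
Proof.
move=> h u hu; apply/cvg0P => e e0; have [[C hC] _] := hu.
have C0 : 0 <= C by apply: le_trans (hC 0%N); exact: nrm_ge0.
have e20 : 0 < e / 2 by rewrite divr_gt0.
have [d d0 de] := small_mul e20 C0.
have [B [hB hAB]] := h d d0.
have [N hN] := (cvg0P _).1 (hB u hu) _ e20.
exists N => n /hN; rewrite !ger0_norm ?nrm_ge0 // => h1.
have h2 := nrmD H (A (u n) - B (u n)) (B (u n)); rewrite subrK in h2.
apply: le_lt_trans h2 _; rewrite [ltRHS]splitr; apply: ler_ltD => //.
by apply: le_trans (hAB _) _; apply: le_trans de; rewrite ler_pM2l.
Qed.

(** Along a weakly convergent subsequence the differences of consecutive z_n are weakly null, while
    their images under A have squared norm c^2 + c'^2 >= d^2, where c and c' are the two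
    coefficients. *)
Lemma orthonormal_not_cc (wsc : weak_seq_compact dot) A (zn : nat -> V) (c : nat -> R) d :
  0 < d -> lin A -> cc A -> (forall i j, dot (zn i) (zn j) = (i == j)%:R) ->
  (forall n, A (zn n) = c n *: zn n) -> (forall n, d <= `|c n|) -> False.
Proof.
move=> d0 Al hA on Az cd.
have zn1 n : nrm (zn n) <= 1 by rewrite /nrm on eqxx sqrtr1.
have [k [hk [z hz]]] := wsc zn 1 zn1.
have hk' n : (n <= n.+1)%N by [].
have hy : wnull (fun n => zn (k n.+1) - zn (k n)).
  have -> : (fun n => zn (k n.+1) - zn (k n)) =
     (fun n => (zn (k n.+1) - z) - (zn (k n) - z)).
    by apply/funext => n; rewrite opprB addrA subrK.
  exact: wnullB (wnull_sub hk' hz) hz.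
suff : d <= 0 by rewrite leNgt d0.
apply: le_cvg0 (hA _ hy) => n.
have neq : k n.+1 != k n by rewrite neq_ltn orbC hk.
rewrite (linB Al) !Az -ler_sqr ?nnegrE ?nrm_ge0 ?(ltW d0) // (nrm_sqr H).
rewrite !(dotE H) !on !eqxx (negPf neq) eq_sym (negPf neq).
rewrite !mulr1 !mulr0 !oppr0 !addr0 add0r opprK -!expr2.
have : d ^+ 2 <= c (k n.+1) ^+ 2.
  by rewrite -[leRHS]real_normK ?num_real // ler_sqr ?nnegrE ?(ltW d0).
by have := sqr_ge0 (c (k n)); lra.
Qed.

(** If [expands t v] holds for all v in t, then t is a Parseval frame of its span; this is used in
    place of orthonormality of t. *)
Definition expands (t : seq V) z : Prop := z = \sum_(v <- t) dot z v *: v.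

(** One Gram-Schmidt step: z is the normalized difference of x and its orthogonal projection p onto
    the span of t. *)
Lemma orthogonal_extension (K : set V) (t : seq V) (x : V) :
  (forall a (u v : V), K u -> K v -> K (a *: u + v)) -> K 0 ->
  {in t, forall v, K v} -> K x -> {in t, forall v, expands t v} -> ~ expands t x ->
  exists z, [/\ K z, dot z z = 1, {in t, forall v, dot z v = 0} & expands (z :: t) x].
Proof.
move=> KP K0 tK Kx tt ntx; pose p := \sum_(v <- t) dot x v *: v.
have Kp : K p.
  rewrite /p big_seq; apply: (@big_ind _ K) => // [u v Ku Kv|v vt].
    by have := KP 1 u v Ku Kv; rewrite scale1r.
  by have := KP (dot x v) v 0 (tK v vt) K0; rewrite addr0.
have yt v : v \in t -> dot (x - p) v = 0.
  move=> /tt ve; rewrite (dotBl H) {1}ve (dotC H x) (dot_suml H) (dot_suml H).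
  apply/eqP; rewrite subr_eq0; apply/eqP; apply: eq_bigr => w _.
  by rewrite !(dotZl H) mulrC (dotC H w) (dotC H w).
have y0 : x - p != 0 by rewrite subr_eq0; apply/eqP.
have ny := nrm_gt0 H y0.
have zt v : v \in t -> dot ((nrm (x - p))^-1 *: (x - p)) v = 0.
  by move=> /yt h; rewrite (dotZl H) h mulr0.
have px : dot p (x - p) = 0.
  rewrite (dot_suml H) big_seq big1 // => v vt.
  by rewrite (dotZl H) (dotC H v) yt // mulr0.
exists ((nrm (x - p))^-1 *: (x - p)); split=> //.
- have Kxp : K (x - p) by rewrite addrC -scaleN1r; apply: KP.
  by have := KP (nrm (x - p))^-1 (x - p) 0 Kxp K0; rewrite addr0.
- by rewrite (dotZl H) (dotZr H) -(nrm_sqr H); field; rewrite gt_eqF.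
have xy : dot x (x - p) = nrm (x - p) ^+ 2.
  by rewrite -{1}(subrK p x) (dotDl H) px addr0 (nrm_sqr H).
rewrite /expands big_cons -/p (dotZr H) xy scalerA (_ : _ * _ = 1).
  by rewrite scale1r subrK.
by field; rewrite gt_eqF.
Qed.

Lemma orthonormalize (K : set V) (s : seq V) :
  (forall a (u v : V), K u -> K v -> K (a *: u + v)) -> K 0 ->
  {in s, forall v, K v} -> exists t : seq V, [/\ {in t, forall v, K v},
    {in t, forall v, expands t v} & {in s, forall v, expands t v}].
Proof.
move=> KP K0; elim: s => [|x s IH] sK; first by exists [::].
have [|t [tK tt st]] := IH; first by move=> v vs; apply: sK; rewrite inE vs orbT.
have Kx : K x by apply: sK; rewrite mem_head.
have [hx|hx] := pselect (expands t x).
  by exists t; split=> // v; rewrite inE => /orP[/eqP -> //|]; exact: st.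
have [z [Kz z1 zt zx]] := orthogonal_extension KP K0 tK Kx tt hx.
have ztv v : expands t v -> expands (z :: t) v.
  move=> hv; rewrite /expands big_cons [dot v z](_ : _ = 0) ?scale0r ?add0r //.
  rewrite hv (dot_suml H) big_seq big1 // => w wt.
  by rewrite (dotZl H) (dotC H w) zt // mulr0.
exists (z :: t); split=> v; rewrite inE => /orP[/eqP ->|] //.
- exact: tK.
- rewrite /expands big_cons z1 scale1r big_seq big1 ?addr0 // => w wt.
  by rewrite zt // scale0r.
- by move=> vt; apply: ztv; exact: tt.
- by move=> vs; apply: ztv; exact: st.
Qed.

(** Expanding A u_n in t writes |A u_n|^2 as a finite sum of squares <A u_n, v>^2, and A u_n is
    weakly null. *)
Lemma finite_rank_cc n (e : 'I_n -> V) A C : symop dot A ->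
  (forall f, nrm (A f) <= C * nrm f) ->
  (forall f, exists a : 'I_n -> R, A f = \sum_(i < n) a i *: e i) -> cc A.
Proof.
move=> As Ab Ae.
have [//|//|//|t [_ _ te]] := @orthonormalize setT (codom e).
have At f : expands t (A f).
  have [a ->] := Ae f; elim/big_ind: _ => [|u v hu hv|i _].
  - by rewrite /expands big1 // => v _; rewrite (dot0l H) scale0r.
  - rewrite /expands {1}hu {1}hv -big_split /=; apply: eq_bigr => w _.
    by rewrite (dotDl H) scalerDl.
  rewrite /expands {1}(te _ (codom_f e i)) scaler_sumr; apply: eq_bigr => w _.
  by rewrite (dotZl H) scalerA.
move=> u /(wnull_op As Ab)[_ hw].
have h2 : nrm (A (u n)) ^+ 2 @[n --> \oo] --> (0 : R).
  have -> : (fun n => nrm (A (u n)) ^+ 2) =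
      (fun n => \sum_(v <- t) dot (A (u n)) v * dot (A (u n)) v).
    apply/funext => k; rewrite (nrm_sqr H) {1}At (dot_suml H); apply: eq_bigr => v _.
    by rewrite (dotZl H) (dotC H v).
  elim: (t) => [|v s IH]; first by under eq_fun do rewrite big_nil; exact: cvg_cst.
  under eq_fun do rewrite big_cons.
  apply: cvg0D => //; rewrite -[X in _ --> X](mul0r 0).
  by apply: cvgM; exact: hw.
apply/cvg0P => d d0; have [N hN] := (cvg0P _).1 h2 _ (exprn_gt0 2 d0).
exists N => k /hN; rewrite !ger0_norm ?sqr_ge0 ?nrm_ge0 // ltr_sqr ?nnegrE ?nrm_ge0 //.
exact: ltW.
Qed.

End CompactTheory.

(** * Cut-off functions and a covering argument for ideals of C_0(R) *)

Section RealContinuity.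
Context {R : realType}.
Implicit Types (f g : R -> R).

Lemma contC (a : R) : continuous (fun _ : R => a).
Proof. by move=> x; exact: cvg_cst. Qed.

Lemma contI : continuous (fun x : R => x).
Proof. by move=> x; exact: cvg_id. Qed.

Lemma contB f g : continuous f -> continuous g -> continuous (fun x => f x - g x).
Proof. by move=> hf hg x; apply: cvgB; [exact: hf | exact: hg]. Qed.

Lemma contM f g : continuous f -> continuous g -> continuous (fun x => f x * g x).
Proof. by move=> hf hg x; apply: cvgM; [exact: hf | exact: hg]. Qed.

Lemma cont_comp f g : continuous f -> continuous g -> continuous (fun x => f (g x)).
Proof. by move=> hf hg x; apply: (@continuous_comp _ _ _ g f); [exact: hg | exact: hf]. Qed.

Lemma cont_abs f : continuous f -> continuous (fun x => `|f x|).
Proof. by move=> hf; apply: (@cont_comp (fun x => `|x|) f) => //; exact: norm_continuous. Qed.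

Lemma cont_max f g : continuous f -> continuous g ->
  continuous (fun x => Num.max (f x) (g x)).
Proof. by move=> hf hg x; apply: (@continuous_max _ _ f g); [exact: hf | exact: hg]. Qed.

Lemma cont_min f g : continuous f -> continuous g ->
  continuous (fun x => Num.min (f x) (g x)).
Proof. by move=> hf hg x; apply: (@continuous_min _ _ f g); [exact: hf | exact: hg]. Qed.

Lemma cont_sqrt f : continuous f -> continuous (fun x => Num.sqrt (f x)).
Proof. by move=> hf; apply: (@cont_comp _ f) => //; exact: sqrt_continuous. Qed.

(** Soft thresholding. It changes y by at most e and vanishes for |y| <= e, so composition with it
    moves the support of a continuous f into the closed set where |f| >= e. *)
Definition soft (e y : R) : R := y - Num.max (- e) (Num.min e y).

Lemma soft_dist (e y : R) : 0 <= e -> `|y - soft e y| <= e.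
Proof.
move=> e0; rewrite /soft opprB addrC subrK ler_norml le_max lexx /= ge_max.
by rewrite ge_min lexx andbT; lra.
Qed.

Lemma soft_neq0 (e y : R) : 0 <= e -> soft e y != 0 -> e < `|y|.
Proof.
move=> e0; rewrite ltNge; apply: contra; rewrite ler_norml => /andP[h1 h2].
by rewrite /soft (min_idPr h2) (max_idPr h1) subrr.
Qed.

Lemma soft_le (e y : R) : 0 <= e -> `|soft e y| <= `|y|.
Proof.
move=> e0; rewrite /soft; have [ye|ye] := leP `|y| e.
  have := ye; rewrite ler_norml => /andP[h1 h2].
  by rewrite (min_idPr h2) (max_idPr h1) subrr normr0.
have [y0|y0] := leP 0 y.
  rewrite (ger0_norm y0) in ye *; rewrite (min_idPl (ltW ye)) max_r; last by lra.
  by rewrite ger0_norm; lra.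
rewrite (ltr0_norm y0) in ye *; rewrite min_r ?max_l; try lra.
by rewrite ler0_norm; lra.
Qed.

Lemma cont_soft (e : R) f : continuous f -> continuous (fun x => soft e (f x)).
Proof.
move=> hf; apply: contB => //; apply: cont_max; first exact: contC.
by apply: cont_min => //; exact: contC.
Qed.

Lemma C0_0 : C0 (fun _ : R => 0 : R).
Proof. by apply: (@C0_support _ 0) => //; exact: contC. Qed.

Lemma C0_D f g : C0 f -> C0 g -> C0 (fun x => f x + g x).
Proof.
move=> hp hq; have := C0_lin 1 hp hq; congr C0.
by apply/funext => x; rewrite fctE /= mul1r.
Qed.

Lemma C0_Z (a : R) f : C0 f -> C0 (fun x => a * f x).
Proof.
by move=> /(C0_lin a)/(_ C0_0); congr C0; apply/funext => x; rewrite fctE /= addr0.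
Qed.

Lemma C0_bump (l r : R) : C0 (fun x => Num.max 0 (r - `|x - l|)).
Proof.
apply: (@C0_support _ (`|l| + r)).
  apply: cont_max; first exact: contC.
  by apply: contB; [exact: contC | apply: cont_abs; apply: contB; [exact: contI | exact: contC]].
move=> x hx; rewrite max_l // subr_le0.
by have := ler_normD (x - l) l; rewrite subrK; lra.
Qed.

Lemma bump_neq0 (l r x : R) : Num.max 0 (r - `|x - l|) != 0 -> `|x - l| < r.
Proof. by case: (leP 0 (r - `|x - l|)) => [h|]; rewrite ?eqxx // subr_eq0 => h'; lra. Qed.

(* With Phi_l l != 0 for the finitely many l of a subcover, the sum psi of the
   squares Phi_l ^ 2 is positive on K, and k = (k / psi) psi. *)
Lemma C0_ideal_cover (Q : (R -> R) -> Prop) (K : set R) k : Q (fun=> 0) ->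
  (forall f g, C0 f -> C0 g -> Q f -> Q g -> Q (fun x => f x + g x)) ->
  (forall f g, C0 f -> C0 g -> Q f -> Q (fun x => g x * f x)) ->
  compact K -> (forall l, K l -> exists f, [/\ C0 f, f l != 0 & Q f]) ->
  continuous k -> (forall x, k x != 0 -> K x) -> Q k.
Proof.
move=> Q0 QD QM cK hK ck ks.
have Kcl : closed K by apply: compact_closed => //; exact: norm_hausdorff.
have /choice[Phi hPhi] : forall l, exists f, K l -> [/\ C0 f, f l != 0 & Q f].
  by move=> l; have [/hK[f hf]|nl] := pselect (K l); [exists f | exists 0 => /nl].
move: (cK); rewrite compact_cover.
move=> /(_ R K (fun l => [set x | Phi l x != 0])) [|x Kx|D DK Dcov].
- by move=> l /hPhi[[cphi _ _] _ _]; exact: (open_comp (fun x _ => cphi x) (@open_neq _ 0)).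
- by exists x => //; have [] := hPhi x Kx.
pose psi x := \sum_(l <- D) Phi l x * Phi l x.
have [hpsi Qpsi] : C0 psi /\ Q psi.
  have : {in (D : seq R), forall l, C0 (Phi l) /\ Q (Phi l)}.
    by move=> l /DK; rewrite inE => /hPhi[].
  rewrite /psi; elim: (D : seq R) => [|l s IH] hs.
    have -> : (fun x => \sum_(l <- [::]) Phi l x * Phi l x) = (fun=> 0).
      by apply/funext => x; rewrite big_nil.
    by split=> //; exact: C0_0.
  have [|h1 h2] := IH; first by move=> l' l's; apply: hs; rewrite inE l's orbT.
  have [h3 h4] := hs l (mem_head _ _).
  have h5 := C0_mul h3 h3.
  have -> : (fun x => \sum_(l <- l :: s) Phi l x * Phi l x) =
    (fun x => Phi l x * Phi l x + \sum_(l <- s) Phi l x * Phi l x).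
    by apply/funext => x; rewrite big_cons.
  by split; [exact: C0_D | apply: QD => //; exact: QM].
have psi_neq0 x : K x -> psi x != 0.
  move=> Kx; have [l lD /= hlx] := Dcov x Kx.
  rewrite /psi (big_rem l) //= gt_eqF // ltr_wpDr ?sumr_ge0 //.
    by move=> i _; rewrite -expr2 sqr_ge0.
  by rewrite -expr2 lt_neqAle eq_sym sqrf_eq0 hlx sqr_ge0.
have k0 x : ~ K x -> k x = 0.
  by move=> nK; apply/eqP/negPn/negP => /ks.
pose kap x := k x / psi x.
have ckap : continuous kap.
  have [cpsi _ _] := hpsi.
  move=> x; have [px|px] := eqVneq (psi x) 0; last first.
    by apply: cvgM; [exact: ck | apply: cvgV => //; exact: cpsi].
  (* Where psi vanishes, x lies in the open complement of K, and [kap] is 0 there. *)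
  have nK : (~` K) x by move=> /psi_neq0; rewrite px eqxx.
  have nK' : nbhs x (~` K) by apply: open_nbhs_nbhs; split => //; exact: closed_openC.
  rewrite /continuous_at /kap px invr0 mulr0.
  apply: cvg_trans (@cvg_cst _ (0 : R) _ (nbhs x) _).
  apply: near_eq_cvg; near=> y; rewrite k0 ?mul0r //.
  by near: y; exact: nK'.
have hkap : C0 kap.
  have [M [_ hM]] := compact_bounded cK.
  apply: (@C0_support _ (M + 1)) => // x xM; rewrite /kap k0 ?mul0r // => Kx.
  have M1 : M < M + 1 by rewrite ltrDl.
  have hx : `|x| <= M + 1 by exact: hM M1 x Kx.
  by rewrite ltNge hx in xM.
have -> : k = (fun x => kap x * psi x); last exact: QM.
apply/funext => x; rewrite /kap; have [Kx|nK] := pselect (K x).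
  by rewrite mulfVK // psi_neq0.
by rewrite k0 // !mul0r.
Unshelve. all: by end_near.
Qed.

End RealContinuity.

(** * Spectral localization and the essential spectrum *)

Definition eigen {R : realType} {V : lmodType R} (P S : V -> V) (l : R) : Prop :=
  exists2 u, u != 0 & opgraph P S (u, l *: u).

Definition finmult {R : realType} {V : lmodType R} (P S : V -> V) (l : R) : Prop :=
  exists n (e : 'I_n -> V), forall u, opgraph P S (u, l *: u) ->
    exists a : 'I_n -> R, u = \sum_(i < n) a i *: e i.

Definition ess_set {R : realType} {V : lmodType R} (dot : V -> V -> R)
    (P S : V -> V) : set R :=
  ~` res_set dot P S `\` [set l | [/\ isolated (~` res_set dot P S) l,
    eigen P S l & finmult P S l]].

Section EssentialSpectrum.
Context {R : realType} {V : lmodType R} {dot : V -> V -> R}.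
Context (H : inner_product dot) (Hc : hcomplete dot).
Context {P S : V -> V} (HS : pos_contraction dot S) (HP : compatible dot P S).
Local Notation nrm := (nrm dot).
Local Notation fc := (fcalc dot S).
Local Notation opg := (opgraph P S).
Local Notation res := (res_set dot P S).
Local Notation cc := (cc dot).
Implicit Types (phi psi h : R -> R) (a e C l r t x mu d : R) (u v w f g : V).

Let Sl := pc_lin HS.
Let Ss := pc_sym HS.
Let S0 := pc_ge0 HS.
Let S1 := pc_le1 HS.

(** With t = (1 + l)^-1 and q(X) - q(t) = p(X) (X - t), the vector q(S) u - q(t) u is p(S) applied
    to the defect S u - t u. The three thirds of e pay for phi(L) - q(S), for this vector, and for
    q(t) - phi(l). *)
Lemma fc_almost_eigen phi l e : C0 phi -> 0 <= l -> 0 < e -> exists2 d : R, 0 < d &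
  forall u, nrm (S u - (1 + l)^-1 *: u) <= d * nrm u ->
    nrm (fc phi u - phi l *: u) <= e * nrm u.
Proof.
move=> hp l0 e0; have e30 : 0 < e / 3 by rewrite divr_gt0.
have [q [_ hq1 hq2]] := fcP H Hc HS hp e30.
pose t := (1 + l)^-1.
have : root (q - q.[t]%:P) t by apply/rootP; rewrite !hornerE subrr.
move=> /factor_theorem[p pE].
have [C C0 hC] := pop_norm Sl H Ss S0 S1 p.
have [d d0 dC] := small_mul e30 (ltW C0).
exists d => // u hu.
have h1 : pop S q u - q.[t] *: u = pop S p (S u - t *: u).
  have := congr1 (fun r : {poly R} => pop S r u) pE.
  by rewrite /= (popB (S := S)) popC (popM Sl) (popB (S := S)) (popXE Sl) popC.
have h2 : nrm (pop S q u - q.[t] *: u) <= e / 3 * nrm u.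
  rewrite h1; apply: le_trans (hC _) _; apply: le_trans (ler_wpM2l (ltW C0) hu) _.
  by rewrite mulrA (mulrC C) ler_wpM2r ?nrm_ge0.
have h3 : nrm (q.[t] *: u - phi l *: u) <= e / 3 * nrm u.
  by rewrite -scalerBl (nrmZ H) ler_wpM2r ?nrm_ge0 // distrC hq1.
have h4 := hq2 u.
have h5 := nrm_triB H (pop S q u) (fc phi u) (phi l *: u).
have h6 := nrm_triB H (q.[t] *: u) (pop S q u) (phi l *: u).
lra.
Qed.

Lemma fc_eigen phi l u : C0 phi -> 0 <= l -> opg (u, l *: u) -> fc phi u = phi l *: u.
Proof.
move=> hp l0 /(opg_S_eig HS l0) Su; apply: (nrmB_le0 H); apply/ler_addgt0Pr => e e0; rewrite add0r.
have [d d0 de] := small_mul e0 (nrm_ge0 dot u).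
have [b b0 hb] := fc_almost_eigen hp l0 d0.
apply: le_trans de; apply: hb; rewrite Su subrr (nrm0 H).
by rewrite mulr_ge0 ?nrm_ge0 // ltW.
Qed.

Lemma fcZ a phi f : C0 phi -> fc (fun x => a * phi x) f = a *: fc phi f.
Proof.
move=> hp; have c0 := @C0_0 R.
rewrite -[RHS]addr0 -(fc_eq0 H Hc HS f c0) // -(fc_comb H Hc HS) //.
by congr (fc _ _); apply/funext => x; rewrite fctE addr0.
Qed.

Lemma fcD phi psi f : C0 phi -> C0 psi ->
  fc (fun x => phi x + psi x) f = fc phi f + fc psi f.
Proof.
move=> hp hq; rewrite -[fc phi f]scale1r -(fc_comb H Hc HS) //.
by congr (fc _ _); apply/funext => x; rewrite fctE /= mul1r.
Qed.

(** The graph condition reads (1 + x)^-1 (psi + phi) = phi on [0, +oo[. *)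
Lemma opg_fc phi psi g : C0 phi -> C0 psi -> (forall x, 0 <= x -> psi x = x * phi x) ->
  opg (fc phi g, fc psi g).
Proof.
move=> hp hq h; split=> /=.
  apply: (fc_range H Hc HS) => // [|?|?]; first exact: cp_lin HP.
    exact: cp_PS HP _.
  exact: cp_nrm HP _.
rewrite -(fc_res1 H Hc HS _ C0_res1); last first.
  by move=> x x0; rewrite /res1 ger0_norm.
rewrite -fcD // -(fc_mul H Hc HS) //; last 2 first.
- exact: C0_res1.
- exact: C0_D.
apply: (fc_eq H Hc HS) => // [|x x0]; first by apply: C0_mul; [exact: C0_res1 | exact: C0_D].
rewrite /= h // /res1 ger0_norm //; field.
by rewrite gt_eqF // ltr_pwDl.
Qed.

Lemma fc_sqr_nrm phi g : C0 phi -> nrm (fc phi g) ^+ 2 = dot (fc (phi \* phi) g) g.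
Proof.
by move=> hp; rewrite (fc_mul H Hc HS) // (fc_sym H Hc HS hp) (nrm_sqr H).
Qed.

(** On the range of phi(L) the operator L - mu is bounded below by r and, because of the support of
    phi, above by r' < r; so the range is 0. *)
Lemma fc_vanish phi mu r r' g :
  (forall u f, opg (u, f) -> r * nrm u <= nrm (f - mu *: u)) ->
  0 <= r' -> r' < r -> C0 phi ->
  (forall x, 0 <= x -> phi x != 0 -> `|x - mu| <= r') -> fc phi g = 0.
Proof.
(* The support hypothesis concerns x >= 0; the even function p agrees with phi there and has compact
   support. *)
move=> hr r'0 rr hp hs; pose p x := phi `|x|.
have hp' : C0 p := C0_comp_abs hp.
have -> : fc phi g = fc p g.
  by apply: (fc_eq H Hc HS) => // x x0; rewrite /p ger0_norm.
have ps x : `|mu| + r' < `|x| -> p x = 0.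
  move=> hx; apply/eqP; apply: contraTT hx => /(hs _ (normr_ge0 x)) h.
  by rewrite -leNgt; have := ler_norm mu; move: h; rewrite ler_norml; lra.
have pc : continuous p by have [] := hp'.
pose psi x := `|x| * p x.
pose th x := psi x + - mu * p x.
(* As rho ^ 2 = (r' ^ 2 - (x - mu) ^ 2) p ^ 2, it follows that
   |(L - mu) p(L) g| <= r' |p(L) g|. *)
pose rho x := p x * Num.sqrt (r' ^+ 2 - (`|x| - mu) ^+ 2).
have cabs : continuous (fun x : R => `|x|) by apply: cont_abs; exact: contI.
have hpsi : C0 psi.
  apply: (@C0_support _ (`|mu| + r')); first exact: contM.
  by move=> x /ps h; rewrite /psi h mulr0.
have hth : C0 th by apply: C0_D => //; exact: C0_Z.
have hrho : C0 rho.
  apply: (@C0_support _ (`|mu| + r')); last by move=> x /ps h; rewrite /rho h mul0r.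
  apply: contM => //; apply: cont_sqrt; apply: contB; first exact: contC.
  by apply: contM; apply: contB => //; exact: contC.
have o : opg (fc p g, fc psi g).
  by apply: opg_fc => // x x0; rewrite /psi ger0_norm.
have h1 := hr _ _ o.
have e1 : fc psi g - mu *: fc p g = fc th g.
  by rewrite fcD // ?fcZ ?scaleNr //; exact: C0_Z.
rewrite e1 in h1.
have h2 : (r' * nrm (fc p g)) ^+ 2 = nrm (fc th g) ^+ 2 + nrm (fc rho g) ^+ 2.
  rewrite -{1}(ger0_norm r'0) -(nrmZ H) -fcZ // !fc_sqr_nrm //; last exact: C0_Z.
  rewrite -(dotDl H) -fcD; [|exact: C0_mul|exact: C0_mul].
  congr (dot (fc _ _) _); apply/funext => x /=.
  have [p0|p0] := eqVneq (p x) 0; first by rewrite /th /psi /rho p0; ring.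
  have hx : `| `|x| - mu| <= r' by apply: hs p0.
  have sq : 0 <= r' ^+ 2 - (`|x| - mu) ^+ 2.
    by rewrite subr_ge0 -[leLHS]real_normK ?num_real // ler_sqr ?nnegrE.
  rewrite /rho; transitivity (th x * th x + p x ^+ 2 * Num.sqrt (r' ^+ 2 - (`|x| - mu) ^+ 2) ^+ 2);
    last by ring.
  by rewrite sqr_sqrtr // /th /psi; ring.
have h3 : nrm (fc th g) <= r' * nrm (fc p g).
  rewrite -ler_sqr ?nnegrE ?mulr_ge0 ?nrm_ge0 // h2 lerDl; exact: sqr_ge0.
apply: (nrm_le0 H).
by have := nrm_ge0 dot (fc p g); nra.
Qed.

(** L - l is bounded below by r = (|C| + 1)^-1, so [fc_vanish] applies to the bump of radius r/2
    around l. *)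
Lemma res_fc_eq0 l : res l -> exists phi, [/\ C0 phi, phi l != 0 & forall g, fc phi g = 0].
Proof.
move=> [_ [C hC]]; have C1 : 0 < `|C| + 1 by rewrite ltr_wpDl.
pose r := (`|C| + 1)^-1; have r0 : 0 < r by rewrite invr_gt0.
have hp := C0_bump l (r / 2).
exists (fun x => Num.max 0 (r / 2 - `|x - l|)); split=> // [|g].
  by rewrite subrr normr0 subr0 max_r ?gt_eqF ?divr_ge0 ?divr_gt0 // ltW.
apply: (@fc_vanish _ l r (r / 2)) => // [u f uf|||x _ /bump_neq0/ltW //]; try lra.
rewrite ler_pdivrMl //; apply: le_trans (hC u f uf) _; rewrite ler_wpM2r ?nrm_ge0 //.
by apply: le_trans (ler_norm _) _; rewrite lerDl.
Qed.

(** The phi with phi(L) = 0 form an ideal, to which [C0_ideal_cover] applies. *)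
Lemma fc_support_res h (K : set R) g : compact K -> (forall l, K l -> res l) ->
  continuous h -> (forall x, h x != 0 -> K x) -> fc h g = 0.
Proof.
move=> cK hK ch hs; move: g.
apply: (@C0_ideal_cover _ (fun phi => forall g, fc phi g = 0) K) => //.
- move=> g; apply: (fc_eq0 H Hc HS) => //; exact: C0_0.
- by move=> phi psi hp hq p0 q0 g; rewrite fcD // p0 q0 addr0.
- move=> phi psi hp hq p0 g; rewrite (fc_mul H Hc HS g hq hp) p0.
  exact: (lin0 (fc_lin H Hc HS hq)).
- by move=> l /hK/res_fc_eq0.
Qed.

(** The function h(x) = (x - l) phi(x) vanishes on the spectrum, since the bump phi lives where l is
    the only possible spectral point. Hence (L - l) phi(L) = h(L) is 0. *)
Lemma fc_isolated l eps : 0 < eps -> (forall x, ~ res x -> `|x - l| < eps -> x = l) ->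
  exists phi, [/\ C0 phi, phi l != 0 & forall g, opg (fc phi g, l *: fc phi g)].
Proof.
move=> eps0 hl; pose c := eps / 2; have c0 : 0 < c by rewrite divr_gt0.
pose phi x := Num.max 0 (c - `|x - l|).
have hphi : C0 phi by exact: C0_bump.
have [cphi _ _] := hphi.
pose h x := (x - l) * phi x.
have ch : continuous h by apply: contM => //; apply: contB; [exact: contI | exact: contC].
have hs x : h x != 0 -> x != l /\ `|x - l| < c.
  by rewrite mulf_eq0 subr_eq0 negb_or => /andP[xl /bump_neq0].
have hh : C0 h.
  apply: (@C0_support _ (`|l| + c)) => // x hx; apply/eqP; apply: contraTT hx => /hs[_ xl].
  by rewrite -leNgt; have := ler_normD (x - l) l; rewrite subrK; lra.
have fh g : fc h g = 0.
  apply: (nrm_le0 H); apply/ler_addgt0Pr => e' e'0; rewrite add0r.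
  have [e e0 ee] := small_mul e'0 (nrm_ge0 dot g); apply: le_trans ee.
  (* Up to e, h is replaced by a function with support in a compact part of the resolvent set, where
     [fc_support_res] applies. *)
  pose s x := soft e (h x).
  have hs' : C0 s.
    apply: (@C0_le _ h s 1) => // [|x]; first exact: cont_soft.
    by rewrite mul1r; apply: soft_le; exact: ltW.
  have s0 : fc s g = 0.
    apply: (@fc_support_res s (`[l - c, l + c]%classic `&` [set x | e <= `|h x|])).
    - apply: compact_closedI; first exact: segment_compact.
      apply: (@preimage_closed _ _ (fun x => `|h x|) [set y | e <= y]) => [x _|].
        exact: cont_abs.
      exact: closed_ge.
    - move=> x [_ /= ehx]; apply: contrapT => nx.
      have [|xl xc] := hs x; first by rewrite -normr_gt0 (lt_le_trans e0).
      by move/eqP: xl; apply; apply: hl => //; rewrite /c in xc; lra.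
    - by apply: cont_soft.
    move=> x sx; have ehx := soft_neq0 (ltW e0) sx.
    have [|_ xc] := hs x; first by rewrite -normr_gt0 (lt_trans e0).
    split; last exact: ltW.
    by rewrite /= in_itv /=; move: xc; rewrite ltr_norml; lra.
  have -> : fc h g = fc (fun x => h x + -1 * s x) g.
    by rewrite fcD // ?fcZ ?s0 ?scaler0 ?addr0 //; exact: C0_Z.
  apply: (fc_le H Hc HS); first by apply: C0_D => //; exact: C0_Z.
  by move=> x _; rewrite mulN1r; apply: soft_dist; exact: ltW.
exists phi; split=> [//||g].
  by rewrite /phi subrr normr0 subr0 max_r ?gt_eqF // ltW.
have -> : l *: fc phi g = fc (fun x => h x + l * phi x) g.
  by rewrite fcD ?fh ?add0r ?fcZ //; exact: C0_Z.
apply: opg_fc => // [|x x0]; last by rewrite /h; ring.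
by apply: C0_D => //; exact: C0_Z.
Qed.

End EssentialSpectrum.

Section EssentialSpectrumCompact.
Context {R : realType} {V : lmodType R} {dot : V -> V -> R}.
Context (H : inner_product dot) (Hc : hcomplete dot) (wsc : weak_seq_compact dot).
Context {P S : V -> V} (HS : pos_contraction dot S) (HP : compatible dot P S).
Local Notation nrm := (nrm dot).
Local Notation fc := (fcalc dot S).
Local Notation opg := (opgraph P S).
Local Notation res := (res_set dot P S).
Local Notation ess := (ess_set dot P S).
Local Notation cc := (cc dot).
Local Notation wnull := (wnull dot).
Implicit Types (phi psi h : R -> R) (a e C l r t x mu d : R) (u v w f g z : V).

Let Sl := pc_lin HS.
Let Pl := cp_lin HP.

(** At a point of the resolvent set phi(L) = 0 for a small bump phi; at an isolated eigenvalue of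
    finite multiplicity, [fc_isolated] puts the range of phi(L) into the eigenspace. *)
Lemma ess_cc l : ~ ess l -> exists phi, [/\ C0 phi, phi l != 0 & cc (fc phi)].
Proof.
move=> nl; have [rl|rl] := pselect (res l).
  have [phi [hp pl h0]] := res_fc_eq0 H Hc HS HP rl.
  exists phi; split=> // u _; under eq_fun do rewrite h0 (nrm0 H); exact: cvg_cst.
have : [/\ isolated (~` res) l, eigen P S l & finmult P S l].
  by apply: contrapT => h; apply: nl; split.
move=> [[_ [W Wl WA]] _ [n [e he]]].
have [d /= d0 dW] := (nbhs_ballP _ _).1 Wl.
have iso x : ~ res x -> `|x - l| < d -> x = l.
  move=> nx xl; have : (W `&` ~` res) x by split=> //; apply: dW; rewrite /= /ball /= distrC.
  by rewrite WA.
have [phi [hp pl ho]] := fc_isolated H Hc HS HP d0 iso.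
exists phi; split=> //; have [C C0 hC] := fc_bounded H Hc HS hp.
by apply: (finite_rank_cc H (fc_sym H Hc HS hp) hC) => f; exact: he.
Qed.

Section CompactCutoff.
Variables (phi : R -> R) (hp : C0 phi) (hcc : cc (fc phi)).

(** For approximate eigenvectors u_n, phi(L) u_n - phi(l) u_n tends to 0, and phi(L) u_n converges
    along a subsequence by compactness; as phi(l) != 0, so does u_n. The graph of L is closed. *)
Lemma cutoff_eigen l : ~ res l -> phi l != 0 -> exists u, nrm u = 1 /\ opg (u, l *: u).
Proof.
move=> nl pl; have l0 : 0 <= l.
  by rewrite leNgt; apply/negP => l0; exact/nl/(neg_res H Hc HS HP).
have [C C0 hC] := fc_bounded H Hc HS hp.
have /choice[uf huf] : forall n : nat, exists uf : V * V, [/\ opg uf, nrm uf.1 = 1 &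
    nrm (uf.2 - l *: uf.1) < n.+1%:R^-1].
  move=> n; have n0 : 0 < n.+1%:R^-1 :> R by rewrite invr_gt0.
  by have [u [f [h1 h2 h3]]] := spectrum_approx H Hc HS HP nl n0; exists (u, f).
pose un n := (uf n).1; pose fn n := (uf n).2.
have rn : nrm (fn n - l *: un n) @[n --> \oo] --> (0 : R).
  apply: cvg0_le (@cvg_invSn R) => n; rewrite ger0_norm ?nrm_ge0 //.
  by have [_ _ h] := huf n; exact: ltW.
have un1 n : nrm (un n) = 1 by have [] := huf n.
have Sn n : nrm (S (un n) - (1 + l)^-1 *: un n) <= nrm (fn n - l *: un n).
  have [ho _ _] := huf n; have e1 := opg_S HS l (ho : opg (un n, fn n)).
  (* This is [opg_S] divided by -(1 + l); the defect for S is thus at most the defect for L. *)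
  have -> : S (un n) - (1 + l)^-1 *: un n = - (1 + l)^-1 *: S (fn n - l *: un n).
    rewrite -e1 scalerBr scalerA mulNr mulVf ?gt_eqF ?ltr_pwDl //.
    by rewrite scaleN1r opprK scaleNr addrC.
  rewrite (nrmZ H) normrN; apply: le_trans (_ : 1 * nrm (S (fn n - l *: un n)) <= _).
    rewrite ler_wpM2r ?nrm_ge0 // ger0_norm ?invr_ge0 ?addr_ge0 //.
    by rewrite invf_le1 ?lerDl ?ltr_pwDl.
  by rewrite mul1r; exact: (pc_nrm H HS).
have an : nrm (fc phi (un n) - phi l *: un n) @[n --> \oo] --> (0 : R).
  apply/cvg0P => e e0; have e20 : 0 < e / 2 by rewrite divr_gt0.
  have [d d0 hd] := fc_almost_eigen H Hc HS hp l0 e20.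
  have [N hN] := (cvg0P _).1 rn d d0; exists N => n /hN.
  rewrite !ger0_norm ?nrm_ge0 // => h1.
  have := hd (un n); rewrite un1 !mulr1 => h2.
  have : nrm (fc phi (un n) - phi l *: un n) <= e / 2.
    by apply: h2; apply: le_trans (Sn n) (ltW h1).
  lra.
have un1' n : nrm (un n) <= 1 by rewrite un1.
have [k [hk [z hz]]] := wsc un1'.
have hk' := homo_geid hk.
pose v := (phi l)^-1 *: fc phi z.
have uv : hcvg dot (un \o k) v.
  apply: (@cvg0_le _ _ (fun n => `|(phi l)^-1| *
    (nrm (fc phi (un (k n)) - phi l *: un (k n)) + nrm (fc phi (un (k n) - z))))).
    move=> n; rewrite ger0_norm ?nrm_ge0 //=.
    have -> : un (k n) - v = (phi l)^-1 *: (phi l *: un (k n) - fc phi z).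
      by rewrite scalerBr scalerA mulVf // scale1r.
    rewrite (nrmZ H) ler_wpM2l // (linB (fc_lin H Hc HS hp)).
    rewrite (nrmB H (fc phi (un (k n))) (phi l *: _)).
    exact: nrm_triB.
  apply: cvg0M; apply: cvg0D; last exact: hcc hz.
  exact: (cvg0_sub hk' an).
have fv : hcvg dot (fn \o k) (l *: v).
  apply: (@cvg0_le _ _ (fun n => nrm (fn (k n) - l *: un (k n)) + `|l| * nrm (un (k n) - v))).
    move=> n; rewrite ger0_norm ?nrm_ge0 //= -(nrmZ H) scalerBr.
    exact: nrm_triB.
  by apply: cvg0D; [exact: (cvg0_sub hk' rn) | exact: cvg0M].
exists v; split; last first.
  by apply: (hcvg_opg H HS HP uv fv) => n; have [] := huf (k n).
have := hcvg_nrm H uv; have -> : (fun n => nrm ((un \o k) n)) = (fun=> 1).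
  by apply/funext => n /=; rewrite un1.
by move=> h; apply: (cvg_unique _ h); [exact: norm_hausdorff | exact: cvg_cst].
Qed.

(** An infinite-dimensional eigenspace would contain an orthonormal sequence, on which phi(L) is
    multiplication by phi(l) != 0, against [orthonormal_not_cc]. *)
Lemma cutoff_finmult l : ~ res l -> phi l != 0 -> finmult P S l.
Proof.
move=> nl pl; have l0 : 0 <= l.
  by rewrite leNgt; apply/negP => l0; exact/nl/(neg_res H Hc HS HP).
apply: contrapT => nf; pose K : set V := [set u | opg (u, l *: u)].
have KP a u v : K u -> K v -> K (a *: u + v).
  move=> Ku Kv; have := opg_comb HS HP a Ku Kv; rewrite /K /=.
  by rewrite scalerDr !scalerA (mulrC l).
have K0 : K 0 by split; rewrite /= scaler0 ?(lin0 Pl) // addr0 (lin0 Sl).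
(* Any finite list in the eigenspace admits a unit eigenvector orthogonal to it; iterating a choice
   of such vectors gives the sequence [zn]. *)
have ext (t : seq V) : exists z, {in t, forall v, K v} ->
    [/\ K z, dot z z = 1 & {in t, forall v, dot z v = 0}].
  have [tK|tK] := pselect ({in t, forall v, K v}); last by exists 0.
  have [t' [tK' tt' te]] := orthonormalize H KP K0 tK.
  have [x [Kx nx]] : exists x : V, K x /\ ~ expands (dot := dot) t' x.
    apply: contrapT => hn; apply: nf; exists (size t'), (fun i => tnth (in_tuple t') i).
    move=> u Ku; exists (fun i => dot u (tnth (in_tuple t') i)).
    rewrite -(big_tnth _ _ t' xpredT (fun v => dot u v *: v)).
    by apply: contrapT => hu; apply: hn; exists u.
  have [z [Kz z1 zt _]] := orthogonal_extension H KP K0 tK' Kx tt' nx.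
  exists z => _; split=> // v /te ->; rewrite (dotC H) (dot_suml H) big_seq big1 // => w wt.
  by rewrite (dotZl H) (dotC H w) zt // mulr0.
have [F hF] := choice ext.
pose T n := iter n (fun s => F s :: s) [::]; pose zn n := F (T n).
have TK n : {in T n, forall v, K v}.
  elim: n => [|n IH] v //=; rewrite inE => /orP[/eqP ->|]; last exact: IH.
  by have [] := hF _ IH.
have Tz i n : (i < n)%N -> zn i \in T n.
  elim: n => // n IH; rewrite ltnS leq_eqVlt => /orP[/eqP ->|/IH] /=; rewrite inE ?eqxx //.
  by move=> ->; rewrite orbT.
have on i j : dot (zn i) (zn j) = (i == j)%:R.
  have [ij|ij|->] := ltngtP i j.
  - by have [_ _ h] := hF _ (TK j); rewrite (dotC H) h // Tz.
  - by have [_ _ h] := hF _ (TK i); rewrite h // Tz.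
  - by have [] := hF _ (TK j).
apply: (@orthonormal_not_cc _ _ _ H wsc (fc phi) zn (fun=> phi l) `|phi l|) => //.
- by rewrite normr_gt0.
- exact: (fc_lin H Hc HS hp).
- move=> n; have [Kz _ _] := hF _ (TK n); exact: (fc_eigen H Hc HS hp l0 Kz).
Qed.

(** Otherwise infinitely many spectral points lie in the region near l where |phi| >= |phi(l)| / 2.
    All of them are eigenvalues by [cutoff_eigen], with orthogonal eigenvectors by symmetry of L. *)
Lemma cutoff_isolated l : ~ res l -> phi l != 0 -> isolated (~` res) l.
Proof.
move=> nl pl; have [cphi _ _] := hp.
have [d0 d00 hd0] : exists2 d : R, 0 < d &
    forall x, `|x - l| < d -> `|phi l| / 2 <= `|phi x|.
  have p2 : 0 < `|phi l| / 2 by rewrite divr_gt0 // normr_gt0.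
  have /cvgr_dist_lt/(_ _ p2)/nbhs_ballP[d /= d0 hd] := cphi l.
  exists d => // x xl; have := hd x; rewrite /ball /= distrC => /(_ xl) h.
  have := ler_normD (phi l - phi x) (phi x); rewrite subrK.
  move: h => /ltW h h'; lra.
apply: contrapT => ni.
have ext d : exists x, 0 < d -> [/\ ~ res x, x != l, `|x - l| < d & `|x - l| < d0].
  have [dp|dp] := ltP 0 d; last by exists 0 => h; lra.
  apply: contrapT => hn; apply: ni; split; first by rewrite inE.
  exists (ball l (Num.min d d0)); first by apply: nbhsx_ballx; rewrite lt_min dp.
  apply/seteqP; split=> [x [xb nx]|x ->]; last first.
    by split=> //; apply: ballxx; rewrite lt_min dp.
  apply: contrapT => xl; apply: hn; exists x => _.
  move: xb; rewrite /ball /= distrC lt_min => /andP[h1 h2].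
  by split=> //; apply/eqP.
have [F hF] := choice ext.
(* Each point is chosen strictly closer to l than its predecessor, which makes the points
   distinct. *)
pose x n := iter n (fun y => F `|y - l|) (F 1).
have xP n : [/\ ~ res (x n), x n != l & `|x n - l| < d0].
  elim: n => [|n [_ xl _]] /=; first by have [] := hF 1 ltr01.
  have : 0 < `|x n - l| by rewrite normr_gt0 subr_eq0.
  by move=> /hF[].
have xdec i j : (i < j)%N -> `|x j - l| < `|x i - l|.
  elim: j => // j IH; rewrite ltnS leq_eqVlt.
  have xj : `|x j.+1 - l| < `|x j - l|.
    have [_ xl _] := xP j; have : 0 < `|x j - l| by rewrite normr_gt0 subr_eq0.
    by move=> /hF[].
  by move=> /orP[/eqP -> //|/IH]; exact: lt_trans.
have xinj i j : i != j -> x i - x j != 0.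
  rewrite subr_eq0 neq_ltn => /orP[] /xdec; apply: contraTneq => ->; rewrite ltxx //.
have hx n : `|phi l| / 2 <= `|phi (x n)| by have [_ _ /hd0] := xP n.
have p2 : 0 < `|phi l| / 2 by rewrite divr_gt0 // normr_gt0.
have [zn hz] : {zn : nat -> V & forall n, nrm (zn n) = 1 /\ opg (zn n, x n *: zn n)}.
  apply: (@choice _ _ (fun n z => nrm z = 1 /\ opg (z, x n *: z))) => n.
  apply: cutoff_eigen; first by have [] := xP n.
  by rewrite -normr_gt0; apply: lt_le_trans (hx n).
apply: (@orthonormal_not_cc _ _ _ H wsc (fc phi) zn (phi \o x) (`|phi l| / 2)) => //.
- exact: (fc_lin H Hc HS hp).
- move=> i j; have [->|ij] := eqVneq i j.
    by rewrite -(nrm_sqr H) (hz j).1 expr1n.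
  have := opg_sym H HS (hz i).2 (hz j).2; rewrite (dotZl H) (dotZr H) => /eqP.
  by rewrite -subr_eq0 -mulrBl mulf_eq0 (negPf (xinj _ _ ij)) => /eqP.
- move=> n; apply: (fc_eigen H Hc HS) => //; last exact: (hz n).2.
  rewrite leNgt; apply/negP => x0; have [nx _ _] := xP n.
  exact/nx/(neg_res H Hc HS HP).
Qed.

End CompactCutoff.

Lemma ess_setP l : ess l <-> forall phi, C0 phi -> cc (fc phi) -> phi l = 0.
Proof.
split=> [[nl ne] phi hp hcc|h].
  apply/eqP; apply/negPn/negP => pl; apply: ne; split.
  - exact: (cutoff_isolated hp hcc).
  - have [u [u1 ou]] := cutoff_eigen hp hcc nl pl; exists u => //.
    by apply/eqP => u0; move: u1; rewrite u0 (nrm0 H) => /esym/eqP; rewrite oner_eq0.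
  - exact: (cutoff_finmult hp hcc).
apply: contrapT => /ess_cc[phi [hp pl hcc]].
by rewrite (h phi hp hcc) eqxx in pl.
Qed.

Lemma ess_ge0 l : ess l -> 0 <= l.
Proof.
by move=> [nl _]; rewrite leNgt; apply/negP => l0; exact/nl/(neg_res H Hc HS HP).
Qed.

Lemma cc_fc_mul phi psi : C0 phi -> C0 psi -> cc (fc phi) -> cc (fc (psi \* phi)).
Proof.
move=> hp hq hcc; have [C C0 hC] := fc_bounded H Hc HS hq.
apply: (@cc_ext _ _ dot (fc psi \o fc phi)); last exact: (cc_compl hC hcc).
by move=> f; rewrite (fc_mul H Hc HS).
Qed.

(** [C0_ideal_cover] for the ideal of those phi for which phi(L) is compact. *)
Lemma cc_cover a k : continuous k -> (forall x, k x != 0 -> - a <= x <= a) ->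
  (forall l, - a <= l <= a -> ~ ess l) -> cc (fc k).
Proof.
move=> ck ks hl.
apply: (@C0_ideal_cover _ (fun phi => cc (fc phi)) `[- a, a]%classic) => //.
- by move=> u _; under eq_fun do rewrite (fc_eq0 H Hc HS _ (@C0_0 R)) // (nrm0 H); exact: cvg_cst.
- move=> f g hf hg cf cg; apply: cc_ext (cc_comb H 1 cf cg) => v.
  by rewrite scale1r (fcD H Hc HS).
- by move=> f g hf hg cf; exact: cc_fc_mul.
- exact: segment_compact.
by move=> l; rewrite /= in_itv /= => /hl/ess_cc.
Qed.

Lemma wnull_rayleigh a a0 (u : nat -> V) : (forall l, ess l -> a <= l) -> 0 <= a0 -> a0 < a ->
  wnull u -> (forall n, nrm (u n) = 1) ->
  (forall n, (1 + a0)^-1 <= dot (S (u n)) (u n)) -> False.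
Proof.
(* b < a makes k(L) compact, and b > a0 leaves a gap between (1 + a0)^-1 and the bound (1 + b)^-1 of
   the remainder q(L). *)
move=> ha a00 a0a hu u1 hS; pose b := (a0 + a) / 2.
have b0 : 0 < b by rewrite /b; lra.
have ba : b < a by rewrite /b; lra.
have a0b : a0 < b by rewrite /b; lra.
have b1 : 0 < 1 + b by lra.
pose k x := Num.max (res1 x - (1 + b)^-1) 0.
have ks x : k x != 0 -> - b <= x <= b.
  move=> kx; have : 0 < res1 x - (1 + b)^-1.
    by rewrite ltNge; apply: contra kx => h; rewrite /k max_r.
  have px : 0 < 1 + `|x| by rewrite ltr_pwDl.
  rewrite subr_gt0 /res1 ltf_pV2 ?posrE // -ler_norml.
  by move=> h; apply: ltW; lra.
have ck : continuous k.
  apply: cont_max; last exact: contC.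
  by apply: contB; [exact: continuous_res1 | exact: contC].
have hk : C0 k.
  apply: (@C0_support _ b) => // x xb; apply/eqP; apply: contraTT xb => /ks.
  by rewrite -ler_norml leNgt.
have cck : cc (fc k).
  apply: (@cc_cover b) => // l /andP[_ lb] /ha; lra.
pose q x := res1 x + -1 * k x.
have hq : C0 q by apply: C0_D; [exact: C0_res1 | exact: C0_Z].
have SE f : S f = fc q f + fc k f.
  rewrite -(fc_res1 H Hc HS _ C0_res1); last by move=> x x0; rewrite /res1 ger0_norm.
  rewrite -(fcD H Hc HS) //; congr (fc _ _); apply/funext => x.
  by rewrite /q mulN1r subrK.
have qb x : 0 <= x -> `|q x| <= (1 + b)^-1.
  move=> x0; have r0 := res1_gt0 x; have i0 : 0 < (1 + b)^-1 by rewrite invr_gt0.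
  rewrite /q /k mulN1r; have [h|h] := leP (res1 x) (1 + b)^-1.
    by rewrite max_r ?subr_le0 // subr0 (ger0_norm (ltW r0)).
  by rewrite max_l ?subr_ge0 ?(ltW h) // opprB addrC subrK (ger0_norm (ltW i0)).
have gap : 0 < (1 + a0)^-1 - (1 + b)^-1.
  by rewrite subr_gt0 ltf_pV2 ?posrE; lra.
suff : (1 + a0)^-1 - (1 + b)^-1 <= 0 by rewrite leNgt gap.
apply: le_cvg0 (cck _ hu) => n.
have h1 := dot_CS H (fc q (u n)) (u n); have h2 := dot_CS H (fc k (u n)) (u n).
have h3 := fc_le H Hc HS (u n) hq qb.
have := hS n; rewrite SE (dotDl H).
rewrite u1 !mulr1 in h1 h2 h3.
by have := ler_norm (dot (fc q (u n)) (u n)); have := ler_norm (dot (fc k (u n)) (u n)); lra.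
Qed.

End EssentialSpectrumCompact.

(** * Functional calculi of two resolvents with compact difference *)

Section CompactDifference.
Context {R : realType} {V : lmodType R} {dot : V -> V -> R}.
Context (H : inner_product dot) (Hc : hcomplete dot).
Context {S S' : V -> V} (HS : pos_contraction dot S) (HS' : pos_contraction dot S').
Context (hd : cc dot (fun f => S f - S' f)).
Local Notation nrm := (nrm dot).

(** q(S) S - q(S') S' = (q(S) - q(S')) S + q(S') (S - S'), where S preserves weakly null
    sequences. *)
Lemma cc_pop_diff (q : {poly R}) : cc dot (fun f => pop S q f - pop S' q f).
Proof.
elim/poly_ind: q => [|q c IH] u hu.
  have z0 n : nrm (pop S 0 (u n) - pop S' 0 (u n)) = 0.
    by rewrite /pop size_poly0 !big_ord0 subrr (nrm0 H).
  by under eq_fun do rewrite z0; exact: cvg_cst.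
have [Sl Ss S0 S1] := HS; have [Sl' Ss' S0' S1'] := HS'.
have [C C0 hC] := pop_norm Sl' H Ss' S0' S1' q.
have huS : wnull dot (S \o u).
  by apply: (wnull_op (C := 1) Ss) hu => f; rewrite mul1r; exact: (pc_nrm H HS).
apply: (@cvg0_le _ _ (fun n => nrm (pop S q (S (u n)) - pop S' q (S (u n))) +
  C * nrm (S (u n) - S' (u n)))).
  move=> n; rewrite ger0_norm ?nrm_ge0 //.
  have -> : pop S (q * 'X + c%:P) (u n) - pop S' (q * 'X + c%:P) (u n) =
     (pop S q (S (u n)) - pop S' q (S (u n))) + pop S' q (S (u n) - S' (u n)).
    rewrite !popD (popM Sl) (popM Sl') (popXE Sl) (popXE Sl') !popC.
    by rewrite (linB (pop_lin Sl' _)) addrA subrK opprD addrACA subrr addr0.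
  by apply: le_trans (nrmD H _ _) _; rewrite lerD2l.
by apply: cvg0D; [exact: (IH _ huS) | exact: cvg0M (hd hu)].
Qed.

Lemma cc_fcalc_diff phi : C0 phi ->
  cc dot (fun f => fcalc dot S phi f - fcalc dot S' phi f).
Proof.
move=> hp; apply: (cc_lim H) => e e0.
have e20 : 0 < e / 2 by rewrite divr_gt0.
have e40 : 0 < e / 2 / 2 by rewrite divr_gt0.
have [Sl Ss S0 S1] := HS; have [Sl' Ss' S0' S1'] := HS'.
have [q [_ hq1 hq2]] := fcP H Hc HS hp e40.
have [q' [_ hq1' hq2']] := fcP H Hc HS' hp e40.
(* The approximants q for S and q' for S' may differ; both are close to phi on [0, +oo[, so they are
   close to each other and q also serves for S'. *)
have qq f : nrm (pop S' q f - pop S' q' f) <= e / 2 * nrm f.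
  rewrite -(popB (S := S')); apply: (pop_le_inv1 Sl' H Ss' S0' S1') => x x0.
  by have := hq1 x x0; have := hq1' x x0; rewrite !hornerE !ler_norml; lra.
exists (fun f => pop S q f - pop S' q f); split; first exact: cc_pop_diff.
move=> f.
have -> : fcalc dot S phi f - fcalc dot S' phi f - (pop S q f - pop S' q f) =
    (fcalc dot S phi f - pop S q f) - (fcalc dot S' phi f - pop S' q f).
  rewrite !opprB (addrC (pop S' q f) (- pop S q f)) addrACA.
  by rewrite (addrC (- fcalc dot S' phi f)).
have h1 := hq2 f; have h2 := hq2' f; have h3 := qq f.
have h4 := nrm_triB H (pop S' q' f) (fcalc dot S' phi f) (pop S' q f).
rewrite (nrmB H (pop S' q' f)) in h4.
have h5 := nrmBD H (fcalc dot S phi f - pop S q f) (fcalc dot S' phi f - pop S' q f).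
have := nrm_ge0 dot f; lra.
Qed.

End CompactDifference.

(** * Weighted spaces of square summable functions *)

Section RealSums.
Context {R : realType} {T : choiceType}.
Implicit Types (f g : T -> R) (F : {fset T}) (a C e : R).

(** Summability in real terms; by [asum_esum] it means that the sum of |f| in the extended reals is
    finite. *)
Definition asum f : Prop := exists C : R, forall F, \sum_(t <- F) `|f t| <= C.

Lemma esum_le_fsetP f (C : R) : (forall t, 0 <= f t) ->
  ((\esum_(t in setT) (f t)%:E)%E <= C%:E)%E <-> (forall F, \sum_(t <- F) f t <= C).
Proof.
move=> f0; split=> [h F|h].
  rewrite -lee_fin; apply: le_trans h; apply: esum_ge.
  exists [set` F]; first by split=> //; exact: finite_fset.
  by rewrite fsbig_finite ?finite_fset //= set_fsetK sumEFin.
apply: ge_ereal_sup => _ [A [finA _] <-].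
by rewrite fsbig_finite //= sumEFin lee_fin; exact: h.
Qed.

Lemma esum_lty_fsetP f : (forall t, 0 <= f t) ->
  ((\esum_(t in setT) (f t)%:E)%E < +oo)%E <-> (exists C : R, forall F, \sum_(t <- F) f t <= C).
Proof.
move=> f0; split=> [h|[C /(esum_le_fsetP C f0) h]]; last exact: le_lt_trans h (ltry _).
exists (fine (\esum_(t in setT) (f t)%:E)%E); apply/esum_le_fsetP => //.
rewrite fineK // ge0_fin_numE // esum_ge0 // => t _; rewrite lee_fin //.
Qed.

Lemma asum_esum f : asum f <-> (\esum_(t in setT) `|f t|%:E < +oo)%E.
Proof. by split=> /(esum_lty_fsetP (fun t => normr_ge0 (f t))). Qed.

Lemma asum_le f g : (forall t, `|f t| <= g t) -> asum g -> asum f.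
Proof.
move=> fg [C hC]; exists C => F; apply: le_trans (hC F); apply: ler_sum => t _.
exact: le_trans (fg t) (ler_norm _).
Qed.

Lemma asum_le' f g : (forall t, `|f t| <= `|g t|) -> asum g -> asum f.
Proof.
move=> fg [C hC]; exists C => F; apply: le_trans (hC F); apply: ler_sum => t _.
exact: fg.
Qed.

Lemma le_sum_fsubset f (F G : {fset T}) : (forall t, 0 <= f t) -> (F `<=` G)%fset ->
  \sum_(t <- F) f t <= \sum_(t <- G) f t.
Proof.
move=> f0 FG; pose h t := if t \in F then f t else 0.
have -> : \sum_(t <- F) f t = \sum_(t <- F) h t.
  by apply: eq_big_seq => t tF; rewrite /h tF.
rewrite (big_fset_incl _ FG) => [|t _ tF]; last by rewrite /h (negPf tF).
by apply: ler_sum => t _; rewrite /h; case: ifP.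
Qed.

Lemma asum_lin a f g : asum f -> asum g -> asum (fun t => a * f t + g t).
Proof.
move=> [C hC] [D hD]; exists (`|a| * C + D) => F.
apply: le_trans (_ : `|a| * \sum_(t <- F) `|f t| + \sum_(t <- F) `|g t| <= _).
  rewrite mulr_sumr -big_split; apply: ler_sum => t _.
  by apply: le_trans (ler_normD _ _) _; rewrite normrM.
by apply: lerD; rewrite ?ler_wpM2l.
Qed.

Let nsum f : R := fine (\esum_(t in setT) (f t)%:E)%E.

Let nsumE f : (forall t, 0 <= f t) -> asum f ->
  (nsum f)%:E = (\esum_(t in setT) (f t)%:E)%E.
Proof.
move=> f0 /asum_esum h; rewrite fineK // ge0_fin_numE; last first.
  by apply: esum_ge0 => t _; rewrite lee_fin.
by under eq_esum do rewrite -(ger0_norm (f0 _)).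
Qed.

Let nsum_leP f C : (forall t, 0 <= f t) -> asum f ->
  nsum f <= C <-> (forall F, \sum_(t <- F) f t <= C).
Proof. by move=> f0 fa; rewrite -lee_fin nsumE //; exact: esum_le_fsetP. Qed.

Lemma rsumB f g : (forall t, 0 <= f t) -> (forall t, 0 <= g t) -> asum f -> asum g ->
  rsum (fun t => f t - g t) = nsum f - nsum g.
Proof.
move=> f0 g0 fa ga; rewrite /rsum.
have := @esumB R T setT (EFin \o f) (EFin \o g).
have -> : ((EFin \o f) \- (EFin \o g))%E = EFin \o (fun t => f t - g t) by [].
move=> ->; try by move=> t _; rewrite lee_fin.
- by rewrite /= -!nsumE.
- by move/asum_esum: fa.
- by move/asum_esum: ga.
Qed.

Lemma rsum_ge0E f : (forall t, 0 <= f t) -> asum f ->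
  (rsum f)%:E = (\esum_(t in setT) (f t)%:E)%E.
Proof.
move=> f0 fa; rewrite -nsumE //; congr EFin.
have a0 : asum (fun _ : T => 0 : R).
  by exists 0 => F; rewrite big1 // => t _; rewrite normr0.
transitivity (rsum (fun t => f t - (fun=> 0) t)).
  by congr rsum; apply/funext => t; rewrite subr0.
rewrite rsumB // [nsum (fun=> 0)](_ : _ = 0) ?subr0 //.
by rewrite /nsum esum1.
Qed.

Lemma rsum_leP f C : (forall t, 0 <= f t) -> asum f ->
  rsum f <= C <-> (forall F, \sum_(t <- F) f t <= C).
Proof. by move=> f0 fa; rewrite -lee_fin rsum_ge0E //; exact: esum_le_fsetP. Qed.

(** For the lower bound, finite sums of f over F and of g over G are compared with the sum over the
    union of F and G, and the two suprema are then taken one after the other. *)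
Let nsum_lin a f g : 0 <= a -> (forall t, 0 <= f t) -> (forall t, 0 <= g t) ->
  asum f -> asum g -> nsum (fun t => a * f t + g t) = a * nsum f + nsum g.
Proof.
move=> a0 f0 g0 fa ga; apply/eqP; rewrite eq_le.
have h0 t : 0 <= a * f t + g t by rewrite addr_ge0 ?mulr_ge0.
have ha := asum_lin a fa ga.
have nle h : (forall t, 0 <= h t) -> asum h -> forall F, \sum_(t <- F) h t <= nsum h.
  by move=> h0' ha'; apply/(nsum_leP _ h0' ha').
apply/andP; split.
  apply/nsum_leP => // F; rewrite big_split -mulr_sumr; apply: lerD; last exact: nle.
  by apply: ler_wpM2l => //; exact: nle.
have key (F G : {fset T}) : a * \sum_(t <- F) f t + \sum_(t <- G) g t <= nsum (fun t => a * f t + g t).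
  have := nle _ h0 ha (F `|` G)%fset; apply: le_trans; rewrite big_split -mulr_sumr; apply: lerD.
    apply: ler_wpM2l => //; exact: (le_sum_fsubset f0 (fsubsetUl F G)).
  exact: (le_sum_fsubset g0 (fsubsetUr F G)).
have k1 F : nsum g <= nsum (fun t => a * f t + g t) - a * \sum_(t <- F) f t.
  by apply/nsum_leP => // G; rewrite lerBrDl.
have [a00|an] := eqVneq a 0.
  by have := k1 fset0; rewrite big_seq_fset0 mulr0 subr0 {2}a00 mul0r add0r.
have ap : 0 < a by rewrite lt_neqAle eq_sym an.
rewrite -lerBrDr mulrC -ler_pdivlMr //; apply/nsum_leP => // F.
rewrite ler_pdivlMr // lerBrDr mulrC -lerBrDl; exact: k1.
Qed.

Let pos f t := Num.max (f t) 0.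

Let pos_ge0 f t : 0 <= pos f t.
Proof. by rewrite le_max lexx orbT. Qed.

Let pos_neg f t : f t = pos f t - pos (fun t => - f t) t.
Proof.
rewrite /pos; have [h|h] := leP (f t) 0.
  by rewrite max_l ?oppr_ge0 // sub0r opprK.
by rewrite max_r ?subr0 // oppr_le0 ltW.
Qed.

Let asum_pos f : asum f -> asum (pos f).
Proof.
move=> [C hC]; exists C => F; apply: le_trans (hC F); apply: ler_sum => t _.
rewrite (ger0_norm (pos_ge0 f t)) ge_max ler_norm /=; exact: normr_ge0.
Qed.

Lemma asumN f : asum f -> asum (fun t => - f t).
Proof. by apply: asum_le' => t; rewrite normrN. Qed.

Lemma rsum_lin a f g : asum f -> asum g ->
  rsum (fun t => a * f t + g t) = a * rsum f + rsum g.
Proof.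
move=> fa ga.
have fp := asum_pos fa; have gp := asum_pos ga.
have fn := asum_pos (asumN fa); have gn := asum_pos (asumN ga).
have rE h : asum h -> rsum h = nsum (pos h) - nsum (pos (fun t => - h t)).
  move=> ha; rewrite -rsumB //; [|exact: asum_pos|exact/asum_pos/asumN].
  by congr rsum; apply/funext => t; exact: pos_neg.
rewrite (rE f fa) (rE g ga).
have [a0|a0] := leP 0 a.
  have -> : (fun t => a * f t + g t) = (fun t => (a * pos f t + pos g t) -
      (a * pos (fun t => - f t) t + pos (fun t => - g t) t)).
    by apply/funext => t; rewrite {1}(pos_neg f t) {1}(pos_neg g t); ring.
  rewrite rsumB; [|by move=> t; rewrite addr_ge0 ?mulr_ge0..|exact: asum_lin|exact: asum_lin].
  by rewrite !nsum_lin //; ring.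
(* For a < 0 the positive and the negative part of f change places. *)
have na0 : 0 <= - a by rewrite oppr_ge0 ltW.
have -> : (fun t => a * f t + g t) = (fun t => (- a * pos (fun t => - f t) t + pos g t) -
    (- a * pos f t + pos (fun t => - g t) t)).
  by apply/funext => t; rewrite {1}(pos_neg f t) {1}(pos_neg g t); ring.
rewrite rsumB; [|by move=> t; rewrite addr_ge0 ?mulr_ge0..|exact: asum_lin|exact: asum_lin].
by rewrite !nsum_lin //; ring.
Qed.

Lemma rsum_ge0 f : (forall t, 0 <= f t) -> asum f -> 0 <= rsum f.
Proof.
move=> f0 fa; rewrite -lee_fin rsum_ge0E //; apply: esum_ge0 => t _.
by rewrite lee_fin.
Qed.

Lemma le_rsum_fset f F : (forall t, 0 <= f t) -> asum f -> \sum_(t <- F) f t <= rsum f.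
Proof. by move=> f0 fa; exact: (rsum_leP (rsum f) f0 fa).1. Qed.

Lemma asum_fsupp f F : (forall t, t \notin F -> f t = 0) -> asum f.
Proof.
move=> fF; exists (\sum_(t <- F) `|f t|) => G.
apply: le_trans (le_sum_fsubset (f := fun t => `|f t|) _ (fsubsetUl G F)) _ => //.
rewrite -(big_fset_incl _ (fsubsetUr G F)) // => t _ /fF ->.
by rewrite normr0.
Qed.

Lemma rsum_fsupp f F : (forall t, t \notin F -> f t = 0) -> rsum f = \sum_(t <- F) f t.
Proof.
move=> fF.
have key g : (forall t, 0 <= g t) -> (forall t, t \notin F -> g t = 0) ->
    nsum g = \sum_(t <- F) g t.
  move=> g0 gF; have ga := asum_fsupp gF.
  apply/eqP; rewrite eq_le; apply/andP; split.
    apply/nsum_leP => // G; apply: le_trans (le_sum_fsubset g0 (fsubsetUl G F)) _.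
    by rewrite -(big_fset_incl _ (fsubsetUr G F)) // => t _ /gF.
  exact: (nsum_leP (nsum g) g0 ga).1 (lexx _) F.
have -> : f = (fun t => pos f t - pos (fun t => - f t) t).
  by apply/funext => t; exact: pos_neg.
have pF g : (forall t, t \notin F -> g t = 0) -> forall t, t \notin F -> pos g t = 0.
  by move=> gF t /gF h; rewrite /pos h maxxx.
have nF t : t \notin F -> - f t = 0 by move=> /fF ->; rewrite oppr0.
rewrite rsumB //; [|exact: asum_fsupp (pF _ fF)|exact: asum_fsupp (pF _ nF)].
by rewrite !key // ?sumrB //; exact: pF.
Qed.

(** F0 carries all but less than e of the total sum of |f|. *)
Lemma asum_tail f e : asum f -> 0 < e -> exists F0 : {fset T},
  forall g, (forall t, `|g t| <= `|f t|) -> (forall t, t \in F0 -> g t = 0) ->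
  forall F, \sum_(t <- F) `|g t| <= e.
Proof.
move=> fa e0; pose f' t := `|f t|.
have f'0 t : 0 <= f' t by exact: normr_ge0.
have f'a : asum f' by apply: asum_le' fa => t; rewrite normr_id.
have [F0 hF0] : exists F0 : {fset T}, rsum f' - e < \sum_(t <- F0) f' t.
  apply: contrapT => hn; suff : rsum f' <= rsum f' - e by rewrite lerBrDr gerDl leNgt e0.
  by apply/rsum_leP => // F; rewrite leNgt; apply/negP => h; apply: hn; exists F.
exists F0 => g gf gF0 F.
have h1 : \sum_(t <- (F `|` F0)%fset) f' t <= rsum f' by exact: le_rsum_fset.
have h2 : \sum_(t <- F0) f' t + \sum_(t <- F) `|g t| <= \sum_(t <- (F `|` F0)%fset) f' t.
  have -> : \sum_(t <- F0) f' t = \sum_(t <- (F `|` F0)%fset) (if t \in F0 then f' t else 0).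
    rewrite -(big_fset_incl _ (fsubsetUr F F0)) => [|t _ tF]; last by rewrite (negPf tF).
    by apply: eq_big_seq => t ->.
  rewrite -lerBrDl -sumrB.
  apply: le_trans (le_sum_fsubset (f := fun t => `|g t|) _ (fsubsetUl F F0)) _ => //.
  apply: ler_sum => t _; case: ifP => tF0; last by rewrite subr0; exact: gf.
  by rewrite gF0 // normr0 subrr.
lra.
Qed.

End RealSums.

(** * Subspaces as modules of their own *)

Section Subspace.
Context {R : realType} {W : lmodType R} (D : set W).

Record submodule_set : Prop := SubmoduleSet {
  sm0 : D 0;
  smP : forall a u v, D u -> D v -> D (a *: u + v) }.

Context (HD : submodule_set).

(** The abstract results concern all vectors of a module. This type makes them available for l^2(X,
    m) and for the form domains, which are given as predicates on X -> R. *)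
Record subsp := Subsp { sval : W ; svalP : D sval }.

Lemma subsp_inj : injective sval.
Proof.
move=> [u hu] [v hv] /= uv; subst v; congr Subsp; exact: Prop_irrelevance.
Qed.

Lemma smD u v : D u -> D v -> D (u + v).
Proof. by move=> hu hv; rewrite -[u]scale1r; exact: smP. Qed.
Lemma smZ a u : D u -> D (a *: u).
Proof. by move=> hu; rewrite -[_ *: _]addr0; apply: smP => //; exact: sm0. Qed.
Lemma smN u : D u -> D (- u).
Proof. by move=> hu; rewrite -scaleN1r; exact: smZ. Qed.
Lemma smB u v : D u -> D v -> D (u - v).
Proof. by move=> hu hv; apply: smD => //; exact: smN. Qed.

Definition subsp0 := Subsp (sm0 HD).
Definition subspD u v := Subsp (smD (svalP u) (svalP v)).
Definition subspN u := Subsp (smN (svalP u)).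
Definition subspZ a u := Subsp (smZ a (svalP u)).

HB.instance Definition _ := gen_eqMixin subsp.
HB.instance Definition _ := gen_choiceMixin subsp.

Let addA : associative subspD.
Proof. by move=> u v w; apply: subsp_inj; rewrite /= addrA. Qed.
Let addC : commutative subspD.
Proof. by move=> u v; apply: subsp_inj; rewrite /= addrC. Qed.
Let add0 : left_id subsp0 subspD.
Proof. by move=> u; apply: subsp_inj; rewrite /= add0r. Qed.
Let addN : left_inverse subsp0 subspN subspD.
Proof. by move=> u; apply: subsp_inj; rewrite /= addNr. Qed.

HB.instance Definition _ := GRing.isZmodule.Build subsp addA addC add0 addN.

Let scaleA a b u : subspZ a (subspZ b u) = subspZ (a * b) u.
Proof. by apply: subsp_inj; rewrite /= scalerA. Qed.
Let scale1 : left_id 1 subspZ.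
Proof. by move=> u; apply: subsp_inj; rewrite /= scale1r. Qed.
Let scaleDr : right_distributive subspZ +%R.
Proof. by move=> a u v; apply: subsp_inj; rewrite /= scalerDr. Qed.
Let scaleDl u : {morph subspZ^~ u : a b / a + b}.
Proof. by move=> a b; apply: subsp_inj; rewrite /= scalerDl. Qed.

HB.instance Definition _ :=
  GRing.Zmodule_isLmodule.Build R subsp scaleA scale1 scaleDr scaleDl.

Definition sub_lmod : lmodType R := subsp.

Definition sv (u : sub_lmod) : W := sval u.
Definition mksub u (hu : D u) : sub_lmod := Subsp hu.
Definition pack (u : W) : sub_lmod :=
  if pselect (D u) is left hu then mksub hu else 0.

Lemma svP u : D (sv u). Proof. exact: svalP. Qed.
Lemma sv_inj : injective sv. Proof. exact: subsp_inj. Qed.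
Lemma svD u v : sv (u + v) = sv u + sv v. Proof. by []. Qed.
Lemma svN u : sv (- u) = - sv u. Proof. by []. Qed.
Lemma svZ a u : sv (a *: u) = a *: sv u. Proof. by []. Qed.
Lemma packE u : D u -> sv (pack u) = u.
Proof. by move=> hu; rewrite /pack; case: pselect. Qed.
Lemma svK u : pack (sv u) = u.
Proof. by apply: sv_inj; rewrite packE //; exact: svP. Qed.

Record inner_product_on (dot : W -> W -> R) : Prop := InnerProductOn {
  ondC : forall u v, dot u v = dot v u;
  ondP : forall a u v w, D u -> D v -> D w -> dot (a *: u + v) w = a * dot u w + dot v w;
  ond_ge0 : forall u, D u -> 0 <= dot u u;
  ond_eq0 : forall u, D u -> dot u u = 0 -> u = 0 }.

Definition sdot (dot : W -> W -> R) (u v : sub_lmod) : R := dot (sv u) (sv v).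

Lemma nrm_sdot dot u : nrm (sdot dot) u = nrm dot (sv u).
Proof. by []. Qed.

Context {dot : W -> W -> R} (Hd : inner_product_on dot).

Lemma inner_product_sdot : inner_product (sdot dot).
Proof.
split=> [u v|a u v w|u|u].
- exact: ondC.
- by rewrite /sdot svD svZ; apply: (ondP Hd); exact: svP.
- by apply: (ond_ge0 Hd); exact: svP.
- by move=> h; apply: sv_inj; apply: (ond_eq0 Hd) => //; exact: svP.
Qed.

Lemma ond_CS u v : D u -> D v -> `|dot u v| <= nrm dot u * nrm dot v.
Proof. by move=> hu hv; exact: (dot_CS inner_product_sdot (mksub hu) (mksub hv)). Qed.

Lemma ond_nrmD u v : D u -> D v -> nrm dot (u + v) <= nrm dot u + nrm dot v.
Proof. by move=> hu hv; exact: (nrmD inner_product_sdot (mksub hu) (mksub hv)). Qed.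

Lemma ond_nrmB u v : D u -> D v -> nrm dot (u - v) = nrm dot (v - u).
Proof. by move=> hu hv; exact: (nrmB inner_product_sdot (mksub hu) (mksub hv)). Qed.

Lemma ond_nrm_sqr u : D u -> nrm dot u ^+ 2 = dot u u.
Proof. by move=> hu; exact: (nrm_sqr inner_product_sdot (mksub hu)). Qed.

Lemma ondPr a u v w : D u -> D v -> D w -> dot w (a *: u + v) = a * dot w u + dot w v.
Proof. by move=> hu hv hw; rewrite ondC // (ondP Hd) // !(ondC Hd w). Qed.

Lemma ondBl u v w : D u -> D v -> D w -> dot (u - v) w = dot u w - dot v w.
Proof. by move=> hu hv hw; rewrite addrC -scaleN1r (ondP Hd) // mulN1r addrC. Qed.

End Subspace.

(** * Weighted inner products, pointwise limits and diagonal subsequences *)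

Section WeightedL2.
Context {R : realType} {T : choiceType}.
Implicit Types (w f g h : T -> R) (a C e : R).

(** The weights may vanish: besides m on X, they are c on X and b on pairs, the latter applied to
    differences. *)
Definition wl2 w f : Prop := asum (fun t => w t * f t ^+ 2).
Definition wdot w f g : R := rsum (fun t => w t * f t * g t).

Context {w : T -> R} (w0 : forall t, 0 <= w t).

Lemma asum_wdot f g : wl2 w f -> wl2 w g -> asum (fun t => w t * f t * g t).
Proof.
move=> hf hg; apply: asum_le (asum_lin 1 hf hg) => t.
rewrite mul1r -mulrDr -mulrA normrM (ger0_norm (w0 t)) ler_wpM2l //.
by rewrite ler_norml; have := sqr_ge0 (f t + g t); have := sqr_ge0 (f t - g t);
  have := sqr_ge0 (f t); have := sqr_ge0 (g t); nra.
Qed.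

Lemma wl2_lin a f g : wl2 w f -> wl2 w g -> wl2 w (fun t => a * f t + g t).
Proof.
move=> hf hg; apply: asum_le (asum_lin (2 * a ^+ 2) hf (asum_lin 1 hg hg)) => t.
rewrite (ger0_norm (mulr_ge0 (w0 t) (sqr_ge0 _))) mul1r.
rewrite (_ : 2 * a ^+ 2 * _ + _ = w t * (2 * (a * f t) ^+ 2 + 2 * g t ^+ 2)); last by ring.
by rewrite ler_wpM2l //; have := sqr_ge0 (a * f t - g t); nra.
Qed.

Lemma wl20 : wl2 w (fun=> 0).
Proof. by exists 0 => F; rewrite big1 // => t _; rewrite expr0n mulr0 normr0. Qed.

Lemma wdotC f g : wdot w f g = wdot w g f.
Proof. by congr rsum; apply/funext => t; rewrite mulrAC. Qed.

Lemma wdotP a f g h : wl2 w f -> wl2 w g -> wl2 w h ->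
  wdot w (fun t => a * f t + g t) h = a * wdot w f h + wdot w g h.
Proof.
move=> hf hg hh; rewrite -rsum_lin; [|exact: asum_wdot|exact: asum_wdot].
by congr rsum; apply/funext => t; ring.
Qed.

Lemma wdot_sqrE f : (fun t => w t * f t * f t) = (fun t => w t * f t ^+ 2).
Proof. by apply/funext => t; rewrite expr2 mulrA. Qed.

Lemma wdot_ge0 f : wl2 w f -> 0 <= wdot w f f.
Proof.
by move=> hf; rewrite /wdot wdot_sqrE; apply: rsum_ge0 => // t; rewrite mulr_ge0 ?sqr_ge0.
Qed.

Lemma wdot_coord f t : wl2 w f -> w t * f t ^+ 2 <= wdot w f f.
Proof.
move=> hf; rewrite /wdot wdot_sqrE.
have := le_rsum_fset (f := fun t => w t * f t ^+ 2) [fset t]%fset _ hf.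
by rewrite big_seq_fset1; apply=> s; rewrite mulr_ge0 ?sqr_ge0.
Qed.

Lemma wdot_leP f C : wl2 w f -> wdot w f f <= C <->
  forall F : {fset T}, \sum_(t <- F) w t * f t ^+ 2 <= C.
Proof.
by move=> hf; rewrite /wdot wdot_sqrE; apply: rsum_leP => // t; rewrite mulr_ge0 ?sqr_ge0.
Qed.

(** Fatou's lemma for sums: bounds on finite partial sums pass to the pointwise limit. *)
Lemma wl2_fatou (g : nat -> T -> R) h e : (forall k, wl2 w (g k)) ->
  (forall k, wdot w (g k) (g k) <= e) ->
  (forall t, g k t @[k --> \oo] --> h t) -> wl2 w h /\ wdot w h h <= e.
Proof.
move=> gl ge gh.
have key (F : {fset T}) : \sum_(t <- F) w t * h t ^+ 2 <= e.
  rewrite -subr_le0.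
  apply: (@le_cvg0 _ (fun k => \sum_(t <- F) w t * h t ^+ 2 - \sum_(t <- F) w t * g k t ^+ 2)).
    by move=> k; rewrite lerD2l lerN2; exact: (wdot_leP e (gl k)).1 (ge k) F.
  rewrite -[X in _ --> X](subrr (\sum_(t <- F) w t * h t ^+ 2)).
  apply: cvgB; first exact: cvg_cst.
  elim: (F : seq T) => [|t s IH]; first by under eq_fun do rewrite big_nil; rewrite big_nil; exact: cvg_cst.
  under eq_fun do rewrite big_cons; rewrite big_cons; apply: cvgD => //.
  apply: cvgM; first exact: cvg_cst.
  by rewrite expr2; under eq_fun do rewrite expr2; apply: cvgM; exact: gh.
have hl : wl2 w h.
  exists e => F; apply: le_trans (key F); apply: ler_sum => t _.
  by rewrite ger0_norm // mulr_ge0 ?sqr_ge0.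
by split=> //; apply/wdot_leP.
Qed.

Lemma wdot_tail f e : wl2 w f -> 0 < e -> exists F0 : {fset T},
  forall g, (forall t, g t = if t \in F0 then 0 else f t) ->
  wl2 w g /\ wdot w g g <= e.
Proof.
move=> hf e0; have [F0 hF0] := asum_tail hf e0; exists F0 => g gE.
have key (F : {fset T}) : \sum_(t <- F) `|w t * g t ^+ 2| <= e.
  apply: (hF0 (fun t => w t * g t ^+ 2)) => t; last by rewrite gE => ->; rewrite expr0n mulr0.
  rewrite gE; case: ifP => // _; rewrite expr0n mulr0 normr0; exact: normr_ge0.
have hg : wl2 w g by exists e.
split=> //; apply/wdot_leP => // F; apply: le_trans (key F); apply: ler_sum => t _.
exact: ler_norm.
Qed.

Lemma wl2_fsupp f (F : {fset T}) : (forall t, t \notin F -> f t = 0) -> wl2 w f.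
Proof. by move=> fF; apply: (@asum_fsupp _ _ _ F) => t /fF ->; rewrite expr0n mulr0. Qed.

Lemma wdot_fsupp f g (F : {fset T}) : (forall t, t \notin F -> g t = 0) ->
  wdot w f g = \sum_(t <- F) w t * f t * g t.
Proof. by move=> gF; apply: rsum_fsupp => t /gF ->; rewrite mulr0. Qed.

End WeightedL2.

Lemma cauchy_pointwise {R : realType} {X : Type} (un : nat -> X -> R) :
  (forall x (e : R), 0 < e -> exists N : nat, forall i j : nat, (N <= i)%N -> (N <= j)%N ->
    `|un i x - un j x| < e) ->
  exists u : X -> R, forall x, un n x @[n --> \oo] --> u x.
Proof.
move=> h; have /choice[u hu] : forall x, exists l : R, un n x @[n --> \oo] --> l; last by exists u.
move=> x.
suff ucv : cvg (un n x @[n --> \oo]) by exists (lim (un n x @[n --> \oo])).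
apply/cauchy_cvgP/cauchy_exP => e e0; have [N hN] := h x e e0.
by exists (un N x); exists N => // n Nn; exact: (hN N n).
Qed.

Lemma diagonal_subseq {R : realType} (u : nat -> nat -> R) :
  (forall j, exists C : R, forall n, `|u n j| <= C) ->
  exists k : nat -> nat, {homo k : i j / (i < j)%N} /\
    forall j, exists l : R, u (k n) j @[n --> \oo] --> l.
Proof.
move=> ub.
have sub (p : nat -> nat) j : exists s : nat -> nat, {homo s : a b / (a < b)%N} /\
    exists l : R, u (p (s n)) j @[n --> \oo] --> l.
  by have [C hC] := ub j; apply: (@bounded_subseq R (fun n => u (p n) j) C).
have /choice[S0 hS0] : forall pj : (nat -> nat) * nat, exists s : nat -> nat,
    {homo s : a b / (a < b)%N} /\ exists l : R, u (pj.1 (s n)) pj.2 @[n --> \oo] --> l.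
  by move=> [p j]; exact: sub.
(* [phi j] is the j-th of nested subsequences; coordinate j converges along [phi j.+1]. *)
pose phi := fix phi j : nat -> nat := if j is j'.+1 then phi j' \o S0 (phi j', j') else id.
have phi_homo j : {homo phi j : a b / (a < b)%N}.
  elim: j => [//|j IH] a b ab /=; apply: IH.
  by have [h _] := hS0 (phi j, j); exact: h.
have phiS j i : exists r : nat -> nat, (forall n, (n <= r n)%N) /\
    forall n, phi (i + j)%N n = phi j (r n).
  elim: i => [|i [r [hr1 hr2]]]; first by exists id.
  have [h _] := hS0 (phi (i + j)%N, (i + j)%N).
  exists (r \o S0 (phi (i + j)%N, (i + j)%N)); split=> n /=; last by rewrite hr2.
  exact: leq_trans (homo_geid h n) (hr1 _).
exists (fun n => phi n n); split.
  apply: homo_ltn; first by move=> a b c; exact: ltn_trans.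
  move=> n /=; apply: phi_homo; have [h _] := hS0 (phi n, n).
  exact: leq_trans (homo_geid h n.+1).
move=> j; have [_ [l hl]] := hS0 (phi j, j); exists l.
have hl0 : u (phi j.+1 n) j - l @[n --> \oo] --> (0 : R) by apply/subr_cvg0.
apply/subr_cvg0; apply/cvg0P => e e0; have [N hN] := (cvg0P _).1 hl0 e e0.
(* For n > j the diagonal entry n is the entry r n >= n of [phi j.+1]. *)
exists (maxn N j.+1) => n; rewrite geq_max => /andP[Nn jn].
have [r [hr1 hr2]] := phiS j.+1 (n - j.+1)%N; rewrite subnK // in hr2.
by rewrite hr2; apply: hN; apply: leq_trans Nn (hr1 n).
Qed.

(** * The Hilbert space l^2(X, m) *)

Section L2Space.
Context {R : realType} {X : countType} {m : X -> R} (m_gt0 : forall x, 0 < m x).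
Implicit Types (u v f g : X -> R) (U : set X) (e C a : R).

Let m0 x : 0 <= m x := ltW (m_gt0 x).

Lemma l2E U u : l2 m U u <-> wl2 m u /\ forall x, ~ U x -> u x = 0.
Proof.
have e : (fun x => (m x * u x ^+ 2)%:E) = (fun x => `|m x * u x ^+ 2|%:E).
  by apply/funext => x; rewrite ger0_norm // mulr_ge0 ?sqr_ge0.
by rewrite /l2 /= e; split=> -[h1 h2]; split=> //; apply/asum_esum.
Qed.

Lemma l2TE u : l2 m setT u <-> wl2 m u.
Proof. by split=> [/l2E[]//|h]; apply/l2E; split=> // x; case. Qed.

Lemma l2_T U u : l2 m U u -> l2 m setT u.
Proof. by move=> /l2E[h _]; apply/l2TE. Qed.

Lemma sm_l2 : submodule_set (l2 m setT).
Proof.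
split; first by apply/l2TE; exact: wl20.
by move=> a u v /l2TE hu /l2TE hv; apply/l2TE; exact: wl2_lin.
Qed.

Lemma ip_l2 : inner_product_on (l2 m setT) (l2dot m).
Proof.
split.
- exact: wdotC.
- by move=> a u v w /l2TE hu /l2TE hv /l2TE hw; exact: wdotP.
- by move=> u /l2TE; exact: wdot_ge0.
move=> u /l2TE hu u0; apply/funext => x; apply/eqP; rewrite -sqrf_eq0 eq_le sqr_ge0 andbT.
rewrite -(pmulr_rle0 _ (m_gt0 x)); apply: le_trans (wdot_coord m0 x hu) _.
by rewrite -[wdot _ _ _]/(l2dot m u u) u0.
Qed.

Definition H2 : lmodType R := sub_lmod sm_l2.
Definition d2 : H2 -> H2 -> R := sdot (l2dot m).

Lemma ip_d2 : inner_product d2.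
Proof. exact: inner_product_sdot ip_l2. Qed.

Lemma l2_coord u x : l2 m setT u -> `|u x| <= nrm (l2dot m) u / Num.sqrt (m x).
Proof.
move=> /[dup] hu /l2TE hu'; have sm : 0 < Num.sqrt (m x) by rewrite sqrtr_gt0.
rewrite ler_pdivlMr // -ler_sqr ?nnegrE ?mulr_ge0 ?nrm_ge0 ?sqrtr_ge0 //.
rewrite exprMn sqr_sqrtr ?m0 // real_normK ?num_real // (ond_nrm_sqr sm_l2 ip_l2 hu) mulrC.
exact: wdot_coord.
Qed.

Lemma coord_cvg0 (un : nat -> X -> R) x : (forall n, l2 m setT (un n)) ->
  nrm (l2dot m) (un n) @[n --> \oo] --> (0 : R) -> un n x @[n --> \oo] --> (0 : R).
Proof.
move=> hu h; apply: (@cvg0_le _ _ (fun n => (Num.sqrt (m x))^-1 * nrm (l2dot m) (un n))).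
  by move=> n; rewrite mulrC; exact: l2_coord.
exact: cvg0M.
Qed.

Lemma l2B u v : l2 m setT u -> l2 m setT v -> l2 m setT (u - v).
Proof. exact: (smB sm_l2). Qed.

Lemma l2_fatou (g : nat -> X -> R) h e : 0 <= e -> (forall k, l2 m setT (g k)) ->
  (forall k, nrm (l2dot m) (g k) <= e) ->
  (forall x, g k x @[k --> \oo] --> h x) -> l2 m setT h /\ nrm (l2dot m) h <= e.
Proof.
move=> e0 gl ge gh.
have [||hl hle] := @wl2_fatou _ _ m m0 g h (e ^+ 2) _ _ gh.
- by move=> k; apply/l2TE.
- move=> k; rewrite -[wdot _ _ _]/(l2dot m (g k) (g k)) -(ond_nrm_sqr sm_l2 ip_l2) //.
  by rewrite ler_sqr ?nnegrE ?nrm_ge0.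
have hl' : l2 m setT h by apply/l2TE.
split=> //; rewrite -ler_sqr ?nnegrE ?nrm_ge0 // (ond_nrm_sqr sm_l2 ip_l2) //.
Qed.

Lemma pointwise_cauchy (un : nat -> X -> R) : (forall n, l2 m setT (un n)) ->
  hcauchy (l2dot m) un -> exists u : X -> R, forall x, un n x @[n --> \oo] --> u x.
Proof.
move=> hu uc; apply: cauchy_pointwise => x e e0.
have sm : 0 < Num.sqrt (m x) by rewrite sqrtr_gt0.
have [N hN] := uc (e * Num.sqrt (m x)) (mulr_gt0 e0 sm); exists N => i j hi hj.
apply: le_lt_trans (l2_coord x (l2B (hu i) (hu j))) _.
by rewrite ltr_pdivrMr //; exact: hN.
Qed.

(** The candidate is the pointwise limit; [l2_fatou], applied to u_i - u_(N + k) as k grows, bounds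
    its distance to u_i. *)
Lemma l2_complete_on (un : nat -> X -> R) : (forall n, l2 m setT (un n)) ->
  hcauchy (l2dot m) un -> exists2 u, l2 m setT u & hcvg (l2dot m) un u.
Proof.
move=> hu uc; have [u ul] := pointwise_cauchy hu uc.
have key e : 0 < e -> exists N : nat, forall i, (N <= i)%N ->
    l2 m setT (un i - u) /\ nrm (l2dot m) (un i - u) <= e.
  move=> e0; have [N hN] := uc e e0; exists N => i hi.
  apply: (l2_fatou (g := fun k => un i - un (N + k)%N)); first exact: ltW.
  - by move=> k; exact: l2B.
  - by move=> k; apply: ltW; apply: hN => //; exact: leq_addr.
  move=> x; apply: cvgB; first exact: cvg_cst.
  by apply/subr_cvg0; apply: (@cvg0_sub _ (fun n => un n x - u x) (addn N)) => [n|];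
    [exact: leq_addl | apply/subr_cvg0; exact: ul].
exists u.
  have [N hN] := key 1 ltr01; have [h _] := hN N (leqnn N).
  by have := l2B (hu N) h; rewrite opprB addrC subrK.
apply/cvg0P => e e0; have [|N hN] := key (e / 2); first by rewrite divr_gt0.
exists N => i /hN[_ h]; rewrite ger0_norm ?nrm_ge0 //; apply: le_lt_trans h _; lra.
Qed.

Lemma complete_d2 : hcomplete d2.
Proof.
move=> un uc; have [u hu uu] := l2_complete_on (fun n => svP (un n)) uc.
by exists (mksub sm_l2 hu).
Qed.

(** z is split into a finitely supported part, which sees finitely many coordinates, and a tail of
    norm at most d, where d C <= e/2. *)
Lemma wnull_pointwise (y : nat -> H2) C : (forall n, nrm d2 (y n) <= C) ->
  (forall x, sv (y n) x @[n --> \oo] --> (0 : R)) -> wnull d2 y.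
Proof.
move=> yC y0; split; first by exists C.
have C0 : 0 <= C by apply: le_trans (yC 0%N); exact: nrm_ge0.
move=> z; have /l2TE zl := svP z.
apply/cvg0P => e e0; have e20 : 0 < e / 2 by rewrite divr_gt0.
have [d d0 de] := small_mul e20 C0.
have [F hF] := wdot_tail m0 zl (exprn_gt0 2 d0).
pose z2 x := if x \in F then 0 else sv z x; pose z1 x := if x \in F then sv z x else 0.
have [z2l z2n] := hF z2 (fun _ => erefl).
have z1l : wl2 m z1 by apply: (@wl2_fsupp _ _ _ _ F) => x /negPf h; rewrite /z1 h.
have zE : sv z = (fun x => 1 * z1 x + z2 x).
  by apply/funext => x; rewrite /z1 /z2; case: ifP => _; rewrite ?mul1r ?addr0 ?add0r // mulr0 add0r.
have h1 : wdot m (sv (y n)) z1 @[n --> \oo] --> (0 : R).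
  have e1 n : wdot m (sv (y n)) z1 = \sum_(x <- F) (m x * z1 x) * sv (y n) x.
    rewrite (@wdot_fsupp _ _ m _ _ F); last by move=> x /negPf h; rewrite /z1 h.
    by apply: eq_bigr => x _; ring.
  under eq_fun do rewrite e1.
  elim: (F : seq X) => [|x s IH]; first by under eq_fun do rewrite big_nil; exact: cvg_cst.
  by under eq_fun do rewrite big_cons; apply: cvg0D => //; exact: cvg0M.
have [N hN] := (cvg0P _).1 h1 _ e20; exists N => n /hN h2.
have yl : wl2 m (sv (y n)) by apply/l2TE; exact: svP.
have -> : d2 (y n) z = wdot m (sv (y n)) z1 + wdot m (sv (y n)) z2.
  rewrite /d2 /sdot /l2dot -/(wdot m (sv (y n)) (sv z)) zE wdotC wdotP // mul1r.
  by rewrite (wdotC z1) (wdotC z2).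
apply: le_lt_trans (ler_normD _ _) _; rewrite [ltRHS]splitr; apply: ltr_leD => //.
have z2l' : l2 m setT z2 by apply/l2TE.
apply: le_trans (ond_CS sm_l2 ip_l2 (svP (y n)) z2l') _.
apply: le_trans de; rewrite mulrC; apply: ler_pM; rewrite ?nrm_ge0 //; last exact: yC.
by rewrite -ler_sqr ?nnegrE ?nrm_ge0 ?(ltW d0) // (ond_nrm_sqr sm_l2 ip_l2).
Qed.

(** A diagonal argument over the countable set X gives a pointwise limit, which is in l^2 by
    [l2_fatou]; then [wnull_pointwise] applies. *)
Lemma wsc_d2 : weak_seq_compact d2.
Proof.
move=> u C uC.
have C0 : 0 <= C by apply: le_trans (uC 0%N); exact: nrm_ge0.
pose c n j := if (choice.unpickle j : option X) is Some x then sv (u n) x else 0.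
have [|k [hk kl]] := @diagonal_subseq R c.
  move=> j; rewrite /c; case: choice.unpickle => [x|]; last by exists 0 => n; rewrite normr0.
  exists (C / Num.sqrt (m x)) => n; apply: le_trans (l2_coord x (svP (u n))) _.
  rewrite ler_pM2r ?invr_gt0 ?sqrtr_gt0 //; exact: uC.
have /choice[z hz] : forall x, exists l : R, sv (u (k n)) x @[n --> \oo] --> l.
  by move=> x; have := kl (choice.pickle x); rewrite /c choice.pickleK.
have [zl zC] := l2_fatou C0 (fun n => svP (u (k n))) (fun n => uC (k n)) hz.
exists k; split=> //; exists (mksub sm_l2 zl).
apply: (@wnull_pointwise _ (C + C)) => [n|x].
  apply: le_trans (nrmBD ip_d2 _ _) _; apply: lerD; [exact: uC | exact: zC].
by apply/subr_cvg0; exact: hz.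
Qed.

End L2Space.

(** * The Dirichlet form of a graph *)

Section DirichletForm.
Context {R : realType} {X : countType} {m : X -> R} {b : X -> X -> R} {c : X -> R}.
Context (m_gt0 : forall x, 0 < m x) (bc : is_graph b c).
Implicit Types (u v f g : X -> R) (U : set X) (e C a : R).

Let m0 x : 0 <= m x := ltW (m_gt0 x).
Let b2 (p : X * X) : R := b p.1 p.2.
Let grad u (p : X * X) : R := u p.1 - u p.2.

Let c0 x : 0 <= c x. Proof. by have [h _ _ _ _] := bc; exact: h. Qed.
Let b0 p : 0 <= b2 p. Proof. by have [_ h _ _ _] := bc; exact: h. Qed.

(** The functions of finite energy in l^2, that is, the maximal domain of the form. It may exceed
    the form domain, but it is complete, so that the closure of C_c can be taken inside of it. *)
Definition dom1 u : Prop := [/\ wl2 m u, wl2 c u & wl2 b2 (grad u)].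
Definition dot1 u v : R := form_comp b c u v + l2dot m u v.

Let dot1E u v : dot1 u v = 2^-1 * wdot b2 (grad u) (grad v) + wdot c u v + wdot m u v.
Proof. by []. Qed.

Let sE a f x : (a *: f) x = a * f x. Proof. by []. Qed.

Let gradP a u v : grad (a *: u + v) = (fun p => a * grad u p + grad v p).
Proof.
by apply/funext => p; rewrite /grad !fctE /=; rewrite /GRing.scale /=; ring.
Qed.

Lemma sm_dom1 : submodule_set dom1.
Proof.
split.
  split; try exact: wl20.
  rewrite (_ : grad 0 = (fun=> 0)); first exact: wl20.
  by apply/funext => p; rewrite /grad subrr.
move=> a u v [h1 h2 h3] [k1 k2 k3]; split; [exact: wl2_lin | exact: wl2_lin |].
by rewrite gradP; exact: wl2_lin.
Qed.

Lemma dom1_l2 u : dom1 u -> l2 m setT u.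
Proof. by move=> [h _ _]; apply/(l2TE m_gt0). Qed.

Lemma form_compC u v : form_comp b c u v = form_comp b c v u.
Proof.
rewrite -[LHS]/(2^-1 * wdot b2 (grad u) (grad v) + wdot c u v).
by rewrite wdotC (wdotC u).
Qed.

Lemma form_comp_ge0 u : dom1 u -> 0 <= form_comp b c u u.
Proof.
move=> [h1 h2 h3].
by apply: addr_ge0; [apply: mulr_ge0; [by rewrite invr_ge0|exact: (wdot_ge0 b0 h3)]|exact: (wdot_ge0 c0 h2)].
Qed.

Lemma ip_dot1 : inner_product_on dom1 dot1.
Proof.
split.
- by move=> u v; rewrite /dot1 form_compC; congr (_ + _); exact: (ondC (ip_l2 m_gt0)).
- move=> a u v w [h1 h2 h3] [k1 k2 k3] [l1 l2 l3]; rewrite !dot1E gradP.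
  rewrite (wdotP b0 a h3 k3 l3) (wdotP c0 a h2 k2 l2) (wdotP m0 a h1 k1 l1); ring.
- move=> u hu; apply: addr_ge0; first exact: form_comp_ge0.
  exact: (ond_ge0 (ip_l2 m_gt0) (dom1_l2 hu)).
move=> u hu; have h1 := form_comp_ge0 hu.
have h2 := ond_ge0 (ip_l2 m_gt0) (dom1_l2 hu).
rewrite /dot1 => h3; apply: (ond_eq0 (ip_l2 m_gt0) (dom1_l2 hu)); lra.
Qed.

Local Notation n1 := (nrm dot1).
Local Notation n2 := (nrm (l2dot m)).

Lemma n1_sqr u : dom1 u -> n1 u ^+ 2 = form_comp b c u u + n2 u ^+ 2.
Proof.
move=> hu; rewrite (ond_nrm_sqr sm_dom1 ip_dot1 hu).
by rewrite (ond_nrm_sqr (sm_l2 m_gt0) (ip_l2 m_gt0) (dom1_l2 hu)).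
Qed.

Lemma n2_le_n1 u : dom1 u -> n2 u <= n1 u.
Proof.
move=> hu; rewrite -ler_sqr ?nnegrE ?nrm_ge0 // n1_sqr // lerDr.
exact: form_comp_ge0.
Qed.

Lemma dom1B u v : dom1 u -> dom1 v -> dom1 (u - v).
Proof. exact: (smB sm_dom1). Qed.

(** The three parts of the norm are estimated separately, which gives 3 e^2 <= (2 e)^2; the constant
    is harmless for completeness. *)
Lemma dom1_fatou (g : nat -> X -> R) h e : 0 <= e -> (forall k, dom1 (g k)) ->
  (forall k, n1 (g k) <= e) -> (forall x, g k x @[k --> \oo] --> h x) ->
  dom1 h /\ n1 h <= 2 * e.
Proof.
move=> e0 gl ge gh.
have ge2 k : 2^-1 * wdot b2 (grad (g k)) (grad (g k)) + wdot c (g k) (g k) +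
    wdot m (g k) (g k) <= e ^+ 2.
  rewrite -dot1E -(ond_nrm_sqr sm_dom1 ip_dot1 (gl k)).
  by rewrite ler_sqr ?nnegrE ?nrm_ge0.
have pb k : 0 <= wdot b2 (grad (g k)) (grad (g k)).
  by have [_ _ h3] := gl k; exact: (wdot_ge0 b0 h3).
have pc k : 0 <= wdot c (g k) (g k) by have [_ h2 _] := gl k; exact: (wdot_ge0 c0 h2).
have pm k : 0 <= wdot m (g k) (g k) by have [h1 _ _] := gl k; exact: (wdot_ge0 m0 h1).
have aux (x y z s : R) : 0 <= x -> 0 <= y -> 0 <= z -> 2^-1 * x + y + z <= s ->
    [/\ x <= 2 * s, y <= s & z <= s].
  by move=> *; split; lra.
have q k := aux _ _ _ _ (pb k) (pc k) (pm k) (ge2 k).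
have [|||hm hm'] := @wl2_fatou _ _ m m0 g h (e ^+ 2) => //.
- by move=> k; have [] := gl k.
- by move=> k; have [] := q k.
have [|||hc hc'] := @wl2_fatou _ _ c c0 g h (e ^+ 2) => //.
- by move=> k; have [] := gl k.
- by move=> k; have [] := q k.
have [|||hb hb'] := @wl2_fatou _ _ b2 b0 (fun k => grad (g k)) (grad h) (2 * e ^+ 2) => //.
- by move=> k; have [] := gl k.
- by move=> k; have [] := q k.
- by move=> p; apply: cvgB; exact: gh.
have hd : dom1 h by [].
split=> //; rewrite -ler_sqr ?nnegrE ?mulr_ge0 ?nrm_ge0 //.
rewrite (ond_nrm_sqr sm_dom1 ip_dot1 hd) dot1E exprMn.
by have := sqr_ge0 e; move: hm' hc' hb' => h1 h2 h3 h4; lra.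
Qed.

Definition delta (x y : X) : R := (y == x)%:R.

(** The gradient of delta_x lives on pairs containing x; the row and, by symmetry of b, the column
    of x are summable. *)
Lemma dom1_delta x : dom1 (delta x).
Proof.
have fs w : wl2 w (delta x).
  apply: (@wl2_fsupp _ _ w (delta x) [fset x]%fset) => y.
  by rewrite inE /delta => /negPf ->.
split; [exact: fs | exact: fs |].
have [_ _ _ bs /(_ x) bx] := bc.
have rowa : asum (fun p : X * X => if p.1 == x then b x p.2 else 0).
  apply/asum_esum; apply: le_lt_trans bx.
  rewrite -(@esum_image _ _ _ setT (fun z => (x, z)) (fun p : X * X => (b x p.2)%:E)); last first.
    by move=> z z' _ _ [].
  rewrite [leRHS]esum_mkcond; apply: le_esum => -[y z] _ /=.
  case: eqVneq => [->|yx]; last by rewrite normr0; case: ifP => // _; rewrite lee_fin (b0 (x, z)).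
  rewrite ifT; first by rewrite ger0_norm ?lee_fin // (b0 (x, z)).
  by rewrite inE; exists z.
have cola : asum (fun p : X * X => if p.2 == x then b x p.1 else 0).
  apply/asum_esum; apply: le_lt_trans bx.
  rewrite -(@esum_image _ _ _ setT (fun z => (z, x)) (fun p : X * X => (b x p.1)%:E)); last first.
    by move=> z z' _ _ [].
  rewrite [leRHS]esum_mkcond; apply: le_esum => -[y z] _ /=.
  case: eqVneq => [->|yx]; last by rewrite normr0; case: ifP => // _; rewrite lee_fin (b0 (x, y)).
  rewrite ifT; first by rewrite ger0_norm ?lee_fin // (b0 (x, y)).
  by rewrite inE; exists y.
apply: asum_le (asum_lin 1 rowa cola) => -[y z] /=.
rewrite mul1r (ger0_norm (mulr_ge0 (b0 (y, z)) (sqr_ge0 _))) /grad /delta /b2 /=.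
have bxx := b0 (x, z); have byx := b0 (x, y).
have := b0 (y, z); rewrite /b2 /= in bxx byx *.
case: (eqVneq y x) => [->|yx]; case: (eqVneq z x) => [->|zx] /=; rewrite ?(bs y x) /=; nra.
Qed.

Lemma sum_deltaE (F : {fset X}) u y :
  (\sum_(x <- F) u x *: delta x) y = if y \in F then u y else 0.
Proof.
rewrite fct_sumE; case: ifP => yF.
  rewrite (big_fsetD1 y) //= big_seq big1 ?addr0.
    by rewrite sE /delta eqxx mulr1.
  by move=> z; rewrite !inE eq_sym => /andP[/negPf zy _]; rewrite sE /delta zy mulr0.
rewrite big_seq big1 // => z zF; rewrite sE /delta.
by case: eqVneq => [yz|]; rewrite ?mulr0 //; rewrite yz zF in yF.
Qed.

Lemma dom1_sum (s : seq X) u : dom1 (\sum_(x <- s) u x *: delta x).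
Proof.
elim: s => [|x s IH]; first by rewrite big_nil; exact: (sm0 sm_dom1).
by rewrite big_cons; apply: (smP sm_dom1) => //; exact: dom1_delta.
Qed.

Lemma Cc_dom1 U u : Cc U u -> dom1 u.
Proof.
move=> [/finite_fsetP[F FE] _].
have -> : u = \sum_(x <- F) u x *: delta x; last exact: dom1_sum.
apply/funext => y; rewrite sum_deltaE; case: ifP => // /negbT yF.
apply/eqP; apply: contraNT yF => uy.
by have : [set x | u x != 0] y by []; rewrite FE.
Qed.

(** The closure of C_c(U) inside of [dom1], the form domain for U = [setT]. Unlike in [form_dom_on],
    the norm is given by explicit sums. *)
Definition core U : set (X -> R) :=
  [set u | dom1 u /\ exists un : nat -> X -> R, (forall n, Cc U (un n)) /\ hcvg dot1 un u].


Lemma coreS U u : core U u -> core setT u.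
Proof.
move=> [hu [un [hun uu]]]; split=> //; exists un; split=> // n.
by have [h _] := hun n; split=> // x; case.
Qed.

Lemma Cc_comb U a u v : Cc U u -> Cc U v -> Cc U (a *: u + v).
Proof.
move=> [fu zu] [fv zv]; split; last first.
  by move=> x hx; rewrite !fctE zu // zv // scaler0 addr0.
apply: (@sub_finite_set _ _ ([set x | u x != 0] `|` [set x | v x != 0])).
  move=> x /=; rewrite !fctE => h; apply: contrapT => /not_orP[/negP h1 /negP h2].
  by move: h; rewrite (eqP (negPn h1)) (eqP (negPn h2)) scaler0 addr0 eqxx.
by rewrite finite_setU.
Qed.

Lemma Cc0 U : Cc U (0 : X -> R).
Proof.
split=> //; rewrite (_ : [set x | _] = set0) //.
by apply/seteqP; split=> x //=; rewrite eqxx.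
Qed.

Lemma n1D u v : dom1 u -> dom1 v -> n1 (u + v) <= n1 u + n1 v.
Proof. exact: (ond_nrmD sm_dom1 ip_dot1). Qed.

Lemma n1Z a u : dom1 u -> n1 (a *: u) = `|a| * n1 u.
Proof. by move=> hu; exact: (nrmZ (inner_product_sdot sm_dom1 ip_dot1) a (mksub sm_dom1 hu)). Qed.

Lemma n1B u v : dom1 u -> dom1 v -> n1 (u - v) = n1 (v - u).
Proof. exact: (ond_nrmB sm_dom1 ip_dot1). Qed.

Lemma sm_core U : submodule_set (core U).
Proof.
split.
  split; first exact: (sm0 sm_dom1).
  exists (fun=> 0); split=> [n|]; first exact: Cc0.
  have z : n1 (0 - 0) = 0 by rewrite subr0; exact: (nrm0 (inner_product_sdot sm_dom1 ip_dot1)).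
  by rewrite /hcvg z; exact: cvg_cst.
move=> a u v [hu [un [hun uu]]] [hv [vn [hvn vv]]]; split; first exact: (smP sm_dom1).
exists (fun n => a *: un n + vn n); split=> [n|]; first exact: Cc_comb.
apply: (@cvg0_le _ _ (fun n => `|a| * n1 (un n - u) + n1 (vn n - v))).
  move=> n; rewrite ger0_norm ?nrm_ge0 //.
  have h1 := dom1B (Cc_dom1 (hun n)) hu; have h2 := dom1B (Cc_dom1 (hvn n)) hv.
  rewrite -(n1Z a h1) (_ : _ - _ = a *: (un n - u) + (vn n - v)).
    exact: (n1D (smZ sm_dom1 a h1) h2).
  by rewrite scalerBr opprD addrACA.
by apply: cvg0D => //; exact: cvg0M.
Qed.

Lemma core_dom1 U u : core U u -> dom1 u.
Proof. by case. Qed.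

Lemma core_l2T U u : core U u -> l2 m setT u.
Proof. by move=> /core_dom1/dom1_l2. Qed.

Lemma Cc_core U u : Cc U u -> core U u.
Proof.
move=> hu; split; first exact: Cc_dom1 hu.
exists (fun=> u); split=> //.
have z : n1 (u - u) = 0 by rewrite subrr; exact: (nrm0 (inner_product_sdot sm_dom1 ip_dot1)).
by rewrite /hcvg z; exact: cvg_cst.
Qed.

Lemma dom1_coord_cvg (un : nat -> X -> R) u x : (forall n, dom1 (un n)) -> dom1 u ->
  hcvg dot1 un u -> un n x @[n --> \oo] --> u x.
Proof.
move=> hun hu uu; apply/subr_cvg0.
apply: (coord_cvg0 m_gt0 (un := fun n => un n - u)).
  by move=> n; apply: dom1_l2; exact: dom1B.
apply: cvg0_le uu => n; rewrite ger0_norm ?nrm_ge0 //; apply: n2_le_n1; exact: dom1B.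
Qed.

Lemma core_l2 U u : core U u -> l2 m U u.
Proof.
move=> [hu [un [hun uu]]]; apply/(l2E m_gt0); split; first by case: hu.
move=> x hx; have h := dom1_coord_cvg (x := x) (fun n => Cc_dom1 (hun n)) hu uu.
have e : (fun n => un n x) = (fun=> 0) by apply/funext => n; have [_] := hun n; exact.
rewrite e in h; apply: (cvg_unique _ h); [exact: norm_hausdorff | exact: cvg_cst].
Qed.

Lemma dom1_complete (un : nat -> X -> R) : (forall n, dom1 (un n)) ->
  hcauchy dot1 un -> exists2 u, dom1 u & hcvg dot1 un u.
Proof.
move=> hu uc.
have uc2 : hcauchy (l2dot m) un.
  move=> e e0; have [N hN] := uc e e0; exists N => i j hi hj.
  by apply: le_lt_trans (hN i j hi hj); apply: n2_le_n1; exact: dom1B.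
have [u ul] := pointwise_cauchy m_gt0 (fun n => dom1_l2 (hu n)) uc2.
have key e : 0 < e -> exists N : nat, forall i, (N <= i)%N ->
    dom1 (un i - u) /\ n1 (un i - u) <= 2 * e.
  move=> e0; have [N hN] := uc e e0; exists N => i hi.
  apply: (dom1_fatou (g := fun k => un i - un (N + k)%N)); first exact: ltW.
  - by move=> k; exact: dom1B.
  - by move=> k; apply: ltW; apply: hN => //; exact: leq_addr.
  move=> x; apply: cvgB; first exact: cvg_cst.
  by apply/subr_cvg0; apply: (@cvg0_sub _ (fun n => un n x - u x) (addn N)) => [n|];
    [exact: leq_addl | apply/subr_cvg0; exact: ul].
exists u.
  have [N hN] := key 1 ltr01; have [h _] := hN N (leqnn N).
  by have := dom1B (hu N) h; rewrite opprB addrC subrK.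
apply/cvg0P => e e0; have [|N hN] := key (e / 4); first by rewrite divr_gt0.
exists N => i /hN[_ h]; rewrite ger0_norm ?nrm_ge0 //; apply: le_lt_trans h _; lra.
Qed.

Lemma core_closed U (un : nat -> X -> R) u : (forall n, core U (un n)) -> dom1 u ->
  hcvg dot1 un u -> core U u.
Proof.
move=> hun hu uu; split=> //.
have /choice[wn hwn] : forall n, exists w, Cc U w /\ n1 (w - un n) < n.+1%:R^-1.
  move=> n; have [_ [vn [hvn vv]]] := hun n.
  have n0 : 0 < n.+1%:R^-1 :> R by rewrite invr_gt0.
  have [N hN] := (cvg0P _).1 vv _ n0; exists (vn N); split=> //.
  by have := hN N (leqnn N); rewrite ger0_norm ?nrm_ge0.
exists wn; split=> [n|]; first by have [] := hwn n.
apply: (@cvg0_le _ _ (fun n => n.+1%:R^-1 + n1 (un n - u))).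
  move=> n; rewrite ger0_norm ?nrm_ge0 //; have [h1 h2] := hwn n.
  have k1 := dom1B (Cc_dom1 h1) (core_dom1 (hun n)).
  have k2 := dom1B (core_dom1 (hun n)) hu.
  by have := n1D k1 k2; rewrite addrA subrK => /le_trans; apply; rewrite lerD2r ltW.
by apply: cvg0D => //; exact: cvg_invSn.
Qed.

Lemma ip_core U : inner_product_on (core U) dot1.
Proof.
split.
- exact: (ondC ip_dot1).
- by move=> a u v w [hu _] [hv _] [hw _]; exact: (ondP ip_dot1).
- by move=> u [hu _]; exact: (ond_ge0 ip_dot1).
- by move=> u [hu _]; exact: (ond_eq0 ip_dot1).
Qed.

Lemma complete_core U : hcomplete (sdot (HD := sm_core U) dot1).
Proof.
move=> un uc; have hc n := svP (un n).
have [u hu uu] := dom1_complete (fun n => core_dom1 (hc n)) uc.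
by exists (mksub (sm_core U) (core_closed hc hu uu)).
Qed.

(** This contains closability: a Cauchy sequence for the form norm converges in [dom1], and its
    limit there is u because both convergences imply convergence at every point. *)
Lemma form_approxP un u : l2 m setT u ->
  form_approx m b c un u <-> [/\ forall n, Cc setT (un n), dom1 u & hcvg dot1 un u].
Proof.
move=> hl; split=> [[hun uc u2]|[hun hu uu]].
  have hd n := Cc_dom1 (hun n).
  have uc' : hcauchy dot1 un.
    move=> e e0; have [N hN] := uc (e ^+ 2) (exprn_gt0 2 e0); exists N => i j hi hj.
    rewrite -ltr_sqr ?nnegrE ?nrm_ge0 ?(ltW e0) // (n1_sqr (dom1B (hd i) (hd j))).
    exact: hN.
  have [v hv uv] := dom1_complete hd uc'.
  suff -> : u = v by [].
  apply/funext => x.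
  have h1 : un n x @[n --> \oo] --> u x.
    apply/subr_cvg0; apply: (coord_cvg0 m_gt0 (un := fun n => un n - u)) => [n|]; last exact: u2.
    by apply: (l2B m_gt0) => //; apply: dom1_l2; exact: hd.
  by apply: (cvg_unique _ h1); [exact: norm_hausdorff | exact: dom1_coord_cvg].
split=> //.
  have hd n := Cc_dom1 (hun n).
  move=> e e0; have se : 0 < Num.sqrt e by rewrite sqrtr_gt0.
  have s2 : 0 < Num.sqrt e / 2 by rewrite divr_gt0.
  have [N hN] := (cvg0P _).1 uu _ s2.
  exists N => i j /hN hi /hN hj; rewrite !ger0_norm ?nrm_ge0 // in hi hj.
  rewrite -[l2norm m _]/(n2 _) -n1_sqr; last exact: dom1B.
  rewrite -[ltRHS](@sqr_sqrtr _ e) ?ltW // ltr_sqr ?nnegrE ?nrm_ge0 ?sqrtr_ge0 //.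
  have := n1D (dom1B (hd i) hu) (dom1B hu (hd j)); rewrite addrA subrK => h.
  by apply: le_lt_trans h _; rewrite (n1B hu (hd j)); lra.
apply: cvg0_le uu => n; rewrite ger0_norm; last exact: nrm_ge0.
by apply: n2_le_n1; apply: dom1B => //; exact: Cc_dom1 (hun n).
Qed.

Lemma form_domE u : form_dom m b c u <-> core setT u.
Proof.
split=> [[hl [un /(form_approxP _ hl)[hun hu uu]]]|hu]; first by split=> //; exists un.
split; first exact: core_l2 hu.
by have [hd [un [hun uu]]] := hu; exists un; apply/form_approxP; first exact: dom1_l2.
Qed.

Lemma formE u v : form_dom m b c u -> form_dom m b c v ->
  Defs.form m b c u v = form_comp b c u v.
Proof.
move=> /[dup] /form_domE cu [lu [un0 au0]] /[dup] /form_domE cv [lv [vn0 av0]].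
have cont un vn : form_approx m b c un u -> form_approx m b c vn v ->
    form_comp b c (un n) (vn n) @[n --> \oo] --> form_comp b c u v.
  move=> /(form_approxP _ lu)[hun hu uu] /(form_approxP _ lv)[hvn hv vv].
  have hdu n := Cc_dom1 (hun n); have hdv n := Cc_dom1 (hvn n).
  have lim2 (W : set (X -> R)) (HW : submodule_set W) dot (Hd : inner_product_on W dot) :
      (forall n, W (un n)) -> (forall n, W (vn n)) -> W u -> W v ->
      hcvg dot un u -> hcvg dot vn v -> dot (un n) (vn n) @[n --> \oo] --> dot u v.
    move=> wun wvn wu wv cu' cv'; have Hi := inner_product_sdot HW Hd.
    apply/subr_cvg0.
    apply: (@cvg0_le _ _ (fun n => nrm dot (un n - u) * nrm dot (vn n) +
       nrm dot u * nrm dot (vn n - v))).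
      move=> n; pose U1 := mksub HW (wun n); pose V1 := mksub HW (wvn n).
      pose U0 := mksub HW wu; pose V0 := mksub HW wv.
      have -> : dot (un n) (vn n) - dot u v =
         sdot dot (U1 - U0) V1 + sdot dot U0 (V1 - V0).
        by rewrite (dotBl Hi) (dotBr Hi) addrA subrK.
      apply: le_trans (ler_normD _ _) _; apply: lerD.
        exact: (dot_CS Hi (U1 - U0) V1).
      exact: (dot_CS Hi U0 (V1 - V0)).
    apply: cvg0D; last exact: cvg0M.
    rewrite -[X in _ --> X](mul0r (nrm dot v)); apply: cvgM => //.
    exact: (hcvg_nrm Hi (un := fun n => mksub HW (wvn n)) (u := mksub HW wv)).
  have h1 := lim2 _ sm_dom1 _ ip_dot1 hdu hdv hu hv uu vv.
  have hcv2 wn w : (forall n, dom1 (wn n)) -> dom1 w -> hcvg dot1 wn w -> hcvg (l2dot m) wn w.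
    move=> hw1 hw2; apply: cvg0_le => n; rewrite ger0_norm ?nrm_ge0 //.
    by apply: n2_le_n1; exact: dom1B.
  have h2 := lim2 _ (sm_l2 m_gt0) _ (ip_l2 m_gt0) (fun n => dom1_l2 (hdu n))
    (fun n => dom1_l2 (hdv n)) lu lv (hcv2 _ _ hdu hu uu) (hcv2 _ _ hdv hv vv).
  have fE f g : form_comp b c f g = dot1 f g - l2dot m f g by rewrite /dot1 addrK.
  by rewrite fE; under eq_fun do rewrite fE; exact: cvgB.
rewrite /Defs.form; case: xgetP => [l _ hl|h].
  apply: (cvg_unique _ (hl _ _ au0 av0)); first exact: norm_hausdorff.
  exact: cont.
by have := h (form_comp b c u v) cont.
Qed.

Lemma form_normE u : form_dom m b c u -> form_norm m b c u = n1 u.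
Proof.
move=> hu; have /form_domE/core_dom1 hd := hu.
by rewrite /form_norm formE // -[l2norm m u]/(n2 u) -n1_sqr // sqrtr_sqr ger0_norm ?nrm_ge0.
Qed.

Lemma form_dom_onE U u : form_dom_on m b c U u <-> core U u.
Proof.
have sub (un : nat -> X -> R) : (forall n, Cc U (un n)) -> form_dom m b c u ->
    (fun n => form_norm m b c (un n - u)) = (fun n => n1 (un n - u)).
  move=> hun /form_domE hu; apply/funext => n; apply: form_normE; apply/form_domE.
  by apply: (smB (sm_core setT)) => //; exact: coreS (Cc_core (hun n)).
split=> [[hu [un [hun uu]]]|hu].
  have /form_domE/core_dom1 hd := hu.
  by split=> //; exists un; split=> //; rewrite /hcvg -(sub un hun hu).
have hf : form_dom m b c u by apply/form_domE; exact: coreS hu.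
split=> //; have [hd [un [hun uu]]] := hu; exists un; split=> //.
by rewrite (sub un hun hf).
Qed.

End DirichletForm.

(** * The resolvents (1 + L_U)^-1 on l^2(X, m) *)

Section Resolvent.
Context {R : realType} {X : countType} {m : X -> R} {b : X -> X -> R} {c : X -> R}.
Context (m_gt0 : forall x, 0 < m x) (bc : is_graph b c).
Implicit Types (u v f g : X -> R) (U : set X) (e C a l : R).

Local Notation core := (core (m := m) (b := b) (c := c)).
Local Notation dot1 := (dot1 (m := m) (b := b) (c := c)).
Local Notation n1 := (nrm dot1).
Local Notation n2 := (nrm (l2dot m)).
Local Notation H2 := (H2 m_gt0).
Local Notation d2 := (@d2 _ _ _ m_gt0).

(** The weak form of (1 + L_U) u = 1_U f. *)
Definition is_resolvent U f u : Prop :=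
  core U u /\ forall v, core U v -> dot1 u v = l2dot m f v.

Lemma resolvent_uniq U f u v : is_resolvent U f u -> is_resolvent U f v -> u = v.
Proof.
move=> [hu uE] [hv vE]; apply/eqP; rewrite -subr_eq0; apply/eqP.
have hw : core U (u - v) by exact: (smB (sm_core m_gt0 bc U)).
apply: (ond_eq0 (ip_core m_gt0 bc U) hw).
by rewrite (ondBl (ip_core m_gt0 bc U)) // uE // vE // subrr.
Qed.

Lemma resolvent_exists U f : l2 m setT f -> exists u, is_resolvent U f u.
Proof.
move=> hf; pose V := sub_lmod (sm_core m_gt0 bc U).
have Fl a (u v : V) : l2dot m f (sv (a *: u + v)) = a * l2dot m f (sv u) + l2dot m f (sv v).
  apply: (ondPr (ip_l2 m_gt0)) => //; apply: (core_l2T m_gt0 (U := U)); exact: svP.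
have Fb (v : V) : `|l2dot m f (sv v)| <= n2 f * nrm (sdot dot1) v.
  apply: le_trans (ond_CS (sm_l2 m_gt0) (ip_l2 m_gt0) hf (core_l2T m_gt0 (svP v))) _.
  rewrite ler_wpM2l ?nrm_ge0 //; exact: (n2_le_n1 m_gt0 bc (core_dom1 (svP v))).
have [u hu] := riesz (inner_product_sdot (sm_core m_gt0 bc U) (ip_core m_gt0 bc U))
  (@complete_core _ _ _ _ _ m_gt0 bc U) Fl Fb.
exists (sv u); split; first exact: svP.
by move=> v hv; exact: (hu (mksub _ hv)).
Qed.

Definition resolvent U f : X -> R := xget (0 : X -> R) [set u | is_resolvent U f u].

Lemma resolventP U f : l2 m setT f -> is_resolvent U f (resolvent U f).
Proof.
move=> /(resolvent_exists U)[u hu]; rewrite /resolvent.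
by case: xgetP => [//|/(_ u) /(_ hu)].
Qed.

Lemma form_coreE U u v : core U u -> core U v ->
  Defs.form m b c u v = form_comp b c u v.
Proof.
by move=> hu hv; apply: (formE m_gt0 bc); apply/(form_domE m_gt0 bc);
  [exact: coreS hu | exact: coreS hv].
Qed.

Lemma laplacian_onE U u f : laplacian_on m b c U (u, f) <->
  [/\ l2 m U f, l2 m U u & u = resolvent U (f + u)].
Proof.
have dotD v : l2 m U f -> l2 m U u -> core U v ->
    l2dot m (f + u) v = l2dot m f v + l2dot m u v.
  move=> hf hu hv; rewrite -[f in LHS]scale1r (ondP (ip_l2 m_gt0)) ?mul1r //.
  - exact: (l2_T m_gt0 hf).
  - exact: (l2_T m_gt0 hu).
  - exact: (core_l2T m_gt0 hv).
have lfu : l2 m U f -> l2 m U u -> l2 m setT (f + u).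
  by move=> /(l2_T m_gt0) hf /(l2_T m_gt0) hu; exact: (smD (sm_l2 m_gt0)).
split=> [[/= /(form_dom_onE m_gt0 bc) hu hf uE]|[hf hu uE]].
  have lu := core_l2 m_gt0 bc hu; split=> //.
  apply: (resolvent_uniq (U := U) (f := f + u)); last exact: (resolventP U (lfu hf lu)).
  split=> // v hv; rewrite dotD // /dot1 -(form_coreE hu hv) uE //.
  exact/(form_dom_onE m_gt0 bc).
have [hu1 hu2] := resolventP U (lfu hf hu); rewrite -uE in hu1 hu2.
split=> /=; [exact/(form_dom_onE m_gt0 bc) | by [] |].
move=> v /(form_dom_onE m_gt0 bc) hv; rewrite (form_coreE hu1 hv).
by have := hu2 v hv; rewrite dotD // => /addIr.
Qed.

Lemma laplacianE : laplacian m b c = laplacian_on m b c setT.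
Proof.
rewrite /laplacian /laplacian_on; congr (form_operator _ _ _ _).
by apply/seteqP; split=> u /=; rewrite (form_domE m_gt0 bc) (form_dom_onE m_gt0 bc).
Qed.

Definition resop U (f : H2) : H2 := pack (sm_l2 m_gt0) (resolvent U (sv f)).
Definition restr U (f : H2) : H2 := pack (sm_l2 m_gt0) (\1_U \* sv f).

Lemma resopE U (f : H2) : sv (resop U f) = resolvent U (sv f).
Proof.
rewrite packE //; apply: (core_l2T m_gt0 (U := U) (b := b) (c := c)).
by have [] := resolventP U (svP f).
Qed.

Lemma l2_restr U f : l2 m setT f -> l2 m U (\1_U \* f).
Proof.
move=> /(l2TE m_gt0) hf; apply/(l2E m_gt0); split; last first.
  by move=> x hx; rewrite /= indicE memNset // mul0r.
apply: asum_le' hf => x /=; rewrite indicE; case: (x \in U); rewrite ?mul1r //.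
by rewrite mul0r expr0n mulr0 normr0.
Qed.

Lemma restrE U (f : H2) : sv (restr U f) = \1_U \* sv f.
Proof. by rewrite packE //; apply: (l2_T m_gt0 (U := U)); apply: l2_restr; exact: svP. Qed.

Opaque resop restr.

Lemma restr_id U (f : H2) : (restr U f = f) <-> (forall x, ~ U x -> sv f x = 0).
Proof.
split=> [<- x hx|h]; first by rewrite restrE /= indicE memNset // mul0r.
apply: sv_inj; rewrite restrE; apply/funext => x; rewrite /= indicE.
by case: (pselect (U x)) => hx; [rewrite mem_set // mul1r | rewrite memNset // mul0r h].
Qed.

Lemma restr_l2 U (f : H2) : (restr U f = f) <-> l2 m U (sv f).
Proof.
rewrite restr_id; split=> [h|/(l2E m_gt0)[]//].
by apply/(l2E m_gt0); split=> //; apply/(l2TE m_gt0); exact: svP.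
Qed.

Lemma l2dot_restr U f v : l2 m U v -> l2dot m (\1_U \* f) v = l2dot m f v.
Proof.
move=> /(l2E m_gt0)[_ hv]; congr rsum; apply/funext => x /=; rewrite indicE.
by case: (pselect (U x)) => hx; [rewrite mem_set // mul1r | rewrite hv // !mulr0].
Qed.

(** <S f, g> is the form inner product of S f and S g, which gives symmetry and positivity; for f =
    g, the Cauchy-Schwarz inequality bounds the form norm of S f by |f|. *)
Lemma resop_contraction U : pos_contraction d2 (resop U).
Proof.
have rP (f : H2) := resolventP U (svP f).
have dE (f : H2) : d2 (resop U f) f = dot1 (resolvent U (sv f)) (resolvent U (sv f)).
  have [h1 h2] := rP f; rewrite h2 // /d2 /sdot resopE.
  exact: (ondC (ip_l2 m_gt0)).
have d0 (f : H2) : 0 <= d2 (resop U f) f.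
  by rewrite dE; have [h _] := rP f; exact: (ond_ge0 (ip_core m_gt0 bc U)).
split=> //.
- move=> a u v; apply: sv_inj; rewrite svD svZ !resopE.
  have [h1 h2] := rP u; have [k1 k2] := rP v.
  apply: (resolvent_uniq (U := U) (f := sv (a *: u + v))); first exact: rP.
  split; first exact: (smP (sm_core m_gt0 bc U)).
  move=> w hw; rewrite (ondP (ip_core m_gt0 bc U)) // h2 // k2 //.
  rewrite svD svZ (ondP (ip_l2 m_gt0)) //; try exact: svP.
  exact: (core_l2T m_gt0 hw).
- move=> u v; rewrite /d2 /sdot !resopE.
  have [h1 h2] := rP u; have [k1 k2] := rP v.
  rewrite -(h2 _ k1) (ondC (ip_core m_gt0 bc U)) (k2 _ h1).
  exact: (ondC (ip_l2 m_gt0)).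
move=> f; have [h1 h2] := rP f.
have e1 : d2 (resop U f) f = n1 (resolvent U (sv f)) ^+ 2.
  by rewrite dE (ond_nrm_sqr (sm_core m_gt0 bc U) (ip_core m_gt0 bc U)).
have e2 : d2 f f = n2 (sv f) ^+ 2.
  by rewrite (ond_nrm_sqr (sm_l2 m_gt0) (ip_l2 m_gt0) (svP f)).
have e3 : n1 (resolvent U (sv f)) ^+ 2 <= n2 (sv f) * n1 (resolvent U (sv f)).
  rewrite -e1 /d2 /sdot resopE; apply: le_trans (ler_norm _) _.
  apply: le_trans (ond_CS (sm_l2 m_gt0) (ip_l2 m_gt0) (core_l2T m_gt0 h1) (svP f)) _.
  rewrite mulrC ler_wpM2l ?nrm_ge0 //; exact: (n2_le_n1 m_gt0 bc (core_dom1 h1)).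
rewrite e1 e2; have := nrm_ge0 dot1 (resolvent U (sv f)); have := nrm_ge0 (l2dot m) (sv f).
move: e3; move: (nrm dot1 _) (nrm (l2dot m) _) => x y; nra.
Qed.

Lemma resop_compatible U : compatible d2 (restr U) (resop U).
Proof.
split.
- move=> a u v; apply: sv_inj; rewrite svD svZ !restrE svD svZ.
  by apply/funext => x; rewrite !fctE /= /GRing.scale /=; ring.
- move=> f; rewrite -ler_sqr ?nnegrE ?nrm_ge0 // !(nrm_sqr (ip_d2 m_gt0)).
  have /(l2TE m_gt0) hf := svP f.
  have hr := l2_T m_gt0 (l2_restr U (svP f)).
  rewrite /d2 /sdot restrE.
  apply/(wdot_leP (fun x => ltW (m_gt0 x)) _ (proj1 (l2TE m_gt0 _) hr)) => F.
  apply: le_trans (proj1 (wdot_leP (fun x => ltW (m_gt0 x)) (l2dot m (sv f) (sv f)) hf) (lexx _) F).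
  apply: ler_sum => x _; rewrite ler_wpM2l ?(ltW (m_gt0 x)) //= indicE.
  by case: (x \in U); rewrite ?mul1r // mul0r expr0n sqr_ge0.
- move=> f; apply/restr_l2; rewrite resopE.
  by have [h _] := resolventP U (svP f); exact: (core_l2 m_gt0 bc).
- move=> f; apply: sv_inj; rewrite (resopE U f) (resopE U (restr U f)).
  apply: (resolvent_uniq (U := U) (f := sv (restr U f))).
    by apply: resolventP; exact: svP.
  have [h1 h2] := resolventP U (svP f); split=> // v hv.
  by rewrite h2 // restrE l2dot_restr //; exact: (core_l2 m_gt0 bc).
- by move=> f; apply/restr_l2; rewrite restrE; apply: l2_restr; exact: svP.
Qed.

Lemma opgraph_laplacian U (u f : H2) :
  opgraph (restr U) (resop U) (u, f) <-> laplacian_on m b c U (sv u, sv f).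
Proof.
split=> [[/= /restr_l2 hf uE]|/laplacian_onE[hf hu uE]].
  apply/laplacian_onE; split=> //; last by rewrite -svD -resopE -uE.
  apply/restr_l2; rewrite uE; exact: (cp_PS (resop_compatible U)).
split=> /=; first exact/restr_l2.
by apply: sv_inj; rewrite resopE svD.
Qed.

Lemma res_setE U : resolvent_set m U (laplacian_on m b c U) =
  res_set d2 (restr U) (resop U).
Proof.
have scE l (u : H2) : sv (l *: u) = l \*o sv u by [].
apply/seteqP; split=> l [h1 [C hC]]; split.
- move=> f /restr_l2 hf; have [u [hu uu]] := h1 _ hf.
  have [_ lu _] := (laplacian_onE U _ _).1 hu.
  have tu := l2_T m_gt0 lu.
  exists (pack (sm_l2 m_gt0) u); split.
    by apply/opgraph_laplacian; rewrite svD scE packE.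
  move=> v /opgraph_laplacian; rewrite svD scE => /uu ->; exact: svK.
- by exists C => u f /opgraph_laplacian /hC; rewrite -scE.
- move=> f hf; have tf := l2_T m_gt0 hf.
  have [|u [hu uu]] := h1 (pack (sm_l2 m_gt0) f).
    by apply/restr_l2; rewrite packE.
  exists (sv u); split.
    by move/opgraph_laplacian: hu; rewrite svD scE packE.
  move=> v hv; have [_ lv _] := (laplacian_onE U _ _).1 hv.
  have tv := l2_T m_gt0 lv.
  rewrite (uu (pack (sm_l2 m_gt0) v)) ?packE //.
  by apply/opgraph_laplacian; rewrite svD scE !packE.
exists C => u f /[dup] /laplacian_onE[lf lu _].
have tf := l2_T m_gt0 lf; have tu := l2_T m_gt0 lu.
rewrite -{1}(packE (sm_l2 m_gt0) tu) -{1}(packE (sm_l2 m_gt0) tf) => /opgraph_laplacian /hC.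
by rewrite !nrm_sdot svD svN scE !packE.
Qed.

Lemma eigenE U l : Defs.eigenvalue (laplacian_on m b c U) l <-> eigen (restr U) (resop U) l.
Proof.
split=> [[u u0 hu]|[u u0 /opgraph_laplacian hu]].
  have [_ lu _] := (laplacian_onE U _ _).1 hu; have tu := l2_T m_gt0 lu.
  exists (pack (sm_l2 m_gt0) u).
    apply: contraNneq u0 => p0; apply/eqP.
    by have := packE (sm_l2 m_gt0) tu; rewrite p0 => <-.
  by apply/opgraph_laplacian; rewrite svZ packE.
exists (sv u) => //; apply: contraNneq u0 => s0.
by apply/eqP; apply: sv_inj; rewrite s0.
Qed.

End Resolvent.

(** * Bases of finite-dimensional subspaces *)

Section FiniteSpan.
Context {R : realType} {W : lmodType R}.
Implicit Types (s : seq W) (u v : W).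

(** Membership in the span by recursion, so that generators can be eliminated one at a time. *)
Fixpoint inspan s u : Prop :=
  if s is e :: s' then exists a : R, inspan s' (u - a *: e) else u = 0.

Lemma inspan_sum (I : Type) (r : seq I) (e : I -> W) (a : I -> R) :
  inspan [seq e i | i <- r] (\sum_(i <- r) a i *: e i).
Proof.
elim: r => [|i r IH] /=; first by rewrite big_nil.
by exists (a i); rewrite big_cons addrC addKr.
Qed.

Lemma inspanP s u : inspan s u ->
  exists a : 'I_(size s) -> R, u = \sum_(i < size s) a i *: tnth (in_tuple s) i.
Proof.
suff key : inspan s u -> exists a : nat -> R, u = \sum_(i < size s) a i *: s`_i.
  move=> /key[a ->]; exists (fun i => a i); apply: eq_bigr => i _.
  by rewrite (tnth_nth 0).
elim: s u => [|e s IH] u /=; first by move=> ->; exists (fun=> 0); rewrite big_ord0.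
move=> [x /IH[a ha]]; exists (fun n => if n is n'.+1 then a n' else x).
by rewrite big_ord_recl /= -ha addrC subrK.
Qed.

Lemma inspan_comb s a u v : inspan s u -> inspan s v -> inspan s (a *: u + v).
Proof.
elim: s u v => [|e s IH] u v /=; first by move=> -> ->; rewrite scaler0 addr0.
move=> [x hx] [y hy]; exists (a * x + y).
rewrite (_ : _ - _ = a *: (u - x *: e) + (v - y *: e)); first exact: IH.
by rewrite scalerBr scalerA scalerDl opprD addrACA.
Qed.

Lemma inspan0 s : inspan s 0.
Proof. by elim: s => [//|e s IH] /=; exists 0; rewrite scale0r subr0. Qed.

(** The induction hypothesis is applied to the vectors of K in the span of the tail of s. If K is
    larger, some k0 in K has a nonzero coefficient x at the first generator, and subtracting a
    multiple of k0 brings any u in K into that span. *)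
Lemma subspace_basis s (K : set W) : (forall a u v, K u -> K v -> K (a *: u + v)) -> K 0 ->
  (forall u, K u -> inspan s u) ->
  exists t, {in t, forall v, K v} /\ forall u, K u -> inspan t u.
Proof.
elim: s K => [|e s IH] K KP K0 Ks; first by exists [::].
pose K' : set W := [set u | K u /\ inspan s u].
have [||u []//|t [tK ht]] := IH K'.
- by move=> a u v [h1 h2] [k1 k2]; split; [exact: KP | exact: inspan_comb].
- by split=> //; exact: inspan0.
have [[k0 [Kk0 nk0]]|hn] := pselect (exists k0, K k0 /\ ~ inspan s k0); last first.
  exists t; split=> [v /tK[]//|u Ku]; apply: ht; split=> //.
  by apply: contrapT => nu; apply: hn; exists u.
exists (k0 :: t); split=> [v|u Ku].
  by rewrite inE => /orP[/eqP ->//|/tK[]].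
have [x hx] := Ks _ Kk0; have [y hy] := Ks _ Ku.
have x0 : x != 0.
  by apply/eqP => x0; apply: nk0; move: hx; rewrite x0 scale0r subr0.
exists (y / x); apply: ht; split.
  by rewrite addrC -scaleNr; exact: KP.
rewrite (_ : _ - _ = (- (y / x)) *: (k0 - x *: e) + (u - y *: e)); first exact: inspan_comb.
rewrite scalerBr scalerA scaleNr mulNr mulfVK // scaleNr opprK addrCA.
by rewrite addrC -addrA addrA addrK addrC.
Qed.

End FiniteSpan.

(** * Compactness and spectra for the graph Laplacian *)

Section GraphLaplacian.
Context {R : realType} {X : countType} {m : X -> R} {b : X -> X -> R} {c : X -> R}.
Context (m_gt0 : forall x, 0 < m x) (bc : is_graph b c).
Implicit Types (f g : X -> R) (U : set X) (F K : {fset X}) (e C a l : R).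

Local Notation core := (core (m := m) (b := b) (c := c)).
Local Notation dot1 := (dot1 (m := m) (b := b) (c := c)).
Local Notation n1 := (nrm dot1).
Local Notation H2 := (H2 m_gt0).
Local Notation d2 := (@d2 _ _ _ m_gt0).
Local Notation pk := (pack (sm_l2 m_gt0)).
Local Notation S U := (@resop _ _ m b c m_gt0 U).
Local Notation P U := (@restr _ _ m m_gt0 U).
Local Notation L U := (laplacian_on m b c U).
Local Notation Hip := (ip_d2 m_gt0).
Local Notation Hc := (@complete_d2 _ _ _ m_gt0).
Local Notation wsc := (@wsc_d2 _ _ _ m_gt0).
Local Notation HS U := (resop_contraction m_gt0 bc U).
Local Notation HP U := (resop_compatible m_gt0 bc U).
Local Notation sm1 := (sm_dom1 m_gt0 bc).
Local Notation ip1 := (ip_dot1 m_gt0 bc).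

Lemma sv_sum I (r : seq I) (F : I -> H2) :
  sv (\sum_(i <- r) F i) = \sum_(i <- r) sv (F i).
Proof. by elim: r => [|i r IH]; rewrite ?big_nil // !big_cons svD IH. Qed.

Lemma pkP a f g : l2 m setT f -> l2 m setT g -> pk (a *: f + g) = a *: pk f + pk g.
Proof.
move=> hf hg; apply: sv_inj; rewrite packE; last exact: (smP (sm_l2 m_gt0)).
by rewrite svD svZ !packE.
Qed.

(* The functions spanning the eigenspace in finite_multiplicity need not be in
   l^2(X, m), so a basis inside of the eigenspace has to be extracted. *)
Lemma finmultE U l : finite_multiplicity (L U) l <-> finmult (P U) (S U) l.
Proof.
pose K : set (X -> R) := [set sv v | v in [set v : H2 | opgraph (P U) (S U) (v, l *: v)]].
have KE u : L U (u, l \*o u) <-> K u.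
  split=> [hu|[v hv <-]]; last by have /(opgraph_laplacian bc) := hv; rewrite svZ.
  have [_ lu _] := (laplacian_onE m_gt0 bc U _ _).1 hu.
  have tu := l2_T m_gt0 lu; exists (pk u); last by rewrite packE.
  by apply/(opgraph_laplacian bc); rewrite svZ packE.
have KP a u v : K u -> K v -> K (a *: u + v).
  move=> [u' hu <-] [v' hv <-]; exists (a *: u' + v'); last by rewrite svD svZ.
  have := opg_comb (HS U) (HP U) a hu hv; rewrite /= scalerDr !scalerA (mulrC l).
  by [].
have K0 : K 0.
  exists 0 => //; split; rewrite /= scaler0 ?(lin0 (cp_lin (HP U))) // addr0.
  by rewrite (lin0 (pc_lin (HS U))).
split=> [[n [e he]]|[n [e he]]].
  have Ks u : K u -> inspan [seq e i | i <- index_enum 'I_n] u.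
    by move=> /KE/he[a ->]; exact: inspan_sum.
  have [t [tK ht]] := subspace_basis KP K0 Ks.
  exists (size t), (fun i => pk (tnth (in_tuple t) i)) => u hu.
  have [|a ha] := inspanP (ht (sv u) _); first by exists u.
  exists a; apply: sv_inj; rewrite ha sv_sum; apply: eq_bigr => i _.
  rewrite svZ packE //; have [v _ <-] := tK _ (mem_tnth i (in_tuple t)).
  exact: svP.
exists n, (fun i => sv (e i)) => u /KE[v hv <-].
by have [a {1}->] := he v hv; exists a; rewrite sv_sum; apply: eq_bigr.
Qed.

Lemma ess_spectrumE U : ess_spectrum m U (L U) = ess_set d2 (P U) (S U).
Proof.
rewrite /ess_spectrum /spectrum /ess_set (res_setE m_gt0 bc).
congr (_ `\` _); apply/seteqP; split=> l [h1 h2 h3]; split=> //.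
- exact/(eigenE m_gt0 bc).
- exact/finmultE.
- exact/(eigenE m_gt0 bc).
- exact/finmultE.
Qed.

Lemma l2norm_pk f : l2 m setT f -> nrm d2 (pk f) = l2norm m f.
Proof. by move=> hf; rewrite nrm_sdot packE. Qed.

Lemma pk_restr U f : l2 m U f -> P U (pk f) = pk f.
Proof.
by move=> hf; apply/restr_l2; rewrite packE //; exact: (l2_T m_gt0 hf).
Qed.

Lemma fcalc_l2 U phi (v : H2) : C0 phi -> l2 m U (sv (fcalc d2 (S U) phi v)).
Proof.
move=> hp; apply/restr_l2; apply: (fc_range Hip Hc (HS U)) => //.
- exact: (cp_lin (HP U)).
- exact: (cp_PS (HP U)).
- exact: (cp_nrm (HP U)).
Qed.

Definition fcalc_on U (phi : R -> R) f : X -> R := sv (fcalc d2 (S U) phi (pk f)).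

Lemma fcalc_onP U : is_functional_calculus m U (L U) (fcalc_on U).
Proof.
split.
- move=> phi hp; have fl := fc_lin Hip Hc (HS U) hp; split; first split.
  + by move=> f hf; exact: fcalc_l2.
  + move=> a f g hf hg; rewrite /fcalc_on (pkP a (l2_T m_gt0 hf) (l2_T m_gt0 hg)) fl.
    by rewrite svD svZ.
  + have [C C0 hC] := fc_bounded Hip Hc (HS U) hp; exists C => f hf.
    by have := hC (pk f); rewrite (l2norm_pk (l2_T m_gt0 hf)).
  move=> f g hf hg.
  have := fc_sym Hip Hc (HS U) hp (pk f) (pk g).
  by rewrite /d2 /sdot (packE _ (l2_T m_gt0 hf)) (packE _ (l2_T m_gt0 hg)).
- move=> a phi psi f hp hq hf; rewrite /fcalc_on (fc_comb Hip Hc (HS U)) //.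
- by move=> phi psi f hp hq hf; rewrite /fcalc_on svK (fc_mul Hip Hc (HS U)).
- move=> phi C f hp hC hf; have := fc_le Hip Hc (HS U) (pk f) hp (fun x _ => hC x).
  by rewrite (l2norm_pk (l2_T m_gt0 hf)).
move=> a phi f a0 hp hphi hf; pose u := fcalc d2 (S U) phi (pk f).
have -> : f - a \*o fcalc_on U phi f = sv (pk f - a *: u).
  by rewrite svD svN svZ (packE _ (l2_T m_gt0 hf)).
apply/(opgraph_laplacian bc); split=> /=.
  rewrite (linB (cp_lin (HP U))) (linZ (cp_lin (HP U))) pk_restr //; congr (_ - _ *: _).
  by apply/restr_l2; exact: fcalc_l2.
(* The resolvent at a is expressed through S: for phi(x) = (x + a)^-1 one has phi = (1 + x)^-1 (1 +
   (1 - a) phi). *)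
have -> : pk f - a *: u + u = (1 - a) *: u + pk f.
  by rewrite scalerBl scale1r addrC addrCA addrC addrAC.
rewrite (pc_lin (HS U)).
have r1 (g : H2) : S U g = fcalc d2 (S U) res1 g.
  rewrite (fc_res1 Hip Hc (HS U)) //; first exact: C0_res1.
  by move=> x x0; rewrite /res1 ger0_norm.
rewrite !r1 /u -(fc_mul Hip Hc (HS U)) //; last exact: C0_res1.
rewrite -(fc_comb Hip Hc (HS U)); last 2 first.
- by apply: C0_mul => //; exact: C0_res1.
- exact: C0_res1.
apply: (fc_eq Hip Hc (HS U)) => //.
  by apply: C0_lin; [apply: C0_mul => //; exact: C0_res1 | exact: C0_res1].
move=> x x0; rewrite !fctE /= /res1 (ger0_norm x0) hphi //; field.
by apply/andP; split; rewrite gt_eqF //; lra.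
Qed.

(** Phi is constrained on l^2(U, m) only. Precomposing it with 1_U gives operators on the whole
    space to which [fc_unique] applies; the resolvent axiom is used at a = 1. *)
Lemma functional_calculus_unique U Phi phi f : is_functional_calculus m U (L U) Phi ->
  C0 phi -> l2 m U f -> Phi phi f = fcalc_on U phi f.
Proof.
move=> [PB PL PM PC PR] hp hf.
pose Psi psi (v : H2) := pk (Phi psi (\1_U \* sv v)).
have lr (v : H2) : l2 m U (\1_U \* sv v) by apply: (l2_restr m_gt0); exact: svP.
have lP psi (v : H2) : C0 psi -> l2 m U (Phi psi (\1_U \* sv v)).
  by move=> /PB[[h _ _] _]; exact: h.
have idU g : l2 m U g -> \1_U \* g = g.
  move=> hg; have := pk_restr hg => /(congr1 (@sv _ _ _ _)).
  by rewrite restrE !packE //; exact: (l2_T m_gt0 hg).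
have key : Psi phi (pk f) = fcalc d2 (S U) phi (pk f).
  apply: (fc_unique Hip Hc (HS U)) => //.
  - move=> a p1 p2 v h1 h2; rewrite /Psi PL //; exact: (pkP a (l2_T m_gt0 (lP _ v h1)) (l2_T m_gt0 (lP _ v h2))).
  - move=> p1 p2 v h1 h2; rewrite /Psi PM // packE; last exact: (l2_T m_gt0 (lP _ _ h2)).
    by rewrite (idU _ (lP _ v h2)).
  - move=> p1 C v h1 hC; rewrite /Psi l2norm_pk; last exact: (l2_T m_gt0 (lP _ _ h1)).
    apply: le_trans (PC _ _ _ h1 hC (lr v)) _.
    have C0 : 0 <= C by apply: le_trans (hC 0).
    apply: ler_wpM2l => //; have := cp_nrm (HP U) v.
    by rewrite nrm_sdot restrE.
  - move=> p1 v h1 h2; have := PR 1 p1 _ ltr01 h1 h2 (lr v).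
    move=> /(laplacian_onE m_gt0 bc)[_ _ e1]; rewrite /Psi e1.
    have -> : \1_U \* sv v - 1 \*o Phi p1 (\1_U \* sv v) + Phi p1 (\1_U \* sv v) =
        sv (P U v).
      by rewrite restrE; apply/funext => x; rewrite !fctE /= mul1r subrK.
    by rewrite -(resopE bc) svK (cp_SP (HP U)).
rewrite /fcalc_on -key /Psi packE; last exact: (l2_T m_gt0 (lP _ _ hp)).
by rewrite packE ?idU //; exact: (l2_T m_gt0 hf).
Qed.

Lemma functional_calculusE U phi f : C0 phi -> l2 m U f ->
  functional_calculus m U (L U) phi f = fcalc_on U phi f.
Proof.
move=> hp hf; rewrite /functional_calculus; case: xgetP => [Phi _ hPhi|].
  exact: functional_calculus_unique.
by move=> /(_ (fcalc_on U)); have := fcalc_onP U.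
Qed.

(** A bounded sequence has a subsequence for which u_n - z is weakly null; B maps these differences
    to a null sequence, so B z is the limit. *)
Lemma compact_of_cc (A : (X -> R) -> X -> R) (B : H2 -> H2) C : lin B ->
  (forall v : H2, nrm d2 (B v) <= C * nrm d2 v) -> cc d2 B ->
  (forall f, l2 m setT f -> A f = sv (B (pk f))) -> compact_op m A.
Proof.
move=> Bl Bb Bcc AB; split; first split.
- by move=> f hf; rewrite AB //; exact: svP.
- move=> a f g hf hg; rewrite !AB //; last exact: (smP (sm_l2 m_gt0) a hf hg).
  by rewrite (pkP a hf hg) Bl svD svZ.
- by exists C => f hf; rewrite AB //; have := Bb (pk f); rewrite (l2norm_pk hf).
move=> un hun [D hD].
have [|k [hk [z hz]]] := @wsc_d2 _ _ _ m_gt0 (fun n => pk (un n)) D.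
  by move=> n; rewrite l2norm_pk.
exists k; split=> //; exists (sv (B z)); first exact: svP.
rewrite /l2cvg; have := Bcc _ hz; apply: cvg_trans; apply: near_eq_cvg.
by apply: nearW => n /=; rewrite (linB Bl) nrm_sdot svD svN -AB.
Qed.

(** Pairing with delta_x gives m(x) times the coordinate. *)
Lemma coord_wnull (w : nat -> H2) x : wnull d2 w ->
  sv (w n) x @[n --> \oo] --> (0 : R).
Proof.
move=> [_ hw].
have dl : l2 m setT (delta x) by exact: (dom1_l2 m_gt0 (dom1_delta bc x)).
have wE (v : H2) : d2 v (pk (delta x)) = m x * sv v x.
  rewrite /d2 /sdot packE // -[l2dot _ _ _]/(wdot m _ _).
  rewrite (@wdot_fsupp _ _ m _ _ [fset x]%fset).
    by rewrite big_seq_fset1 /delta eqxx mulr1.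
  by move=> y; rewrite inE /delta => /negPf ->.
have := cvg0M (m x)^-1 (hw (pk (delta x))).
by under eq_fun do rewrite wE mulKf ?gt_eqF //.
Qed.

Lemma n1_sum_delta (s : seq X) u :
  n1 (\sum_(x <- s) u x *: delta x) <= \sum_(x <- s) `|u x| * n1 (delta x).
Proof.
have z : n1 0 = 0 := nrm0 (inner_product_sdot sm1 ip1).
elim: s => [|x s IH]; first by rewrite !big_nil z.
rewrite !big_cons; have hx := dom1_delta (m := m) bc x.
rewrite -(n1Z m_gt0 bc _ hx).
apply: le_trans (n1D m_gt0 bc (smZ sm1 _ hx) (dom1_sum m_gt0 bc _ _)) _.
by rewrite lerD2l.
Qed.

Lemma cvg0_sum (s : seq X) (un : nat -> X -> R) (k : X -> R) :
  (forall x, x \in s -> un n x @[n --> \oo] --> (0 : R)) ->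
  \sum_(x <- s) `|un n x| * k x @[n --> \oo] --> (0 : R).
Proof.
elim: s => [|x s IH] h; first by under eq_fun do rewrite big_nil; exact: cvg_cst.
under eq_fun do rewrite big_cons.
apply: cvg0D; last by apply: IH => y ys; apply: h; rewrite inE ys orbT.
under eq_fun do rewrite mulrC; apply: cvg0M.
by rewrite -[X in _ --> X](normr0 R); apply: cvg_norm; exact: (h x (mem_head _ _)).
Qed.

(** Approximants in C_c(X) are corrected by their values on F. The correction is a finite
    combination of the delta_x with coefficients u_n(x) tending to u(x) = 0, hence tends to 0 in the
    form norm. *)
Lemma core_vanish F u : core setT u -> (forall x, x \in F -> u x = 0) ->
  core (~` [set` F]) u.
Proof.
move=> [hu [un [hun uu]]] uF; split=> //.
pose p (v : X -> R) := \sum_(x <- F) v x *: delta x.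
have pE (v : X -> R) y : p v y = if y \in F then v y else 0 by exact: sum_deltaE.
exists (fun n => un n - p (un n)); split=> [n|].
  split; last first.
    move=> x /contrapT /= xF; rewrite !fctE pE.
    by rewrite (xF : x \in F) subrr.
  have [h _] := hun n; apply: sub_finite_set h => x /=.
  by rewrite !fctE pE; case: ifP => // _; [rewrite subrr eqxx | rewrite subr0].
apply: (@cvg0_le _ _ (fun n => n1 (un n - u) + \sum_(x <- F) `|un n x| * n1 (delta x))).
  move=> n; rewrite ger0_norm ?nrm_ge0 // addrAC.
  have h1 := dom1B m_gt0 bc (Cc_dom1 m_gt0 bc (hun n)) hu.
  have h2 := dom1_sum m_gt0 bc F (un n).
  apply: le_trans (n1D m_gt0 bc h1 (smN sm1 h2)) _; rewrite lerD2l.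
  by rewrite -scaleN1r (n1Z m_gt0 bc) // normrN1 mul1r n1_sum_delta.
apply: cvg0D => //; apply: cvg0_sum => x xF.
have := dom1_coord_cvg m_gt0 bc (x := x) (fun n => Cc_dom1 m_gt0 bc (hun n)) hu uu.
by rewrite uF.
Qed.

Lemma cc_restr F : cc d2 (P [set` F]).
Proof.
move=> w hw.
apply: (@cvg0_le _ _ (fun n => \sum_(x <- F) `|sv (w n) x| * n1 (delta x))); last first.
  by apply: cvg0_sum => x _; exact: coord_wnull.
move=> n; rewrite ger0_norm ?nrm_ge0 // nrm_sdot restrE.
apply: le_trans (n1_sum_delta _ _).
rewrite (_ : _ \* _ = \sum_(x <- F) sv (w n) x *: delta x).
  exact: (n2_le_n1 m_gt0 bc (dom1_sum m_gt0 bc _ _)).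
apply/funext => x; rewrite sum_deltaE /= indicE.
case: ifPn => xF; first by rewrite mem_set // mul1r.
by rewrite memNset ?mul0r //; exact/negP.
Qed.

Lemma cc_resolvent_diff F : cc d2 (fun f : H2 => S (~` [set` F]) f - S setT f).
Proof.
set G := ~` [set` F]; move=> w hw.
apply: (@cvg0_le _ _ (fun n =>
  \sum_(x <- F) `|sv (S G (w n)) x - sv (S setT (w n)) x| * n1 (delta x))).
  move=> n; rewrite ger0_norm ?nrm_ge0 // nrm_sdot svD svN !(resopE bc).
  have [hG GE] := resolventP m_gt0 bc G (svP (w n)).
  have [hT TE] := resolventP m_gt0 bc setT (svP (w n)).
  set z := _ - _.
  have hz : core setT z.
    by apply: (smB (sm_core m_gt0 bc setT)) => //; exact: coreS hG.
  have zG v : core G v -> dot1 z v = 0.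
    move=> hv; rewrite (ondBl ip1 (core_dom1 hG) (core_dom1 hT) (core_dom1 hv)).
    by rewrite GE // TE ?subrr //; exact: coreS hv.
  pose q := \sum_(x <- F) z x *: delta x.
  have dz := core_dom1 hz; have dq := dom1_sum m_gt0 bc F z : dom1 q.
  have cq : core setT q.
    apply: Cc_core => //; split=> [|x []//].
    apply: sub_finite_set (finite_fset F) => x /=; rewrite /q sum_deltaE.
    by case: ifP => //; rewrite eqxx.
  have hzq : core G (z - q).
    apply: core_vanish => [|x xF]; last by rewrite !fctE /q sum_deltaE xF subrr.
    exact: (smB (sm_core m_gt0 bc setT)).
  (* In the form inner product z is orthogonal to z - q, whence |z|^2 = <q, z>. *)
  have zq : n1 z ^+ 2 <= n1 z * n1 q.
    rewrite (ond_nrm_sqr sm1 ip1 dz).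
    have -> : dot1 z z = dot1 q z.
      rewrite -{1}[z](subrK q) -[z - q]scale1r (ondP ip1) ?mul1r //; last exact: (core_dom1 hzq).
      by rewrite (ondC ip1) (zG _ hzq) add0r.
    rewrite mulrC; exact: le_trans (ler_norm _) (ond_CS sm1 ip1 dq dz).
  apply: le_trans (n2_le_n1 m_gt0 bc dz) _; apply: le_trans (n1_sum_delta _ _).
  rewrite -/q; have := nrm_ge0 dot1 z; have := nrm_ge0 dot1 q; move: zq.
  move: (n1 z) (n1 q) => x y; nra.
have bnd U (f : H2) : nrm d2 (S U f) <= 1 * nrm d2 f by rewrite mul1r; exact: (pc_nrm Hip (HS U)).
apply: cvg0_sum => x _; apply: cvg0B; apply: coord_wnull.
  exact: (wnull_op (pc_sym (HS G)) (bnd G) hw).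
exact: (wnull_op (pc_sym (HS setT)) (bnd setT) hw).
Qed.

(** This is where the lower bound d of m enters: each point of B contributes at least d to the
    squared norm of u. *)
Lemma finite_of_l2 d B u : 0 < d -> (forall x, d <= m x) -> l2 m setT u ->
  (forall x, B x -> 1 <= u x) -> finite_set B.
Proof.
move=> d0 hd /(l2TE m_gt0) hu uB; apply: contrapT => hB.
have hs := (wdot_leP (fun x => ltW (m_gt0 x)) (wdot m u u) hu).1 (lexx _).
have [F FB Fn] := infinite_set_fset (Num.truncn (wdot m u u / d)).+1 hB.
have : #|` F|%:R * d <= wdot m u u.
  apply: le_trans (hs F).
  have -> : #|` F|%:R * d = \sum_(x <- F) d.
    by rewrite big_const_seq count_predT iter_addr addr0 mulr_natl.
  rewrite big_seq [leRHS]big_seq; apply: ler_sum => x xF.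
  apply: le_trans (hd x) _; rewrite ler_peMr ?(ltW (m_gt0 x)) //.
  by rewrite exprn_ege1 // uB //; exact: FB.
rewrite -ler_pdivlMr // => h; have := truncnS_gt (wdot m u u / d).
by rewrite ltNge (le_trans _ h) // ler_nat.
Qed.

Lemma C0_expRNnorm : C0 (fun x : R => expR (- `|x|)).
Proof.
apply: (@C0_le _ res1 _ 1); last 2 first.
- exact: C0_res1.
- move=> x; rewrite mul1r (ger0_norm (expR_ge0 _)) (ger0_norm (ltW (res1_gt0 _))).
  rewrite expRN /res1 lef_pV2 ?posrE ?expR_gt0 ?ltr_pwDl //; exact: expR_ge1Dx.
move=> x; apply: (@continuous_comp _ _ _ (fun x : R => - `|x|) (@expR R)); last exact: continuous_expR.
apply: continuousN; exact: norm_continuous.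
Qed.

Lemma compact_restr_fcalc F phi : C0 phi ->
  compact_op m (fun f => \1_[set` F] \* functional_calculus m setT (laplacian m b c) phi f).
Proof.
move=> hp; have [C C0 hC] := fc_bounded Hip Hc (HS setT) hp.
have fl := fc_lin Hip Hc (HS setT) hp.
apply: (@compact_of_cc _ (fun v => P [set` F] (fcalc d2 (S setT) phi v)) C).
- by move=> a u v; rewrite fl (cp_lin (HP [set` F])).
- by move=> v; apply: le_trans (cp_nrm (HP [set` F]) _) (hC v).
- exact: (cc_compr (fc_sym Hip Hc (HS setT) hp) hC (cc_restr F)).
by move=> f hf; rewrite restrE (laplacianE m_gt0 bc) functional_calculusE.
Qed.

Lemma cc_fcalc_finite F phi : C0 phi -> cc d2 (fun f : H2 =>
  fcalc d2 (S (~` [set` F])) phi f - fcalc d2 (S setT) phi f).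
Proof.
move=> hp; apply: (cc_fcalc_diff Hip Hc (HS _) (HS setT) _ hp).
exact: (cc_resolvent_diff F).
Qed.

Lemma compact_fcalc_diff F phi : C0 phi ->
  compact_op m (fun f =>
    extend0 (~` [set` F]) (functional_calculus m (~` [set` F]) (L (~` [set` F])) phi) f
    - functional_calculus m setT (laplacian m b c) phi f).
Proof.
set G := ~` _ => hp.
have [C C0 hC] := fc_bounded Hip Hc (HS setT) hp.
have [D D0 hD] := fc_bounded Hip Hc (HS G) hp.
have fl := fc_lin Hip Hc (HS setT) hp; have gl := fc_lin Hip Hc (HS G) hp.
apply: (@compact_of_cc _
  (fun v => fcalc d2 (S G) phi v - fcalc d2 (S setT) phi v) (D + C)).
- by move=> a u v; rewrite fl gl scalerBr opprD addrACA.
- move=> v; apply: le_trans (nrmBD Hip _ _) _; rewrite mulrDl.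
  by apply: lerD; [exact: hD | exact: hC].
- exact: cc_fcalc_finite.
move=> f hf; rewrite /extend0 (laplacianE m_gt0 bc) !functional_calculusE //; last first.
  exact: (l2_restr m_gt0).
rewrite svD svN /fcalc_on; congr (sv _ - _).
(* [extend0] multiplies f by 1_G beforehand, which has no effect on [fcalc]. *)
rewrite -(fc_absorb Hip Hc (HS G) (P := P G) (pk f) hp (cp_SP (HP G)) (cp_nrm (HP G))).
congr fcalc; apply: sv_inj; rewrite restrE !packE //; apply: (l2_T m_gt0 (U := G)).
exact: (l2_restr m_gt0).
Qed.

Lemma ess_setE F : ess_set d2 (P (~` [set` F])) (S (~` [set` F])) =
  ess_set d2 (P setT) (S setT).
Proof.
set G := ~` _.
have key phi : C0 phi -> cc d2 (fcalc d2 (S G) phi) <-> cc d2 (fcalc d2 (S setT) phi).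
  move=> hp; have hd := cc_fcalc_finite F hp; split=> h.
    apply: cc_ext (cc_comb Hip (-1) hd h) => f /=.
    by rewrite scaleN1r opprB subrK.
  apply: cc_ext (cc_comb Hip 1 hd h) => f /=.
  by rewrite scale1r subrK.
have essP U := ess_setP Hip Hc wsc (HS U) (HP U).
apply/seteqP; split=> l hl.
  by apply: (essP setT l).2 => phi hp /(key _ hp).2; exact: ((essP G l).1 hl _ hp).
by apply: (essP G l).2 => phi hp /(key _ hp).1; exact: ((essP setT l).1 hl _ hp).
Qed.

(** Let y = (1 + L)^-1 u. In the form norm, |u|^2 <= 1 + l + e and |y|^2 = <S u, u>. The form domain
    of L_U lies in that of L, so u is a test function for y, and 1 = <u, u> is the form inner
    product of y and u, hence at most |y| |u|. *)
Lemma rayleigh_resolvent U (u f : H2) l e : opgraph (P U) (S U) (u, f) ->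
  nrm d2 u = 1 -> nrm d2 (f - l *: u) < e -> (1 + (l + e))^-1 <= d2 (S setT u) u.
Proof.
move=> uf u1 fe; have [/= _ uE] := uf.
have [hr rE] := resolventP m_gt0 bc U (svP (f + u)).
have svu := congr1 (@sv _ _ _ _) uE; rewrite (resopE bc) in svu.
rewrite -svu in hr rE.
have uu : d2 u u = 1 by rewrite -(nrm_sqr Hip) u1 expr1n.
have nu : n1 (sv u) ^+ 2 <= 1 + (l + e).
  rewrite (ond_nrm_sqr sm1 ip1 (core_dom1 hr)) rE // -[l2dot _ _ _]/(d2 (f + u) u).
  rewrite (dotDl Hip) uu addrC lerD2l -[f](subrK (l *: u)) (dotDl Hip) (dotZl Hip) uu mulr1.
  rewrite addrC lerD2l; apply: le_trans (ler_norm _) _.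
  by apply: le_trans (dot_CS Hip _ _) _; rewrite u1 mulr1 ltW.
have [hy yE] := resolventP m_gt0 bc setT (svP u).
set y := resolvent setT (sv u) in hy yE.
have ny : n1 y ^+ 2 = d2 (S setT u) u.
  rewrite (ond_nrm_sqr sm1 ip1 (core_dom1 hy)) yE // (dotC Hip).
  by rewrite /d2 /sdot (resopE bc).
have y1 : 1 <= n1 y * n1 (sv u).
  rewrite -uu -[d2 u u]/(l2dot m (sv u) (sv u)) -yE; last exact: coreS hr.
  exact: le_trans (ler_norm _) (ond_CS sm1 ip1 (core_dom1 hy) (core_dom1 hr)).
rewrite -ny; move: y1 nu (nrm_ge0 dot1 y) (nrm_ge0 dot1 (sv u)).
move: (n1 y) (n1 (sv u)) (1 + (l + e)) => p q s pq qs p0 q0.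
have q1 : 0 < q by rewrite lt_neqAle q0 andbT; apply/eqP => q2; move: pq; rewrite -q2; lra.
have s0 : 0 < s by apply: lt_le_trans qs; exact: exprn_gt0.
by rewrite -[leLHS]mul1r ler_pdivrMr //; nra.
Qed.

Lemma spectrum_lower_bound a a0 : (forall l, ess_set d2 (P setT) (S setT) l -> a <= l) ->
  a0 < a -> exists K0 : {fset X}, forall K : {fset X}, (K0 `<=` K)%fset ->
  forall l, ~ res_set d2 (P (~` [set` K])) (S (~` [set` K])) l -> a0 <= l.
Proof.
move=> ha a0a; have [a00|a00] := ltP a0 0.
  exists fset0 => K _ l hl; apply: ltW; apply: lt_le_trans a00 _.
  by rewrite leNgt; apply/negP => l0; apply: hl; exact: (neg_res Hip Hc (HS _) (HP _)).
apply: contrapT => hn.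
have /choice[K hK] : forall n, exists K : {fset X}, (forall x, (choice.pickle x < n)%N -> x \in K) /\
    exists2 l, ~ res_set d2 (P (~` [set` K])) (S (~` [set` K])) l & l < a0.
  move=> n; apply: contrapT => hK; apply: hn.
  (* These are the points with code less than n, so that every point belongs to [K n] for all large
     n and the u_n vanish there. *)
  exists [fset x in pmap choice.unpickle (iota 0 n)]%fset => K K0K l hl.
  rewrite leNgt; apply/negP => la0; apply: hK; exists K; split; last by exists l.
  move=> x xn; apply: (fsubsetP K0K); rewrite !inE mem_pmap; apply/mapP.
  by exists (choice.pickle x); rewrite ?mem_iota ?choice.pickleK.
have /choice[u hu] : forall n, exists u : H2, [/\ l2 m (~` [set` K n]) (sv u), nrm d2 u = 1 &
    (1 + a0)^-1 <= d2 (S setT u) u].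
  move=> n; have [_ [l hl la0]] := hK n.
  have e0 : 0 < a0 - l by rewrite subr_gt0.
  have [u [f [uf u1 fe]]] := spectrum_approx Hip Hc (HS _) (HP _) hl e0.
  exists u; split=> //.
    by have [_ h _] := (laplacian_onE m_gt0 bc _ _ _).1 ((opgraph_laplacian bc _ _ _).1 uf).
  by have := rayleigh_resolvent uf u1 fe; rewrite (addrC l) subrK.
apply: (wnull_rayleigh Hip Hc (HS setT) (HP setT) ha a00 a0a (u := u)).
- apply: (wnull_pointwise (C := 1)) => [n|x]; first by have [_ -> _] := hu n.
  apply/cvg0P => e e0; exists (choice.pickle x).+1 => n xn.
  have [/(l2E m_gt0)[_ h] _ _] := hu n; rewrite h ?normr0 //= => nK; apply: nK.
  by have [h' _] := hK n; exact: h'.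
- by move=> n; have [] := hu n.
- by move=> n; have [] := hu n.
Qed.

(** Extended reals are forced by the limit +oo for empty essential spectrum. As all values are at
    most y, only eventual lower bounds have to be checked. *)
Lemma ereal_cvg_below {T} {G : set_system T} {FG : Filter G} (h : T -> \bar R) y :
  (forall t, (h t <= y)%E) -> (-oo < y)%E ->
  (forall a, (a%:E < y)%E -> \forall t \near G, (a%:E <= h t)%E) ->
  h t @[t --> G] --> y.
Proof.
move=> hy y0 hG A; case: y => [r| |] in hy y0 hG * => //.
- move=> rA; have /nbhs_ballP[e /= e0 hA] : nbhs r (fun x => A x%:E) by exact: rA.
  have : \forall t \near G, ((r - e / 2)%:E <= h t)%E.
    by apply: hG; rewrite lte_fin; lra.
  apply: filterS => t; have := hy t; rewrite /= /fmap /=.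
  case: (h t) => [s| |] //; rewrite !lee_fin => h1 h2.
  by apply: hA; rewrite /ball /= ltr_norml; apply/andP; split; lra.
- move=> [M [_ hA]]; have := hG (M + 1) (ltry _); apply: filterS => t h1.
  by apply: hA; apply: lt_le_trans h1; rewrite lte_fin ltrDl.
Qed.

Lemma cvg_inf_spectrum :
  (fun K : {fset X} => ereal_inf (EFin @` spectrum m (~` [set` K]) (L (~` [set` K]))))
    @ summability.totally --> ereal_inf (EFin @` ess_spectrum m setT (L setT)).
Proof.
have specE U : spectrum m U (L U) = ~` res_set d2 (P U) (S U).
  by rewrite /spectrum (res_setE m_gt0 bc).
rewrite ess_spectrumE.
have FG : Filter (@summability.totally X) by apply: filter_filter; exact: summability.totally_filter.
apply: ereal_cvg_below => [K| |a0 ha0].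
- apply: ereal_inf_le_tmp => _ [l hl <-]; exists l => //.
  by rewrite specE; move: hl; rewrite -(ess_setE K) => -[].
- apply: (@lt_le_trans _ _ 0%E) => //; apply: le_ereal_inf_tmp => _ [l hl <-].
  rewrite lee_fin; exact: (ess_ge0 Hip Hc (HS setT) (HP setT) hl).
(* A real a strictly above a0 is required; if the infimum is +oo, a0 + 1 serves. *)
have [a a0a ha] : exists2 a : R, a0 < a &
    forall l, ess_set d2 (P setT) (S setT) l -> a <= l.
  have lb l : ess_set d2 (P setT) (S setT) l ->
      (ereal_inf (EFin @` ess_set d2 (P setT) (S setT)) <= l%:E)%E.
    by move=> hl; apply: ereal_inf_lbound; exists l.
  move: ha0 lb; case: ereal_inf => [r| |] //.
    by rewrite lte_fin => ar lb; exists r => // l /lb; rewrite lee_fin.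
  by move=> _ lb; exists (a0 + 1) => [|l /lb]; rewrite ?ltrDl.
have [K0 hK0] := spectrum_lower_bound ha a0a.
exists K0 => // K hK; apply: le_ereal_inf_tmp => _ [l hl <-].
by rewrite lee_fin; apply: (hK0 K hK); rewrite specE in hl.
Qed.

End GraphLaplacian.

Theorem corollary4p4 (R : realType) (X : countType)
    (m : X -> R) (b : X -> X -> R) (c : X -> R)
    (m_gt0 : forall x, 0 < m x)
    (bc_graph : is_graph b c)
    (m_bounded_below : exists2 d : R, 0 < d & forall x, d <= m x) :
  let L := laplacian m b c in
  spatially_locally_compact m L /\
  (forall B : set X, (capacity m b c B < +oo)%E ->
     let G := ~` B in
     let L_G := laplacian_on m b c G in
     (forall phi : R -> R, C0 phi ->
        compact_op m (fun f => extend0 G (functional_calculus m G L_G phi) f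
                               - functional_calculus m setT L phi f)) /\
     ess_spectrum m G L_G = ess_spectrum m setT L) /\
  (fun K : {fset X} =>
     let U := ~` [set` K] in
     ereal_inf (EFin @` spectrum m U (laplacian_on m b c U)))
    @ summability.totally --> ereal_inf (EFin @` ess_spectrum m setT L).
Proof.
move=> L; have [d d0 hd] := m_bounded_below; split; last split.
(* The function 1_E is in l^2(X, m) because m(E) is finite. *)
- move=> E hE; have fE : finite_set E.
    apply: (finite_of_l2 m_gt0 d0 hd (u := \1_E)); last first.
      by move=> x Ex; rewrite indicE mem_set.
    split=> [|x []//]; apply: le_lt_trans hE.
    rewrite /mass [leRHS]esum_mkcond; apply: le_esum => x _.
    rewrite indicE; case: (x \in E); first by rewrite expr1n mulr1.
    by rewrite expr0n mulr0.
  have [F ->] := finite_fsetP.1 fE.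
  apply: (compact_restr_fcalc m_gt0 bc_graph F); exact: C0_expRNnorm.
- move=> B hB; have fB : finite_set B.
    (* Without an admissible v the capacity would be the infimum of the empty set, +oo. *)
    have [v [hv Bv]] : exists v, form_dom m b c v /\ forall x, \1_B x <= v x.
      apply: contrapT => hn; move: hB; rewrite /capacity.
      rewrite (_ : [set _ | _ in _] = set0) ?ereal_inf0 ?ltxx //.
      by apply/seteqP; split=> // y [v hv _]; apply: hn; exists v.
    apply: (finite_of_l2 m_gt0 d0 hd (proj1 hv)) => x Bx.
    by have := Bv x; rewrite indicE mem_set.
  have [F BF] := finite_fsetP.1 fB; rewrite {}BF => {hB fB} G L_G.
  split=> [phi hphi|]; first exact: (compact_fcalc_diff m_gt0 bc_graph F hphi).
  by rewrite /L (laplacianE m_gt0 bc_graph) !(ess_spectrumE m_gt0 bc_graph) ess_setE.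
rewrite /L (laplacianE m_gt0 bc_graph); exact: cvg_inf_spectrum.
Qed.
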